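(* Let $n\ge 2$, $p>1$, $\Omega\subset\mathbb{R}^n$ a bounded open set, $\{w_1,w_2,\dots\}$ a Schauder basis of $W^{1,p}_0(\Omega)$, and $m\ge 1$. Let $F:(\mathbb{R}^m,\|\cdot\|_{1,p,m})\to(\mathbb{R}^m,\|\cdot\|_{1,p,m})$ be continuous, and suppose there is $\varrho>0$ such that $\langle F(\zeta),\zeta\rangle\ge 0$ for every $\zeta\in\mathbb{R}^m$ with $\lfloor\zeta\rfloor_m=\varrho$. Then there exists $z_0$ in the closed affine ball $\overline{B}^m_\varrho(0)=\{z\in\mathbb{R}^m:\lfloor z\rfloor_m\le\varrho\}$ such that $F(z_0)=0$.
   Context: For $u\in W^{1,p}_0(\Omega)$ and $\xi\in\mathbb{S}^{n-1}$, $\nabla_\xi u=\nabla u\cdot\xi$. The affine $L^p$ energy is $\mathcal{E}_{p,\Omega}(u)=\gamma_{n,p}\left(\int_{\mathbb{S}^{n-1}}\|\nabla_\xi u\|_{L^p(\Omega)}^{-n}\,d\sigma(\xi)\right)^{-1/n}$, where $\sigma$ is the surface measure on $\mathbb{S}^{n-1}$, $\gamma_{n,p}=(2\omega_{n+p-2})^{-1}(n\omega_n\omega_{p-1})(n\omega_n)^{p/n}$, $\omega_\kappa$ is the volume of the unit Euclidean ball in $\mathbb{R}^\kappa$ (extended to real $\kappa$ via the Gamma function), and $\mathcal{E}_{p,\Omega}(0)=0$. For $\zeta=(\zeta_1,\dots,\zeta_m)\in\mathbb{R}^m$ set $\lfloor\zeta\rfloor_m=\mathcal{E}_{p,\Omega}\big(\sum_{j=1}^m\zeta_jw_j\big)$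 (this is not a norm) and $\|\zeta\|_{1,p,m}=\big\|\sum_{j=1}^m\zeta_jw_j\big\|_{W^{1,p}_0(\Omega)}$, which is a norm on $\mathbb{R}^m$. $\langle\cdot,\cdot\rangle$ is the Euclidean inner product on $\mathbb{R}^m$, with $\langle x,x\rangle^{1/2}=|x|_2$. *)

(* Defs.v *)
From Stdlib Require Import ClassicalEpsilon.
From mathcomp Require Import all_boot all_order all_algebra.
From mathcomp Require Import all_classical all_reals all_analysis.
Import Order.TTheory GRing.Theory Num.Theory numFieldNormedType.Exports.

Set Implicit Arguments.
Unset Strict Implicit.
Unset Printing Implicit Defensive.

Local Open Scope classical_set_scope.
Local Open Scope ring_scope.

Definition coord_upd (R : realType) (x : nat -> R) (k : nat) (t : R) : nat -> R :=
  fun i => if i == k then t else x i.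

(* iterated one-dimensional Lebesgue integrals; for nonnegative Borel
   functions this is the n-dimensional Lebesgue integral (Tonelli) *)
Fixpoint iter_int (R : realType) (k : nat) (F : (nat -> R) -> \bar R) : \bar R :=
  match k with
  | 0 => F (fun _ => 0)
  | k'.+1 => iter_int k'
      (fun x => (\int[@lebesgue_measure R]_t F (coord_upd x k' t))%E)
  end.

Definition Rn_int (R : realType) (n : nat) (f : 'rV[R]_n -> \bar R) : \bar R :=
  iter_int n (fun x => f (\row_(i < n) x i)).

(* signed integral over R^n of a real function (meaningful when integrable) *)
Definition Rn_sint (R : realType) (n : nat) (f : 'rV[R]_n -> R) : R :=
  fine (Rn_int (fun x => (Num.max (f x) 0)%:E)) -
  fine (Rn_int (fun x => (Num.max (- f x) 0)%:E)).

Definition borel_rn (R : realType) (n : nat) : set (set 'rV[R]_n) :=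
  <<s [set A : set 'rV[R]_n | open A] >>.

Definition meas_rn (R : realType) (n : nat) (f : 'rV[R]_n -> R) : Prop :=
  forall B : set R, measurable B -> @borel_rn R n (f @^-1` B).

Definition enorm (R : realType) (n : nat) (x : 'rV[R]_n) : R :=
  Num.sqrt (\sum_(i < n) x ord0 i ^+ 2).

Definition Lp_int (R : realType) (n : nat) (p : R) (O : set 'rV[R]_n)
  (f : 'rV[R]_n -> R) : \bar R :=
  Rn_int (fun x => (\1_O x * powR `|f x| p)%:E).

(* ||f||_{L^p(Omega)} (for f in L^p(Omega)) *)
Definition Lp_norm (R : realType) (n : nat) (p : R) (O : set 'rV[R]_n)
  (f : 'rV[R]_n -> R) : R :=
  powR (fine (Lp_int p O f)) p^-1.

Definition unitv (R : realType) (n : nat) (i : 'I_n) : 'rV[R]_n := delta_mx 0 i.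

Fixpoint Ck (R : realType) (n : nat) (k : nat) (f : 'rV[R]_n -> R) : Prop :=
  continuous f /\
  match k with
  | 0 => True
  | k'.+1 => forall i : 'I_n,
      (forall x, derivable f x (unitv R i)) /\ Ck k' ('D_(unitv R i) f)
  end.

Definition test_fun (R : realType) (n : nat) (O : set 'rV[R]_n)
  (phi : 'rV[R]_n -> R) : Prop :=
  (forall k, Ck k phi) /\
  compact (closure [set x | phi x != 0]) /\
  closure [set x | phi x != 0] `<=` O.

Definition weak_grad (R : realType) (n : nat) (p : R) (O : set 'rV[R]_n)
  (u : 'rV[R]_n -> R) (g : 'I_n -> 'rV[R]_n -> R) : Prop :=
  (forall i, meas_rn (g i) /\ (Lp_int p O (g i) < +oo)%E) /\
  forall phi, test_fun O phi -> forall i : 'I_n,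
    Rn_sint (fun x => u x * 'D_(unitv R i) phi x) =
    - Rn_sint (fun x => g i x * phi x).

Definition W1p (R : realType) (n : nat) (p : R) (O : set 'rV[R]_n)
  (u : 'rV[R]_n -> R) : Prop :=
  meas_rn u /\ (Lp_int p O u < +oo)%E /\ exists g, weak_grad p O u g.

(* a (chosen) weak gradient; unique up to null sets *)
Definition wgrad (R : realType) (n : nat) (p : R) (O : set 'rV[R]_n)
  (u : 'rV[R]_n -> R) : 'I_n -> 'rV[R]_n -> R :=
  epsilon (inhabits (fun _ _ => 0)) (weak_grad p O u).

Definition W_norm (R : realType) (n : nat) (p : R) (O : set 'rV[R]_n)
  (u : 'rV[R]_n -> R) : R :=
  Lp_norm p O u +
  Lp_norm p O (fun x => enorm (\row_(i < n) wgrad p O u i x)).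

Definition W0 (R : realType) (n : nat) (p : R) (O : set 'rV[R]_n)
  : set ('rV[R]_n -> R) :=
  [set u | W1p p O u /\
     exists phi : nat -> 'rV[R]_n -> R, (forall k, test_fun O (phi k)) /\
       (fun k => W_norm p O (u \- phi k)) @ \oo --> (0 : R)].

Definition lincomb (R : realType) (n : nat) (c : nat -> R)
  (w : nat -> 'rV[R]_n -> R) (N : nat) : 'rV[R]_n -> R :=
  fun x => \sum_(j < N) c j * w j x.

(* {w_1, w_2, ...} (here w 0, w 1, ...) is a Schauder basis of W^{1,p}_0 *)
Definition schauder_basis (R : realType) (n : nat) (p : R) (O : set 'rV[R]_n)
  (w : nat -> 'rV[R]_n -> R) : Prop :=
  (forall j, W0 p O (w j)) /\
  forall u, W0 p O u ->
    exists! c : nat -> R,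
      (fun N => W_norm p O (u \- lincomb c w N)) @ \oo --> (0 : R).

Definition dir_grad (R : realType) (n : nat) (p : R) (O : set 'rV[R]_n)
  (u : 'rV[R]_n -> R) (xi : 'rV[R]_n) : 'rV[R]_n -> R :=
  fun x => \sum_(i < n) xi ord0 i * wgrad p O u i x.

(* integral over S^{n-1} w.r.t. surface measure, via polar coordinates:
   int_{S^{n-1}} h dsigma = n * int_{0 < |x| <= 1} h(x/|x|) dx *)
Definition sphere_int (R : realType) (n : nat) (h : 'rV[R]_n -> \bar R) : \bar R :=
  (n%:R%:E * Rn_int (fun x : 'rV[R]_n =>
     if ((0 < enorm x) && (enorm x <= 1))%R then h ((enorm x)^-1 *: x)
     else 0%E))%E.

Definition Gamma (R : realType) (s : R) : R :=
  fine (\int[@lebesgue_measure R]_(t in `]0%R, +oo[)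
          (powR t (s - 1) * expR (- t))%:E)%E.

Definition omega (R : realType) (k : R) : R :=
  powR pi (k / 2) / Gamma (k / 2 + 1).

Definition gamma_np (R : realType) (n : nat) (p : R) : R :=
  (2 * omega (n%:R + p - 2))^-1 * (n%:R * omega n%:R * omega (p - 1)) *
  powR (n%:R * omega n%:R) (p / n%:R).

Definition affine_int (R : realType) (n : nat) (p : R) (O : set 'rV[R]_n)
  (u : 'rV[R]_n -> R) : \bar R :=
  sphere_int (fun xi =>
    let a := Lp_norm p O (dir_grad p O u xi) in
    if a == 0 then +oo%E else (powR a (- n%:R))%:E).

(* E_{p,Omega}(u); equals 0 for u = 0 (where the integral is +oo) *)
Definition affine_energy (R : realType) (n : nat) (p : R) (O : set 'rV[R]_n)
  (u : 'rV[R]_n -> R) : R :=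
  let I := affine_int p O u in
  if I == +oo%E then 0 else gamma_np n p * powR (fine I) (- (n%:R)^-1).

Definition combo (R : realType) (n m : nat) (w : nat -> 'rV[R]_n -> R)
  (z : 'rV[R]_m) : 'rV[R]_n -> R :=
  fun x => \sum_(j < m) z ord0 j * w j x.

Definition affine_floor (R : realType) (n : nat) (p : R) (O : set 'rV[R]_n)
  (w : nat -> 'rV[R]_n -> R) (m : nat) (z : 'rV[R]_m) : R :=
  affine_energy p O (combo w z).

Definition norm1pm (R : realType) (n : nat) (p : R) (O : set 'rV[R]_n)
  (w : nat -> 'rV[R]_n -> R) (m : nat) (z : 'rV[R]_m) : R :=
  W_norm p O (combo w z).

Definition inner (R : realType) (m : nat) (x y : 'rV[R]_m) : R :=
  \sum_(j < m) x ord0 j * y ord0 j.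

(* Main.v *)
(* The map [z |-> affine_floor z] is not a norm, but it is continuous,
   positively homogeneous and bounded below by a positive multiple of [|z|].
   For such a function [g] the statement follows from the Poincaré-Miranda
   theorem applied to [F (r z) + z - r z], where [r] is the radial retraction
   onto [{g <= rho}]: at a zero with [z] outside the ball, [F (r z)] is a negative
   multiple of [r z] although [g (r z) = rho].

   The lower bound holds because [||D_xi u_z||_p >= c |z| |xi|], by compactness,
   as soon as the left side vanishes only for [z = 0] or [xi = 0].  If [u] is in
   [W0] and [D_xi u = 0], translate test functions by a multiple [eta] of [xi]
   that moves the bounded domain off itself: this gives
   [||phi||_p <= ||phi (. + eta) - phi||_p <= ||D_eta phi||_p], and approximating
   [u] by test functions yields [u = 0]; the uniqueness of the expansion in the
   basis then gives [z = 0].  Continuity of the energy follows from its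
   monotonicity and homogeneity in [xi |-> ||D_xi u_z||_p]: moving [z] changes this
   function by a factor close to 1, uniformly in [xi]. *)
From HB Require Import structures.
From Stdlib Require ClassicalEpsilon.
Require Import Defs.
From mathcomp Require Import all_boot all_order all_algebra.
From mathcomp Require Import all_classical all_reals all_analysis.
From mathcomp Require Import measurable_realfun ring lra.
Import Order.TTheory GRing.Theory Num.Theory numFieldNormedType.Exports.
Local Open Scope classical_set_scope.
Local Open Scope ring_scope.
Set Implicit Arguments.
Unset Strict Implicit.
Unset Printing Implicit Defensive.

(** * The Poincaré-Miranda theorem *)

(** Poincaré-Miranda itself is obtained by a parity count. On a grid of the cube each coordinate of
    the map gives a 0/1 label; the mod 2 cup product of the coboundaries of the labels is exact, so
    its sum over all cells reduces to the faces of the cube, where the signs make it odd. Hence some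
    cell sees every coordinate change sign, and a cluster point of such cells is a zero. The
    definitions shape the rest. Integrals over R^n are iterated one-dimensional integrals, so a
    measure [lebn] representing them is built before Minkowski, dominated convergence or translation
    invariance can be used. [wgrad] is an arbitrary choice among weak gradients, hence linear only
    up to null sets, and its agreement with the classical gradient of a test function rests on
    integration by parts and on uniqueness of weak gradients. Uniqueness is the fundamental lemma of
    the calculus of variations, which requires enough test functions; these are products of
    one-dimensional bumps, whose partial derivatives of every order, as [Ck] asks, are again
    products of smooth functions. *)

Definition lupd (x : nat -> nat) (i v : nat) : nat -> nat :=
  fun j => if j == i then v else x j.

Definition lshift1 (x : nat -> nat) (i : nat) : nat -> nat := lupd x i (x i).+1.

(* The mod 2 cup product of the coboundaries of the 0-cochains in [s], evaluated
   on the lattice cube based at [x] and spanned by the directions in [I]. *)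
Fixpoint cup (s : seq ((nat -> nat) -> bool)) (I : seq nat) (x : nat -> nat) : bool :=
  if s is a :: s' then
    \big[addb/false]_(i <- I)
      ((a (lshift1 x i) (+) a x) && cup s' (rem i I) (lshift1 x i))
  else true.

(** Cells are indexed by their lowest vertex, so each direction takes the values [0..N-1]; a
    direction left out of [I] keeps its value in [y], which is how a face of the grid is
    selected. *)
Fixpoint box_sum (N : nat) (I : seq nat) (f : (nat -> nat) -> bool) (y : nat -> nat) : bool :=
  if I is i :: I' then \big[addb/false]_(t < N) box_sum N I' f (lupd y i t) else f y.

Lemma lupdC (x : nat -> nat) i j u v : i != j -> lupd (lupd x i u) j v = lupd (lupd x j v) i u.
Proof.
move=> ij; apply/funext => k; rewrite /lupd.
by case: (eqVneq k j) => [->|//]; rewrite eq_sym (negbTE ij).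
Qed.

Lemma lupd_lupd (x : nat -> nat) i u v : lupd (lupd x i u) i v = lupd x i v.
Proof. by apply/funext => k; rewrite /lupd; case: eqP. Qed.

Lemma lshift1C (x : nat -> nat) i j : lshift1 (lshift1 x i) j = lshift1 (lshift1 x j) i.
Proof.
case: (eqVneq i j) => [->//|ij].
have ji : (j == i) = false by rewrite eq_sym (negbTE ij).
have uj u : lupd x i u j = x j by rewrite /lupd ji.
have ui u : lupd x j u i = x i by rewrite /lupd (negbTE ij).
by rewrite /lshift1 uj ui lupdC.
Qed.

Lemma remC (I : seq nat) i j : uniq I -> rem i (rem j I) = rem j (rem i I).
Proof.
move=> uI; rewrite !(rem_filter, filter_uniq)// -!filter_predI.
by apply: eq_filter => k /=; rewrite andbC.
Qed.

(** Modulo 2 the terms [(i, j)] and [(j, i)] cancel. *)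
Lemma big_addb_sym (I : seq nat) (f : nat -> nat -> bool) : uniq I ->
  (forall i j, f i j = f j i) ->
  \big[addb/false]_(i <- I) \big[addb/false]_(j <- rem i I) f i j = false.
Proof.
elim: I => [|k I IH] /=; first by rewrite big_nil.
case/andP => kI uI fC; rewrite big_cons eqxx.
have -> : \big[addb/false]_(i <- I) \big[addb/false]_(j <- (if k == i then I else k :: rem i I)) f i j
  = \big[addb/false]_(i <- I) (f k i (+) \big[addb/false]_(j <- rem i I) f i j).
  apply: eq_big_seq => i iI; case: eqVneq => [ki|_]; first by rewrite ki iI in kI.
  by rewrite big_cons fC.
by rewrite big_split /= IH // addbF addbb.
Qed.

(** In the induction the double sum over [i] and [j] splits into a term symmetric in both, which
    cancels modulo 2, and a term that for fixed [j] is the induction hypothesis at [lshift1 x j].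
    This is the cocycle property of a cup product of coboundaries. *)
Lemma cup_closed s I x : uniq I ->
  \big[addb/false]_(i <- I) (cup s (rem i I) (lshift1 x i) (+) cup s (rem i I) x) = false.
Proof.
elim: s I x => [|a s IH] I x uI /=; first by rewrite big1.
transitivity (\big[addb/false]_(i <- I) \big[addb/false]_(j <- rem i I)
   ((a (lshift1 (lshift1 x i) j) (+) a (lshift1 x i) (+) a (lshift1 x j) (+) a x) &&
      cup s (rem j (rem i I)) (lshift1 (lshift1 x i) j)
    (+) ((a (lshift1 x j) (+) a x) && (cup s (rem j (rem i I)) (lshift1 (lshift1 x i) j)
     (+) cup s (rem j (rem i I)) (lshift1 x j))))).
  apply: eq_bigr => i _; rewrite -big_split /=; apply: eq_bigr => j _.
  by do 4 case: (a _); do 3 case: (cup _ _ _).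
under eq_bigr do rewrite big_split /=.
rewrite big_split /= big_addb_sym //; last first.
  move=> i j; rewrite lshift1C remC //; congr (_ && _).
  by do 4 case: (a _).
rewrite addFb.
have ex (f : nat -> nat -> bool) : \big[addb/false]_(i <- I) \big[addb/false]_(j <- rem i I) f i j =
   \big[addb/false]_(j <- I) \big[addb/false]_(i <- rem j I) f i j.
  transitivity (\big[addb/false]_(i <- I) \big[addb/false]_(j <- I | j != i) f i j).
    by apply: eq_bigr => i _; rewrite rem_filter // big_filter.
  rewrite (exchange_big_dep predT) //=; apply: eq_bigr => j _.
  by rewrite rem_filter // big_filter; apply: eq_bigl => i; rewrite eq_sym.
rewrite ex big1_seq // => j /andP[_ jI].
under eq_bigr do rewrite remC // lshift1C -/(lshift1 _ _).
by rewrite -big_distrr /= IH ?rem_uniq // andbF.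
Qed.

Lemma box_sum_eq N I f g y : (forall x, f x = g x) -> box_sum N I f y = box_sum N I g y.
Proof. by move=> fg; congr box_sum; apply/funext. Qed.

Lemma box_sum_addb N I f g y :
  box_sum N I (fun x => f x (+) g x) y = box_sum N I f y (+) box_sum N I g y.
Proof.
elim: I y => [//|i I IH] y /=; rewrite -big_split /=.
by apply: eq_bigr => t _; rewrite IH.
Qed.

Lemma box_sum0 N I y : box_sum N I (fun=> false) y = false.
Proof. by elim: I y => [//|i I IH] y /=; rewrite big1. Qed.

Lemma box_sum_big N I (J : seq nat) (f : nat -> (nat -> nat) -> bool) y :
  box_sum N I (fun x => \big[addb/false]_(i <- J) f i x) y =
  \big[addb/false]_(i <- J) box_sum N I (f i) y.
Proof.
elim: J => [|j J IH].
  by rewrite big_nil -[RHS](box_sum0 N I y); apply: box_sum_eq => x; rewrite big_nil.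
rewrite big_cons -IH -box_sum_addb; apply: box_sum_eq => x; by rewrite big_cons.
Qed.

Lemma box_sum_rem N I i f y : uniq I -> i \in I ->
  box_sum N I f y = \big[addb/false]_(t < N) box_sum N (rem i I) f (lupd y i t).
Proof.
elim: I y => [//|j I IH] y /= /andP[jI uI].
rewrite in_cons; case: (eqVneq j i) => [<- _ //|ji] /= iI.
rewrite [RHS]exchange_big /=; apply: eq_bigr => t _; rewrite IH //.
by apply: eq_bigr => u _; rewrite lupdC.
Qed.

Lemma addb_telescope N (g : nat -> bool) :
  \big[addb/false]_(t < N) (g t.+1 (+) g t) = g N (+) g 0%N.
Proof.
elim: N => [|N IH]; first by rewrite big_ord0 addbb.
by rewrite big_ord_recr /= IH; do 3 case: (g _).
Qed.

Lemma lshift1_lupd x i t : lshift1 (lupd x i t) i = lupd x i t.+1.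
Proof. by rewrite /lshift1 lupd_lupd (_ : lupd x i t i = t) // /lupd eqxx. Qed.

Lemma box_sum_shift N I i f y t : i \notin I ->
  box_sum N I (fun x => f (lshift1 x i)) (lupd y i t) = box_sum N I f (lupd y i t.+1).
Proof.
elim: I y => [|j I IH] y /=; first by rewrite lshift1_lupd.
rewrite in_cons negb_or => /andP[ij iI]; apply: eq_bigr => u _.
by rewrite !(lupdC _ _ _ ij) IH.
Qed.

Lemma box_sum_diff N I i f y : uniq I -> i \in I ->
  box_sum N I (fun x => f (lshift1 x i) (+) f x) y =
  box_sum N (rem i I) f (lupd y i N) (+) box_sum N (rem i I) f (lupd y i 0).
Proof.
move=> uI iI; rewrite (@box_sum_rem N I i) // -(addb_telescope N (fun t => box_sum N (rem i I) f (lupd y i t))).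
apply: eq_bigr => t _.
by rewrite box_sum_addb box_sum_shift // mem_rem_uniq // inE /= eqxx.
Qed.

(** Discrete Stokes: since [cup s] is closed, [cup (a :: s)] is the coboundary of [a] times [cup s],
    and the sum over the cells telescopes in each direction. *)
Lemma box_sum_stokes N a s I y : uniq I ->
  box_sum N I (cup (a :: s) I) y =
  \big[addb/false]_(i <- I)
    (box_sum N (rem i I) (fun x => a x && cup s (rem i I) x) (lupd y i N) (+)
     box_sum N (rem i I) (fun x => a x && cup s (rem i I) x) (lupd y i 0)).
Proof.
move=> uI.
transitivity (box_sum N I (fun x => \big[addb/false]_(i <- I)
   ((a (lshift1 x i) && cup s (rem i I) (lshift1 x i)) (+) (a x && cup s (rem i I) x))) y).
  apply: box_sum_eq => x /=.
  (* Add [a x] times the vanishing sum of [cup_closed]; each term becomes a difference of one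
     function at two neighbouring points. *)
  rewrite -[LHS]addbF -[X in _ (+) X = _](andbF (a x)).
  rewrite -[X in _ (+) (_ && X) = _](cup_closed s x uI).
  rewrite big_distrr -big_split /=; apply: eq_bigr => i _.
  by do 2 case: (a _); do 2 case: (cup _ _ _).
rewrite box_sum_big; apply: eq_big_seq => i iI.
exact: (box_sum_diff N (fun x => a x && cup s (rem i I) x)).
Qed.

Lemma box_sum_ext N I f g y :
  (forall x, (forall j, j \in I -> x j < N)%N -> (forall j, j \notin I -> x j = y j) -> f x = g x) ->
  box_sum N I f y = box_sum N I g y.
Proof.
elim: I y => [|i I IH] y fg /=; first exact: fg.
apply: eq_bigr => t _; apply: IH => x xI xy; apply: fg => j; rewrite in_cons.
- case jI : (j \in I); first by move=> _; exact: xI.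
  rewrite orbF => /eqP ji; rewrite xy ?jI // /lupd ji eqxx; exact: ltn_ord.
- by rewrite negb_or => /andP[ji jI]; rewrite xy // /lupd (negbTE ji).
Qed.

(* [cup] vanishes as soon as one of its entries is constant on the face spanned
   by the remaining directions. *)
Lemma cup_const s (I : seq nat) a x (k : nat) : (k < size s)%N -> nth (fun=> false) s k = a ->
  (forall z, (forall j, j \notin I -> z j = x j) -> a z = a x) ->
  cup s I x = false.
Proof.
elim: s I x k => [//|b s IH] I x [|k] /= ks na cst; apply: big1_seq => i /andP[_ iI].
  have -> : b (lshift1 x i) = b x.
    by rewrite na; apply: cst => j jI; rewrite /lshift1 /lupd; case: eqP jI => // ->; rewrite iI.
  by rewrite addbb.
rewrite (IH _ _ k ks na) ?andbF // => z zx.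
have sx j : j \notin I -> lshift1 x i j = x j.
  by rewrite /lshift1 /lupd; case: eqP => // ->; rewrite iI.
rewrite (cst z); last first.
  move=> j jI; rewrite -sx // zx //; apply: contra jI; exact: mem_rem.
by rewrite (cst (lshift1 x i)).
Qed.

Definition separated N (a : nat -> (nat -> nat) -> bool) (I : seq nat) :=
  forall i x, i \in I ->
    (x i = 0%N -> a i x = false) /\ (x i = N -> a i x = true).

(** Induction on the dimension through [box_sum_stokes]. On the faces normal to another direction
    [i] the label [a i] is constant and the cup product vanishes; on the face [x k = 0] the factor
    [a k] is 0; on [x k = N] it is 1, which leaves the same sum one dimension lower. *)
Lemma box_sum_cup1 N a I y : uniq I -> separated N a I ->
  box_sum N I (cup [seq a i | i <- I] I) y.
Proof.
elim: I y => [//|k I IH] y ukI sep; have /andP[kI uI] := ukI.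
rewrite map_cons box_sum_stokes // big_cons /= eqxx.
rewrite [X in _ (+) X]big1_seq => [|i /andP[_ iI]]; last first.
  have ki : k != i by apply: contraNneq kI => ->.
  have ei : (k == i) = false by apply: negbTE.
  have idx : (index i I < size [seq a i | i <- I])%N by rewrite size_map index_mem.
  have nthi : nth (fun=> false) [seq a i | i <- I] (index i I) = a i.
    by rewrite (nth_map 0%N) ?index_mem // nth_index.
  have iNr : i \notin rem i (k :: I) by rewrite mem_rem_uniq ?inE ?eqxx //= kI.
  rewrite /= ei in iNr *.
  have [siN si0] : (forall x, x i = 0%N -> a i x = false) /\ (forall x, x i = N -> a i x = true).
    by split => x; have [] := sep i x; rewrite ?in_cons ?iI ?orbT.
  suff face v b : (forall x, x i = v -> a i x = b) ->
     box_sum N (k :: rem i I) (fun x => a k x && cup [seq a i | i <- I] (k :: rem i I) x)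
       (lupd y i v) = false by rewrite !(face _ _ siN) (face _ _ si0).
  move=> hv; rewrite -[RHS](box_sum0 N (k :: rem i I) (lupd y i v)).
  apply: box_sum_ext => x _ xy.
  have xi : x i = v by rewrite xy // /lupd eqxx.
  rewrite (cup_const idx nthi) ?andbF // => z zx.
  by rewrite (hv x) // hv // zx.
have [skN sk0] : (forall x, x k = 0%N -> a k x = false) /\ (forall x, x k = N -> a k x = true).
  by split => x; have [] := sep k x; rewrite ?in_cons ?eqxx.
rewrite addbF.
have -> : box_sum N I (fun x => a k x && cup [seq a i | i <- I] I x) (lupd y k 0) = false.
  rewrite -[RHS](box_sum0 N I (lupd y k 0)); apply: box_sum_ext => x _ xy.
  by rewrite skN // xy // /lupd eqxx.
rewrite addbF (_ : box_sum _ _ _ _ = box_sum N I (cup [seq a i | i <- I] I) (lupd y k N)).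
  by apply: IH => // i x iI; apply: sep; rewrite in_cons iI orbT.
by apply: box_sum_ext => x _ xy; rewrite sk0 // xy // /lupd eqxx.
Qed.

Lemma box_sum_witness N I f y : box_sum N I f y ->
  exists x, [/\ f x, forall j, j \in I -> (x j < N)%N & forall j, j \notin I -> x j = y j].
Proof.
move=> h; apply: contrapT => nex.
suff : box_sum N I f y = false by rewrite h.
rewrite -(box_sum0 N I y); apply: box_sum_ext => x xI xy.
by apply/negP => fx; apply: nex; exists x.
Qed.

(** A nonzero term of [cup] is a path of edges through the cube, and along its [k]-th edge the
    [k]-th label changes. The bounds say that both ends are vertices of the cube spanned by [I] at
    [x]. *)
Lemma cup_witness s I x : uniq I -> cup s I x ->
  forall k, (k < size s)%N -> exists u v,
    [/\ forall j, (x j <= u j <= x j + (j \in I))%N,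
        forall j, (x j <= v j <= x j + (j \in I))%N,
        nth (fun=> false) s k u & ~~ nth (fun=> false) s k v].
Proof.
elim: s I x => [//|a s IH] I x uI /= h k ks.
have [i [iI ai]] : exists i, i \in I /\
    (a (lshift1 x i) (+) a x) && cup s (rem i I) (lshift1 x i).
  apply: contrapT => nex; move: h; rewrite big1_seq // => i /andP[_ iI].
  by apply/negP => h; apply: nex; exists i.
have bx j : (x j <= x j <= x j + (j \in I))%N by rewrite leqnn leq_addr.
have bs j : (x j <= lshift1 x i j <= x j + (j \in I))%N.
  by rewrite /lshift1 /lupd; case: eqP => [->|_]; rewrite ?iI ?addn1 ?leqnSn ?leqnn ?leq_addr.
case: k ks => [|k] /= ks.
  case/andP: ai => + _; case ex : (a x); case es : (a (lshift1 x i)) => // _.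
  - by exists x, (lshift1 x i); rewrite ex es.
  - by exists (lshift1 x i), x; rewrite ex es.
case/andP: ai => _ /(IH _ _ (rem_uniq i uI))/(_ k ks)[u [v [hu hv au av]]].
have tr w : (forall j, lshift1 x i j <= w j <= lshift1 x i j + (j \in rem i I))%N ->
   forall j, (x j <= w j <= x j + (j \in I))%N.
  move=> hw j; move: (hw j); rewrite mem_rem_uniq // inE /lshift1 /lupd.
  case: eqP => [->|_] /=; last by [].
  by rewrite iI addn0 addn1 => /andP[/ltnW -> ->].
by exists u, v; split => //; apply: tr.
Qed.

Lemma lattice_poincare_miranda N m (a : nat -> (nat -> nat) -> bool) :
  (forall i x, (i < m)%N -> (x i = 0%N -> a i x = false) /\ (x i = N -> a i x = true)) ->
  exists x, (forall j, (j < m)%N -> (x j < N)%N) /\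
   forall i, (i < m)%N -> exists u v,
    [/\ forall j, (j < m -> x j <= u j <= (x j).+1)%N,
        forall j, (j < m -> x j <= v j <= (x j).+1)%N, a i u & ~~ a i v].
Proof.
move=> sep; have uI := iota_uniq 0 m.
have sepI : separated N a (iota 0 m) by move=> i x; rewrite mem_iota => /= im; apply: sep.
have [x [cx xN _]] := box_sum_witness (box_sum_cup1 (fun=> 0%N) uI sepI).
exists x; split => [j jm|i im]; first by apply: xN; rewrite mem_iota.
have isz : (i < size [seq a i | i <- iota 0 m])%N by rewrite size_map size_iota.
have [u [v [hu hv au av]]] := cup_witness uI cx isz.
rewrite !(nth_map 0%N) ?size_iota // !nth_iota // in au av.
by exists u, v; split => // j jm; move: (hu j) (hv j); rewrite mem_iota /= jm addn1.
Qed.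

Lemma ball_rV (R : realType) m (c y : 'rV[R]_m) (d : R) :
  0 < d -> (forall j, `|c ord0 j - y ord0 j| < d) -> ball c d y.
Proof. by move=> d0 h; split=> // i j; rewrite ord1; apply: h. Qed.

Section PoincareMiranda.
Context (R : realType) (m : nat) (f : 'rV[R]_m -> 'rV[R]_m) (L : R).
Hypothesis L0 : 0 < L.
Hypothesis fC : continuous f.
Hypothesis f_neg : forall i (x : 'rV[R]_m), (forall j, `|x ord0 j| <= L) -> x ord0 i = - L -> f x ord0 i <= 0.
Hypothesis f_pos : forall i (x : 'rV[R]_m), (forall j, `|x ord0 j| <= L) -> x ord0 i = L -> 0 <= f x ord0 i.

Let pt (N : nat) (v : nat -> nat) : 'rV[R]_m :=
  \row_j (- L + 2 * L * (v j)%:R / N.+1%:R).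

Let pt_cube N (v : nat -> nat) (j : 'I_m) : (v j <= N.+1)%N -> `|pt N v ord0 j| <= L.
Proof.
move=> vN; rewrite mxE ler_norml.
have N0 : 0 < N.+1%:R :> R by rewrite ltr0n.
have h0 : 0 <= 2 * L * (v j)%:R / N.+1%:R by rewrite divr_ge0 // mulr_ge0 // mulr_ge0 // ltW.
have h1 : 2 * L * (v j)%:R / N.+1%:R <= 2 * L.
  by rewrite ler_pdivrMr // ler_pM2l ?mulr_gt0 // ler_nat.
move: (_ / _) h0 h1 => t h0 h1; by apply/andP; split; lra.
Qed.

Let mesh_cube N : exists x : nat -> nat, (forall j : 'I_m, (x j <= N)%N) /\
  forall i : 'I_m, exists u v : 'rV[R]_m,
   [/\ forall j, `|pt N x ord0 j - u ord0 j| <= 2 * L / N.+1%:R,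
       forall j, `|pt N x ord0 j - v ord0 j| <= 2 * L / N.+1%:R,
       0 <= f u ord0 i & f v ord0 i <= 0].
Proof.
(* Boundary labels are set by hand, because the sign of [f] on a face is only weak; [f_neg] and
   [f_pos] supply the matching inequality wherever a label is imposed. *)
pose a (i : nat) (v : nat -> nat) :=
  if v i == 0%N then false else if v i == N.+1 then true else
  [exists i' : 'I_m, (i' == i :> nat) && (0 < f (pt N v) ord0 i')].
have [i x im|x [xN hx]] := @lattice_poincare_miranda N.+1 m a.
  by rewrite /a; split=> ->; rewrite ?eqxx.
exists x; split=> [j|i]; first exact: (xN j (ltn_ord j)).
have [u [v [hu hv au av]]] := hx i (ltn_ord i).
have near w : (forall j, (j < m -> x j <= w j <= (x j).+1)%N) ->
  (forall j : 'I_m, `|pt N x ord0 j - pt N w ord0 j| <= 2 * L / N.+1%:R) /\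
  (forall j : 'I_m, (w j <= N.+1)%N).
  move=> hw; split=> j; have /andP[xw wx] := hw j (ltn_ord j); last first.
    by rewrite (leq_trans wx) // xN.
  rewrite !mxE distrC opprD opprK addrACA addNr add0r -mulrBl -mulrBr.
  rewrite -natrB // ger0_norm; last first.
    by rewrite divr_ge0 // mulr_ge0 // mulr_ge0 // ltW.
  rewrite ler_pM2r ?invr_gt0 //; apply: ler_piMr; first by rewrite mulr_ge0 // ltW.
  by rewrite (ler_nat R _ 1) leq_subLR addn1.
have [hu1 hu2] := near u hu; have [hv1 hv2] := near v hv.
exists (pt N u), (pt N v); split=> //.
- move: au; rewrite /a; case: eqP => // _; case: eqP => [uN _|_].
    apply: f_pos => [j|]; first exact: pt_cube.
    by rewrite mxE uN mulfK ?pnatr_eq0 // mulr_natl mulr2n addrA addNr add0r.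
  by case/existsP => i' /andP[/eqP /val_inj -> /ltW].
- move: av; rewrite /a; case: eqP => [vN _|_].
    apply: f_neg => [j|]; first exact: pt_cube.
    by rewrite mxE vN mulr0 mul0r addr0.
  case: eqP => // _; rewrite negb_exists => /forallP/(_ i).
  by rewrite eqxx /= -leNgt.
Qed.

Lemma poincare_miranda : exists x : 'rV[R]_m, (forall j, `|x ord0 j| <= L) /\ f x = 0.
Proof.
have [x hx] := choice mesh_cube.
pose K : set 'rV[R]_m := [set v | forall i, `[- L, L]%classic (v ord0 i)].
have cK : compact K.
  by apply: (@rV_compact _ m (fun=> `[- L, L]%classic)) => i; exact: segment_compact.
have [c [Kc clc]] : K `&` cluster ((fun N => pt N (x N)) @ \oo) !=set0.
  apply: cK; rewrite /nbhs /=; near=> N => i /=; rewrite in_itv /= -ler_norml.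
  by apply: pt_cube; have [h _] := hx N; rewrite (leq_trans (h i)).
exists c; split=> [j|]; first by have := Kc j; rewrite /= in_itv /= -ler_norml.
apply/rowP => i; rewrite mxE; apply/eqP; rewrite -normr_le0; apply/ler_addgt0Pl => e e0.
rewrite addr0.
have fci : (fun y => f y ord0 i) @ c --> f c ord0 i.
  apply: (@continuous_comp _ _ _ f (fun v : 'rV[R]_m => v ord0 i)); first exact: fC.
  exact: coord_continuous.
move/cvgrPdist_lt: (fci) => /(_ e e0) /nbhs_ballP [d /= d0 hd].
have d20 : 0 < d / 2 by rewrite divr_gt0.
(* Intersecting a neighbourhood of [c] with the points of fine meshes puts a whole cell, hence [u]
   and [v], within [d] of [c]. *)
pose A := [set y | exists N, y = pt N (x N) /\ 2 * L / N.+1%:R < d / 2].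
have FA : ((fun N => pt N (x N)) @ \oo) A.
  have e20 : 0 < d / 2 / (2 * L) by rewrite divr_gt0 // mulr_gt0.
  rewrite /nbhs /=; near=> N; exists N; split=> //.
  rewrite mulrC -ltr_pdivlMr ?mulr_gt0 //.
  by near: N; exact: (near_infty_natSinv_lt (PosNum e20)).
have [y [[N [-> hN]] cy]] := clc A _ FA (nbhsx_ballx c _ d20).
have [_ /(_ i)[u [v [hu hv fu fv]]]] := hx N.
have near (w : 'rV[R]_m) : (forall j, `|pt N (x N) ord0 j - w ord0 j| <= 2 * L / N.+1%:R) ->
   `|f c ord0 i - f w ord0 i| < e.
  move=> hw; apply: hd; apply: ball_rV => // j.
  have := cy.2 ord0 j; rewrite /ball /= => cj.
  rewrite (le_lt_trans (ler_distD (pt N (x N) ord0 j) _ _)) // [ltRHS](splitr d) ltrD //.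
  exact: le_lt_trans (hw j) hN.
have := near u hu; have := near v hv.
rewrite !ltr_norml ler_norml; lra.
Unshelve. all: by end_near. Qed.
End PoincareMiranda.

(** * A zero of a vector field that points outwards on a gauge sphere *)

Lemma norm_coord_le (R : realType) m (x : 'rV[R]_m) j : `|x ord0 j| <= `|x|.
Proof.
have -> : `|x| = \big[Order.max/0]_i `|x i.1 i.2| by rewrite -mx_normrE.
exact: (le_bigmax _ (fun i : 'I_1 * 'I_m => `|x i.1 i.2|) (ord0, j)).
Qed.

Lemma continuous_div_max (R : realType) (T : topologicalType) (g : T -> R) (c : R) :
  0 < c -> continuous g -> continuous (fun z => c / Num.max c (g z)).
Proof.
move=> c0 cg z.
have cmx : {for z, continuous (fun y => Num.max c (g y))}.
  apply: (@continuous_max R T (fun=> c) g z); last exact: cg.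
  exact: (@cst_continuous T R c).
apply: (@continuousM R T (fun=> c) (fun y => (Num.max c (g y))^-1) z).
  exact: (@cst_continuous T R c).
by apply: continuousV => //; rewrite gt_eqF // lt_max c0.
Qed.

Lemma gauge_zero (R : realType) m (F : 'rV[R]_m -> 'rV[R]_m) (g : 'rV[R]_m -> R)
    (rho C : R) : 0 < rho -> continuous F -> continuous g ->
  (forall (t : R) z, 0 <= t -> g (t *: z) = t * g z) ->
  0 <= C -> (forall (z : 'rV[R]_m) j, `|z ord0 j| <= C * g z) ->
  (forall z, g z = rho -> 0 <= inner (F z) z) ->
  exists z, g z <= rho /\ F z = 0.
Proof.
move=> rho0 cF cg hom C0 bnd cond.
(* This factor is 1 on the ball and [rho / g z] outside; the maximum makes it continuous without a
   case split. *)
pose s (z : 'rV[R]_m) := rho / Num.max rho (g z).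
pose r (z : 'rV[R]_m) : 'rV[R]_m := s z *: z.
have max0 z : 0 < Num.max rho (g z) by rewrite lt_max rho0.
have s0 z : 0 <= s z by rewrite divr_ge0 // ltW.
have gr z : g (r z) <= rho.
  rewrite hom // /s -mulrA ger_pMr // mulrC ler_pdivrMr // mul1r le_max lexx orbT //.
have cs : continuous s by exact: continuous_div_max.
have cr : continuous r by move=> z; apply: (@continuousZ R _ _ s id z); [exact: cs|exact: cvg_id].
have cFr : continuous (F \o r) by move=> z; apply: continuous_comp; [exact: cr|exact: cF].
(* [r] takes its values in this compact box, so [F \o r] is bounded on the whole space. *)
pose K : set 'rV[R]_m := [set v | forall i, `[- (C * rho), C * rho]%classic (v ord0 i)].
have cK : compact K.
  by apply: (@rV_compact _ m (fun=> `[- (C * rho), C * rho]%classic)) => i; exact: segment_compact.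
have Kr z : K (r z).
  move=> j /=; rewrite in_itv /= -ler_norml (le_trans (bnd _ _)) // ler_wpM2l //.
have K0 : K !=set0 by exists (r 0); exact: Kr.
have cnF : {within K, continuous (fun x => `|F x|)}.
  apply: continuous_subspaceT => z.
  by apply: continuous_comp; [exact: cF|exact: norm_continuous].
have [c _ hc] := EVT_max_rV K0 cK cnF.
pose M := `|F c|.
have FM z j : `|F (r z) ord0 j| <= M.
  by rewrite (le_trans (norm_coord_le _ _)) // hc // inE.
(* On the faces at distance [L] the coordinate of [x] outweighs that of [F (r x)], at most [M], and
   that of [r x], at most [C * rho]; the 1 makes [L] positive. *)
pose L := M + C * rho + 1.
have M0 : 0 <= M by rewrite /M.
have Cr0 : 0 <= C * rho by rewrite mulr_ge0 // ltW.
have L0 : 0 < L by rewrite /L; lra.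
have rC z j : `|r z ord0 j| <= C * rho by have := Kr z j; rewrite /= in_itv /= -ler_norml.
pose H x := F (r x) + (x - r x).
have cH : continuous H.
  move=> z; apply: (@continuousD R _ _ (F \o r) (fun x => x - r x) z); first exact: cFr.
  by apply: (@continuousB R _ _ id r z); [exact: cvg_id|exact: cr].
have HE x i : H x ord0 i = F (r x) ord0 i + (x ord0 i - r x ord0 i).
  by rewrite /H; move: (r x) => y; rewrite !mxE.
have [i x _ xi|i x _ xi|x [_ Hx]] := @poincare_miranda R m H L L0 cH.
- rewrite HE xi; have := FM x i; have := rC x i; rewrite !ler_norml /L; lra.
- rewrite HE xi; have := FM x i; have := rC x i; rewrite !ler_norml /L; lra.
have [gx|gx] := leP (g x) rho.
  exists x; split => //.
  have rx : r x = x by rewrite /r /s max_l // divff ?scale1r // gt_eqF.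
  by move: Hx; rewrite /H rx subrr addr0.
have gx0 : 0 < g x by exact: lt_trans gx.
have sE : s x = rho / g x by rewrite /s max_r // ltW.
have sx0 : 0 < s x by rewrite sE divr_gt0.
have sx1 : s x < 1 by rewrite sE ltr_pdivrMr // mul1r.
have grx : g (r x) = rho by rewrite hom // sE divfK // gt_eqF.
have Frx : F (r x) = (s x - 1) *: x.
  apply/eqP; rewrite scalerBl scale1r -/(r x) -subr_eq0 opprB addrA.
  by rewrite -addrA; apply/eqP.
(* The product of [s x - 1] and [s x] is negative, so the sum of squares is at most 0 and [x = 0];
   but [g 0 = 0] while [rho < g x]. *)
have := cond _ grx; rewrite /inner Frx /r.
have -> : \sum_j ((s x - 1) *: x) ord0 j * (s x *: x) ord0 j =
   ((s x - 1) * s x) * \sum_j x ord0 j ^+ 2.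
  by rewrite big_distrr /=; apply: eq_bigr => j _; rewrite !mxE; ring.
rewrite nmulr_rge0; last by rewrite nmulr_rlt0 // subr_lt0.
move=> sq; have x0 : x = 0.
  apply/rowP => j; rewrite mxE.
  have sq0 : \sum_j x ord0 j ^+ 2 = 0.
    by apply/eqP; rewrite eq_le sq sumr_ge0 // => i _; exact: sqr_ge0.
  have /eqP := psumr_eq0P (fun i _ => sqr_ge0 (x ord0 i)) sq0 (i := j) isT.
  by rewrite sqrf_eq0 => /eqP.
have g0 : g 0 = 0 by have := hom 0 0 (lexx 0); rewrite scale0r mul0r.
by move: gx0; rewrite x0 g0 ltxx.
Qed.

(** * Lebesgue measure on row vectors *)

(** The pushforward is a measure only through the proof [mf]; the existential hides it and leaves a
    plain measure with its two properties. *)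
Lemma ge0_integral_pushforwardT d d' (T : measurableType d) (T' : measurableType d')
    (R : realType) (m : {measure set T -> \bar R}) (f : T -> T') :
  measurable_fun setT f -> exists mu : {measure set T' -> \bar R},
    (forall A, mu A = m (f @^-1` A)) /\
    forall h : T' -> \bar R, measurable_fun setT h -> (forall x, 0 <= h x)%E ->
      (\int[mu]_x h x = \int[m]_x h (f x))%E.
Proof.
move=> mf; unshelve eexists (pushforward m f); first exact: mf.
by split=> // h mh h0; rewrite ge0_integral_pushforward // preimage_setT.
Qed.

(** Lebesgue measure is determined by half-open intervals, whose length a shift preserves. *)
Lemma lebesgue_measure_shift (R : realType) (c : R) (A : set R) : measurable A ->
  pushforward (@lebesgue_measure R) (fun x : R => x + c : measurableTypeR R) A = lebesgue_measure A.
Proof.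
have mc : measurable_fun setT (fun x : R => x + c : measurableTypeR R).
  by apply: measurable_funD => //; exact: measurable_cst.
move=> mA; apply/esym/lebesgue_measure_unique => // _ [[a b]] _ <-.
rewrite /= /pushforward.
have -> : (fun x => x + c) @^-1` `]a, b]%classic = `]a - c, b - c]%classic.
  by apply/seteqP; split=> x /=; rewrite !in_itv /= ltrBlDr lerBrDr.
by rewrite !lebesgue_measure_itv /= !lte_fin ltrD2r -!EFinD opprB addrA subrK.
Qed.

Lemma ge0_integral_lebesgue_shift (R : realType) (c : R) (f : R -> \bar R) :
  measurable_fun setT f -> (forall x, 0 <= f x)%E ->
  (\int[lebesgue_measure]_x f (x + c)%R = \int[lebesgue_measure]_x f x)%E.
Proof.
move=> mf f0.
have mc : measurable_fun setT (fun x : R => x + c : measurableTypeR R).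
  by apply: measurable_funD => //; exact: measurable_cst.
have [mu [muE muI]] := ge0_integral_pushforwardT (@lebesgue_measure R) mc.
rewrite -muI //; apply: eq_measure_integral => A mA _; rewrite muE; exact: lebesgue_measure_shift.
Qed.

Section SigmaFiniteOf.
Context d (T : measurableType d) (R : realType) (mu : {measure set T -> \bar R}).
Hypothesis sf : sigma_finite setT mu.

(** A copy of [mu] indexed by a proof of sigma-finiteness, so that the structure required by product
    measures can be attached to it. *)
Definition sigma_finite_of & sigma_finite setT mu : set T -> \bar R := mu.

HB.instance Definition _ := Measure.copy (sigma_finite_of sf) mu.
HB.instance Definition _ := Measure_isSigmaFinite.Build _ _ _ (sigma_finite_of sf) sf.

End SigmaFiniteOf.

(** [iter_int] integrates functions of infinite sequences, so its measurable space is the space of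
    sequences with the product sigma-algebra, generated by these sets. *)
Definition cylinders (R : realType) : set (set (nat -> R)) :=
  [set A | exists k (B : set R), measurable B /\ A = (fun x => x k) @^-1` B].

Definition seqT (R : realType) := g_sigma_algebraType (@cylinders R).

(** Its measurable sets are [borel_rn] by definition, so [meas_rn] is ordinary measurability. *)
Definition borelT (R : realType) n := g_sigma_algebraType [set A : set 'rV[R]_n | open A].

Lemma measurable_coord (R : realType) k : measurable_fun setT (fun x : seqT R => x k).
Proof.
move=> _ B mB; rewrite setTI; apply: sub_sigma_algebra; by exists k, B.
Qed.

Lemma measurable_seqP (R : realType) d (T : measurableType d) (f : T -> seqT R) :
  (forall k, measurable_fun setT (fun x => f x k)) -> measurable_fun setT f.
Proof.
move=> mf; apply: (@measurability _ _ T (seqT R) setT f (@cylinders R)) => // _ [_ [k [B [mB ->]] <-]].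
exact: (mf k).
Qed.

Lemma measurable_coord_upd (R : realType) k :
  measurable_fun setT (fun p : seqT R * R => coord_upd p.1 k p.2 : seqT R).
Proof.
apply: measurable_seqP => i; rewrite /coord_upd; case: eqP => _.
  exact: measurable_snd.
exact: (measurableT_comp (@measurable_coord R i) measurable_fst).
Qed.

Definition seq_box (R : realType) (k : nat) (r : R) : set (seqT R) :=
  [set x | forall i, (i < k)%N -> `|x i| <= r].

Lemma measurable_seq_box (R : realType) k (r : R) : measurable (@seq_box R k r).
Proof.
elim: k => [|k IH].
  rewrite (_ : seq_box _ _ = setT); first exact: measurableT.
  by apply/seteqP; split.
rewrite (_ : seq_box _ _ = @seq_box R k r `&` (fun x : seqT R => x k) @^-1` `[- r, r]%classic).
  apply: measurableI => //; rewrite -[X in measurable X]setTI; apply: measurable_coord => //.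
apply/seteqP; split=> x /=; rewrite /seq_box /= in_itv /= -ler_norml.
  by move=> h; split=> [i ik|]; apply: h => //; exact: ltnW.
by move=> [h hk] i; rewrite ltnS leq_eqVlt => /predU1P[->//|]; exact: h.
Qed.

(** Each further integral is Tonelli on the product with one-dimensional Lebesgue measure, pushed
    forward along [coord_upd]; with no integral left it is evaluation at the zero sequence, a Dirac
    mass. The value on boxes is carried along because it gives the sigma-finiteness needed for the
    next product. *)
Lemma iter_intE (R : realType) k : exists lam : {measure set (seqT R) -> \bar R},
  (forall r : R, 0 <= r -> lam (@seq_box R k r) = ((2 * r) ^+ k)%:E) /\
  forall f : seqT R -> \bar R, measurable_fun setT f -> (forall x, 0 <= f x)%E ->
    iter_int k f = (\int[lam]_x f x)%E.
Proof.
elim: k => [|k [lam [lamB IH]]].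
  exists (@dirac _ (seqT R) (fun=> 0) R); split=> [r r0|f mf f0 /=].
    rewrite /= diracE expr0 (_ : seq_box _ _ = setT) ?in_setT //.
    by apply/seteqP; split.
  by rewrite integral_dirac // diracT mul1e.
have sf : sigma_finite setT lam.
  exists (fun j => @seq_box R k j%:R).
    apply/esym/seteqP; split=> // x _.
    exists (Num.truncn (\sum_(i < k) `|x i|)).+1 => // i ik.
    apply: (@le_trans _ _ (\sum_(i < k) `|x i|)); last by apply/ltW/Num.Theory.truncnS_gt.
    by rewrite (bigD1 (Ordinal ik)) //= lerDl sumr_ge0.
  by move=> j; split; [exact: measurable_seq_box|rewrite lamB // ltry].
pose lams : {sigma_finite_measure set (seqT R) -> \bar R} := sigma_finite_of sf.
have [lam' [lamE lamI]] := ge0_integral_pushforwardT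
  (lams \x (@lebesgue_measure R))%E (@measurable_coord_upd R k).
exists lam'; split=> [r r0|f mf f0].
  rewrite lamE.
  rewrite (_ : _ @^-1` _ = @seq_box R k r `*` `[- r, r]%classic); last first.
    apply/seteqP; split=> [[x t]|[x t]] /=; rewrite /seq_box /coord_upd /= in_itv /= -ler_norml.
      move=> h; split=> [i ik|]; last by have := h k (ltnSn k); rewrite eqxx.
      by have := h i (ltnW ik); rewrite (ltn_eqF ik).
    by move=> [h hk] i; rewrite ltnS leq_eqVlt; case: eqP => //= _; exact: h.
  pose B : set R := `[- r, r]%classic.
  have mB : measurable B by exact: measurable_itv.
  have E : (lams \x (@lebesgue_measure R))%E (@seq_box R k r `*` B) =
      (lam (@seq_box R k r) * lebesgue_measure B)%E.
    by apply: product_measure1E => //; exact: measurable_seq_box.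
  rewrite [LHS]E lamB // lebesgue_measure_itv /= lte_fin.
  have -> : (r%:E - (- r)%:E)%E = (2 * r)%:E by rewrite -EFinB; congr EFin; ring.
  (* The interval formula singles out the degenerate interval; there [r = 0] and both sides
     vanish. *)
  case: ifPn => [_|]; first by rewrite -EFinM exprSr.
  rewrite -leNgt => rr; have -> : r = 0 by lra.
  by rewrite mule0 mulr0 exprS mul0r.
have mfu := measurableT_comp mf (@measurable_coord_upd R k).
rewrite lamI // fubini_tonelli1 //= IH //; last by move=> x; apply: integral_ge0.
have := @measurable_fun_fubini_tonelli_F _ _ _ _ R (@lebesgue_measure R) _ mfu.
by apply=> x; exact: f0.
Qed.

Definition obox (R : realType) n (a b : 'rV[R]_n) : set 'rV[R]_n :=
  [set x | forall i, a ord0 i < x ord0 i < b ord0 i].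

Definition cbox (R : realType) n (a b : 'rV[R]_n) : set 'rV[R]_n :=
  [set x | forall i, a ord0 i <= x ord0 i <= b ord0 i].

Definition ratv (R : realType) n (q : 'rV[rat]_n) : 'rV[R]_n := map_mx ratr q.

Lemma open_rat_box (R : realType) n (U : set 'rV[R]_n) x : open U -> U x ->
  exists a b : 'rV[rat]_n, obox (ratv R a) (ratv R b) x /\ cbox (ratv R a) (ratv R b) `<=` U.
Proof.
move=> oU Ux; have /nbhs_ballP[e /= e0 xe] : nbhs x U by exact: open_nbhs_nbhs.
have /choice[a ha] : forall i, exists q : rat, ratr q \in `](x ord0 i - e), (x ord0 i)[.
  by move=> i; apply: rat_in_itvoo; rewrite ltrBlDr ltrDl.
have /choice[b hb] : forall i, exists q : rat, ratr q \in `](x ord0 i), (x ord0 i + e)[.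
  by move=> i; apply: rat_in_itvoo; rewrite ltrDl.
exists (\row_i a i), (\row_i b i); split=> [i|y hy].
  rewrite !mxE; have := ha i; have := hb i; rewrite !in_itv /=.
  by move=> /andP[-> _] /andP[_ ->].
apply: xe; apply: ball_rV => // i; have := hy i; rewrite !mxE.
have := ha i; have := hb i; rewrite !in_itv /= => /andP[b1 b2] /andP[a1 a2] /andP[y1 y2].
by rewrite ltr_norml; apply/andP; split; lra.
Qed.

Lemma open_obox (R : realType) n (a b : 'rV[R]_n) : open (obox a b).
Proof.
rewrite openE => x ox.
suff h : nbhs x [set y : 'rV[R]_n | forall i, a ord0 i < y ord0 i < b ord0 i] by exact: h.
apply: (@filter_forall _ _ (fun i => [set y : 'rV[R]_n | a ord0 i < y ord0 i < b ord0 i])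
  (nbhs x) (nbhs_filter x)) => i.
have oi : open ((fun y : 'rV[R]_n => y ord0 i) @^-1` `]a ord0 i, b ord0 i[%classic).
  apply: open_comp; last exact: interval_open.
  by move=> y _; exact: coord_continuous.
apply: filterS (open_nbhs_nbhs (conj oi _)) => [y|]; rewrite /= in_itv //=; exact: ox.
Qed.

Lemma measurable_open (R : realType) n (U : set (borelT R n)) : open (U : set 'rV[R]_n) -> measurable U.
Proof. by move=> oU; exact: sub_sigma_algebra. Qed.

(** Rational corners keep the family countable. The closed box is required to lie in [U], so that a
    bump supported in it is a test function of [U]. *)
Definition inner_boxes (R : realType) n (U : set 'rV[R]_n) : set ('rV[rat]_n * 'rV[rat]_n) :=
  [set q | cbox (ratv R q.1) (ratv R q.2) `<=` U].

Lemma open_bigcup_boxes (R : realType) n (U : set 'rV[R]_n) : open U ->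
  U = \bigcup_(q in inner_boxes U) obox (ratv R q.1) (ratv R q.2).
Proof.
move=> oU; apply/seteqP; split=> [x Ux|x [q qU qx]].
  by have [a [b [xab abU]]] := open_rat_box oU Ux; exists (a, b).
by apply: qU => i; have /andP[/ltW-> /ltW->] := qx i.
Qed.

(** An open set is a countable union of boxes, each a finite intersection of cylinders, so Borel
    sets pull back to the product sigma-algebra. *)
Lemma measurable_row_mx (R : realType) n :
  measurable_fun setT (fun x : seqT R => \row_(i < n) x i : borelT R n).
Proof.
apply: (@measurability _ _ (seqT R) (borelT R n) setT _ [set A : set 'rV[R]_n | open A]) => // _ [U /= oU <-].
rewrite setTI (open_bigcup_boxes oU) preimage_bigcup.
rewrite bigcup_mkcond; apply: countable_bigcupT_measurable; first exact: countableP.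
move=> q; case: ifP => // _.
have -> : (fun x : seqT R => \row_(i < n) x i) @^-1` obox (ratv R q.1) (ratv R q.2) =
   \bigcap_(i in [set` finset.setT]) ((fun x : seqT R => x (nat_of_ord i)) @^-1`
      `]ratv R q.1 ord0 i, ratv R q.2 ord0 i[%classic).
  apply/seteqP; split=> x /= h i; first by move=> _ /=; rewrite in_itv /=; have := h i; rewrite mxE.
  by have := h i; rewrite /= in_itv /= !mxE; apply; rewrite finset.inE.
apply: fin_bigcap_measurable => // i _.
rewrite -[X in measurable X]setTI; apply: measurable_coord => //.
Qed.

Lemma measurable_continuous (R : realType) n (f : 'rV[R]_n -> R) :
  continuous f -> measurable_fun (setT : set (borelT R n)) f.
Proof.
move=> cf; apply: (@measurability _ _ (borelT R n) _ setT f _ (RGenOpens.measurableE R)) => _ [U oU <-].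
rewrite setTI; apply: measurable_open.
have [a [b ->]] := oU.
by apply: open_comp; [move=> x _; exact: cf|exact: interval_open].
Qed.

Lemma measurable_continuous_rV (R : realType) n m (f : 'rV[R]_n -> 'rV[R]_m) :
  continuous f -> measurable_fun setT (f : borelT R n -> borelT R m).
Proof.
move=> cf; apply: (@measurability _ _ (borelT R n) (borelT R m) setT f [set A | open A]) => // _ [U oU <-].
rewrite setTI; apply: measurable_open.
by apply: open_comp => // x _; exact: cf.
Qed.

Lemma measurable_cbox (R : realType) n (a b : 'rV[R]_n) : measurable (cbox a b : set (borelT R n)).
Proof.
have -> : cbox a b = \bigcap_(i in [set` finset.setT]) ((fun x : 'rV[R]_n => x ord0 i) @^-1` `[a ord0 i, b ord0 i]%classic).
  apply/seteqP; split=> x /= h i; first by move=> _ /=; rewrite in_itv /=; exact: h.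
  by have := h i; rewrite /= in_itv /=; apply; rewrite finset.inE.
apply: fin_bigcap_measurable => // i _.
have := @measurable_continuous R n (fun x => x ord0 i) (@coord_continuous R 1 n ord0 i).
move=> mc; rewrite -[X in measurable X]setTI; apply: mc => //.
Qed.

Lemma Rn_int_measure (R : realType) n : exists mu : {measure set (borelT R n) -> \bar R},
  (forall r : R, 0 <= r -> mu (cbox (const_mx (- r)) (const_mx r)) = ((2 * r) ^+ n)%:E) /\
  forall f : 'rV[R]_n -> \bar R, measurable_fun (setT : set (borelT R n)) f ->
    (forall x, 0 <= f x)%E -> Rn_int f = (\int[mu]_x f x)%E.
Proof.
have [lam [lamB lamI]] := iter_intE R n.
have [mu [muE muI]] := ge0_integral_pushforwardT lam (@measurable_row_mx R n).
exists mu; split=> [r r0|f mf f0].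
  rewrite muE -lamB //; congr (lam _); apply/seteqP; split=> x /= h i.
    by move=> ik; have := h (Ordinal ik); rewrite !mxE -ler_norml.
  by rewrite !mxE -ler_norml; exact: h.
rewrite muI // /Rn_int lamI //.
exact: (measurableT_comp mf (@measurable_row_mx R n)).
Qed.

(** Lebesgue measure in dimension [n]. Two facts are kept of it: its value on centred cubes, and
    that it computes [Rn_int] of nonnegative Borel functions. *)
Definition lebn (R : realType) n : {measure set (borelT R n) -> \bar R} :=
  sval (cid (Rn_int_measure R n)).

Lemma lebn_cbox (R : realType) n (r : R) : 0 <= r ->
  lebn R n (cbox (const_mx (- r)) (const_mx r)) = ((2 * r) ^+ n)%:E.
Proof. by rewrite /lebn; case: cid => mu [/= muB _]; exact: muB. Qed.

Lemma Rn_intE (R : realType) n (f : 'rV[R]_n -> \bar R) :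
  measurable_fun (setT : set (borelT R n)) f -> (forall x, 0 <= f x)%E ->
  Rn_int f = (\int[lebn R n]_x f x)%E.
Proof. by rewrite /lebn; case: cid => mu [/= _ muI]; exact: muI. Qed.

(** [iter_int] sets all coordinates from [k] on to 0, whence the condition on [v]. In the induction
    step the innermost integral absorbs the shift of its own coordinate, and the remaining integrals
    absorb [v'], which is 0 there. *)
Lemma iter_int_shift (R : realType) k (v : nat -> R) (f : seqT R -> \bar R) :
  measurable_fun setT f -> (forall x, 0 <= f x)%E -> (forall i, (k <= i)%N -> v i = 0) ->
  iter_int k (fun x => f (fun i => x i + v i)) = iter_int k f.
Proof.
have mshift (u : nat -> R) : measurable_fun setT (fun x : seqT R => (fun i => x i + u i) : seqT R).
  apply: measurable_seqP => i; apply: measurable_funD; last exact: measurable_cst.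
  exact: measurable_coord.
elim: k v f => [|k IH] v f mf f0 v0.
  by rewrite /=; congr f; apply/funext => i; rewrite v0 // addr0.
pose G x := (\int[@lebesgue_measure R]_t f (coord_upd x k t))%E.
pose v' := coord_upd v k 0.
have mfu := measurableT_comp mf (@measurable_coord_upd R k).
have mG : measurable_fun setT (G : seqT R -> \bar R).
  have := @measurable_fun_fubini_tonelli_F _ _ _ _ R (@lebesgue_measure R) _ mfu.
  by apply=> x; exact: f0.
have G0 x : (0 <= G x)%E by apply: integral_ge0.
transitivity (iter_int k (fun x => G (fun i => x i + v' i))); last first.
  apply: IH => // i; rewrite /v' /coord_upd leq_eqVlt eq_sym.
  by case: eqP => // _ /= ki; exact: v0.
rewrite /=; congr iter_int; apply/funext => x; rewrite /G.
rewrite -(@ge0_integral_lebesgue_shift R (v k)) //; last first.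
  have mp : measurable_fun setT (fun t : R => ((fun i => x i + v' i) : seqT R, t)).
    by apply: measurable_fun_pair; [exact: measurable_cst|exact: measurable_id].
  exact: (measurableT_comp mfu mp).
apply: eq_integral => t _; congr f; apply/funext => i; rewrite /v' /coord_upd.
by case: eqP => // ->.
Qed.

Lemma continuous_translate (R : realType) n (v : 'rV[R]_n) : continuous (fun x : 'rV[R]_n => x + v).
Proof. by move=> x; apply: (@continuousD R _ _ id (fun=> v) x); [exact: cvg_id|exact: (@cst_continuous _ _ v x)]. Qed.

Lemma lebn_shift (R : realType) n (v : 'rV[R]_n) (f : borelT R n -> \bar R) :
  measurable_fun setT f -> (forall x, 0 <= f x)%E ->
  (\int[lebn R n]_x f (x + v)%R = \int[lebn R n]_x f x)%E.
Proof.
move=> mf f0.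
have mfv : measurable_fun setT (fun x : borelT R n => f (x + v)).
  exact: (measurableT_comp mf (measurable_continuous_rV (@continuous_translate R n v))).
rewrite -!Rn_intE // /Rn_int.
pose vn i := if insub i is Some j then v ord0 j else 0 : R.
rewrite -(@iter_int_shift R n vn (fun x => f (\row_(i < n) x i))) //; last 2 first.
- exact: (measurableT_comp mf (@measurable_row_mx R n)).
- by move=> i ni; rewrite /vn insubF // ltnNge ni.
congr iter_int; apply/funext => x; congr f; apply/rowP => i; rewrite !mxE /vn.
by rewrite valK.
Qed.

(** * L^p spaces *)

(** Extension by zero. It moves the weight [\1_O] inside the power, so norms over [O] become norms
    of functions on the whole space, to which Minkowski's inequality applies. *)
Definition res (R : realType) n (O : set 'rV[R]_n) (f : 'rV[R]_n -> R) : 'rV[R]_n -> R :=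
  fun x => \1_O x * f x.

Lemma measurable_powR_norm (R : realType) d (T : measurableType d) (f : T -> R) (p : R) :
  measurable_fun setT f -> measurable_fun setT (fun x => `|f x| `^ p).
Proof.
move=> mf; apply: (measurableT_comp (measurable_powR p)).
exact: (measurableT_comp (@normr_measurable R setT) mf).
Qed.

Lemma ae_sub d (T : measurableType d) (R : realType) (mu : {measure set T -> \bar R})
  (P Q : T -> Prop) : (forall x, P x -> Q x) ->
  {ae mu, forall x, P x} -> {ae mu, forall x, Q x}.
Proof. by move=> PQ; apply: filterS. Qed.

Section LpSpace.
Context (R : realType) (n : nat) (p : R) (O : set 'rV[R]_n).
Hypotheses (p1 : 1 < p) (oO : open O).

Let p0 : 0 < p. Proof. exact: lt_trans p1. Qed.
Let pN0 : p != 0. Proof. by rewrite gt_eqF. Qed.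

Definition inLp (f : 'rV[R]_n -> R) := meas_rn f /\ (Lp_int p O f < +oo)%E.

Lemma meas_rnP (f : 'rV[R]_n -> R) :
  meas_rn f <-> measurable_fun (setT : set (borelT R n)) f.
Proof.
split=> [mf _ B mB|mf B mB]; first by rewrite setTI; exact: mf.
by have := mf measurableT B mB; rewrite setTI.
Qed.

Lemma measurable_res f : meas_rn f -> measurable_fun (setT : set (borelT R n)) (res O f).
Proof.
move=> /meas_rnP mf; apply: measurable_funM => //.
by apply/measurable_indicP; exact: measurable_open.
Qed.

Lemma resE f x : O x -> res O f x = f x.
Proof. by move=> Ox; rewrite /res indicE mem_set // mul1r. Qed.

Lemma res_out f x : ~ O x -> res O f x = 0.
Proof. by move=> Ox; rewrite /res indicE memNset // mul0r. Qed.

Lemma Lp_intE f : meas_rn f -> Lp_int p O f = (\int[lebn R n]_x (`|res O f x| `^ p)%:E)%E.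
Proof.
move=> mf; rewrite /Lp_int (_ : (fun x => _) = fun x => (`|res O f x| `^ p)%:E).
  rewrite Rn_intE //.
  by apply/measurable_EFinP/measurable_powR_norm; exact: measurable_res.
apply/funext => x; congr EFin; have [Ox|Ox] := pselect (O x).
  by rewrite resE // indicE mem_set // mul1r.
by rewrite res_out // indicE memNset // mul0r normr0 powR0.
Qed.

Lemma Lp_int_ge0 f : meas_rn f -> (0 <= Lp_int p O f)%E.
Proof. by move=> mf; rewrite Lp_intE //; apply: integral_ge0 => x _; rewrite lee_fin powR_ge0. Qed.

Lemma Lp_norm_ge0 f : 0 <= Lp_norm p O f.
Proof. exact: powR_ge0. Qed.

Lemma LnormE f : meas_rn f ->
  Lnorm (lebn R n) p%:E (EFin \o res O f) = (Lp_int p O f `^ p^-1)%E.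
Proof.
move=> mf; rewrite Lp_intE // unlock /=; congr (_ `^ _)%E.
Qed.

Lemma LnormE_fin f : inLp f ->
  Lnorm (lebn R n) p%:E (EFin \o res O f) = (Lp_norm p O f)%:E.
Proof.
move=> [mf foo]; rewrite LnormE // /Lp_norm -poweR_EFin fineK // ge0_fin_numE //.
exact: Lp_int_ge0.
Qed.

Lemma res_add f g : res O (f \+ g) = (res O f \+ res O g).
Proof. by apply/funext => x; rewrite /res /= mulrDr. Qed.

Lemma meas_rn_add f g : meas_rn f -> meas_rn g -> @meas_rn R n (f \+ g).
Proof. by rewrite !meas_rnP => mf mg; exact: measurable_funD. Qed.

Lemma meas_rn_scale c f : meas_rn f -> @meas_rn R n (fun x => c * f x).
Proof. by rewrite !meas_rnP => mf; apply: measurable_funM => //; exact: measurable_cst. Qed.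

Lemma inLp_add f g : inLp f -> inLp g ->
  inLp (f \+ g) /\ Lp_norm p O (f \+ g) <= Lp_norm p O f + Lp_norm p O g.
Proof.
move=> Lf Lg; have [mf _] := Lf; have [mg _] := Lg.
have mfg := meas_rn_add mf mg.
have := @minkowski_EFin _ _ R (lebn R n) (res O f) (res O g) p
  (measurable_res mf) (measurable_res mg) (ltW p1).
rewrite -res_add LnormE // !LnormE_fin // => le.
have fin : (Lp_int p O (f \+ g)%R < +oo)%E.
  by apply: (lty_poweRy (invr_neq0 pN0)); rewrite (le_lt_trans le) // ltry.
have Lfg : inLp (f \+ g) by split.
split => //; move: le; rewrite -LnormE // LnormE_fin // lee_fin.
Qed.

Lemma Lp_int_scale c f : meas_rn f ->
  Lp_int p O (fun x => c * f x) = ((`|c| `^ p)%:E * Lp_int p O f)%E.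
Proof.
move=> mf; rewrite !Lp_intE //; last exact: meas_rn_scale.
rewrite -ge0_integralZl //.
- apply: eq_integral => x _; rewrite -EFinM; congr EFin.
  by rewrite -powRM // /res mulrCA normrM.
- by apply/measurable_EFinP/measurable_powR_norm; exact: measurable_res.
Qed.

Lemma inLp_scale c f : inLp f ->
  inLp (fun x => c * f x) /\ Lp_norm p O (fun x => c * f x) = `|c| * Lp_norm p O f.
Proof.
move=> [mf foo]; have fin : Lp_int p O f \is a fin_num by rewrite ge0_fin_numE // Lp_int_ge0.
split; first split; first exact: meas_rn_scale.
  by rewrite Lp_int_scale // -(fineK fin) -EFinM ltry.
rewrite /Lp_norm Lp_int_scale // fineM //= powRM ?powR_ge0 ?fine_ge0 ?Lp_int_ge0 //.
by rewrite -powRrM divff // powRr1.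
Qed.

Lemma inLp0 : inLp (fun=> 0) /\ Lp_norm p O (fun=> 0) = 0.
Proof.
have m0 : @meas_rn R n (fun=> 0) by apply/meas_rnP; exact: measurable_cst.
have i0 : Lp_int p O (fun=> 0) = 0%E.
  rewrite Lp_intE // integral0_eq // => x _.
  by rewrite /res mulr0 normr0 powR0.
by split; [split=> //; rewrite i0|rewrite /Lp_norm i0 /= powR0 // invr_neq0].
Qed.

Lemma inLp_sum (I : Type) (s : seq I) (F : I -> 'rV[R]_n -> R) : (forall i, inLp (F i)) ->
  inLp (fun x => \sum_(i <- s) F i x) /\
  Lp_norm p O (fun x => \sum_(i <- s) F i x) <= \sum_(i <- s) Lp_norm p O (F i).
Proof.
move=> LF; elim: s => [|i s [L le]].
  rewrite big_nil (_ : (fun x => _) = fun=> 0); last by apply/funext => x; rewrite big_nil.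
  by have [L0 ->] := inLp0.
rewrite big_cons (_ : (fun x => _) = F i \+ (fun x => \sum_(i <- s) F i x)); last first.
  by apply/funext => x; rewrite big_cons.
have [L' le'] := inLp_add (LF i) L; split=> //.
by rewrite (le_trans le') // lerD2l.
Qed.

Lemma le_Lp_int f g : meas_rn f -> meas_rn g -> (forall x, O x -> `|f x| <= `|g x|) ->
  (Lp_int p O f <= Lp_int p O g)%E.
Proof.
move=> mf mg fg; rewrite !Lp_intE //; apply: ge0_le_integral; rewrite ?measurableT //.
- by apply/measurable_EFinP/measurable_powR_norm; exact: measurable_res.
- by apply/measurable_EFinP/measurable_powR_norm; exact: measurable_res.
move=> x _; rewrite lee_fin; apply: ge0_ler_powR; [exact: ltW|by rewrite nnegrE..|].
have [Ox|Ox] := pselect (O x); first by rewrite !resE // fg.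
by rewrite !res_out.
Qed.

Lemma inLp_le f g : meas_rn f -> inLp g -> (forall x, O x -> `|f x| <= `|g x|) ->
  inLp f /\ Lp_norm p O f <= Lp_norm p O g.
Proof.
move=> mf [mg goo] fg; have le := le_Lp_int mf mg fg.
have Lf : inLp f by split=> //; exact: le_lt_trans goo.
split; first by [].
have f0 := Lp_int_ge0 mf; have g0 := Lp_int_ge0 mg; have [_ foo] := Lf.
apply: ge0_ler_powR; [by rewrite invr_ge0 ltW|by rewrite nnegrE fine_ge0..|].
by apply: fine_le; rewrite ?ge0_fin_numE.
Qed.

Definition ae0 (f : 'rV[R]_n -> R) := {ae lebn R n, forall x, O x -> f x = 0}.

Lemma ae0_res f : ae0 f -> {ae lebn R n, forall x, res O f x = 0}.
Proof.
apply: ae_sub => x fx; have [Ox|Ox] := pselect (O x); last exact: res_out.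
by rewrite resE // fx.
Qed.

Lemma Lp_norm_eq0 f : inLp f -> Lp_norm p O f = 0 <-> ae0 f.
Proof.
move=> Lf; have [mf foo] := Lf.
have mpow : measurable_fun (setT : set (borelT R n)) (fun x => (`|res O f x| `^ p)%:E).
  by apply/measurable_EFinP/measurable_powR_norm; exact: measurable_res.
have absE x : (`|(`|res O f x| `^ p)%:E| = (`|res O f x| `^ p)%:E)%E.
  by rewrite /= ger0_norm // powR_ge0.
have int0 : (\int[lebn R n]_x (`|res O f x| `^ p)%:E = 0)%E <-> ae0 f.
  under eq_integral do rewrite -absE.
  apply: (iff_trans (ae_eq_integral_abs (lebn R n) measurableT mpow)); split.
    apply: ae_sub => x /(_ I)[/eqP]; rewrite powR_eq0 => /andP[/eqP + _] Ox.
    by rewrite resE // => /eqP; rewrite normr_eq0 => /eqP.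
  by move/ae0_res; apply: ae_sub => x -> _; rewrite normr0 powR0.
rewrite -int0 -Lp_intE //; split=> [/eqP|i0].
  rewrite /Lp_norm powR_eq0 => /andP[/eqP h _].
  by rewrite -(@fineK _ (Lp_int p O f)) ?h // ge0_fin_numE // Lp_int_ge0.
by rewrite /Lp_norm i0 powR0 // invr_neq0.
Qed.

Lemma Lp_norm_ae f g : meas_rn f -> inLp g -> ae0 (fun x => f x - g x) ->
  inLp f /\ Lp_norm p O f = Lp_norm p O g.
Proof.
move=> mf [mg goo] fg.
have E : Lp_int p O f = Lp_int p O g.
  rewrite (Lp_intE mf) (Lp_intE mg); apply: ae_eq_integral; first exact: measurableT.
  - by apply/measurable_EFinP/measurable_powR_norm; exact: measurable_res.
  - by apply/measurable_EFinP/measurable_powR_norm; exact: measurable_res.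
  apply: ae_sub (ae0_res fg) => x h _.
  suff -> : res O f x = res O g x by [].
  by apply/eqP; rewrite -subr_eq0 /res -mulrBr; apply/eqP.
by split; [split=> //; rewrite E|rewrite /Lp_norm E].
Qed.

End LpSpace.

(** * Signed integrals and functions on a bounded domain *)

Definition integ (R : realType) n (f : 'rV[R]_n -> R) : Prop :=
  (lebn R n).-integrable setT (EFin \o f).

(** The signed integral against [lebn], which is linear and obeys dominated convergence; [Rn_sintE]
    identifies it with [Rn_sint]. *)
Definition sint (R : realType) n (f : 'rV[R]_n -> R) : R :=
  fine (\int[lebn R n]_x (f x)%:E)%E.

Section SignedIntegral.
Context (R : realType) (n : nat).
Implicit Types f g : 'rV[R]_n -> R.

Lemma integ_meas f : integ f -> meas_rn f.
Proof. by move=> /integrableP[/measurable_EFinP mf _]; exact/meas_rnP. Qed.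

Lemma integ_le f g : meas_rn f -> integ g -> (forall x, `|f x| <= g x) -> integ f.
Proof.
move=> /meas_rnP mf ig fg; apply: (le_integrable measurableT) ig.
  exact/measurable_EFinP.
by move=> x _; rewrite /= lee_fin (le_trans (fg x)) // ler_norm.
Qed.

Lemma integ_norm f : integ f -> integ (fun x => `|f x|).
Proof. exact: integrable_abse. Qed.

Lemma integ_add f g : integ f -> integ g -> integ (fun x => f x + g x).
Proof. exact: integrableD. Qed.

Lemma integ_scale c f : integ f -> integ (fun x => c * f x).
Proof. exact: integrableZl. Qed.

Lemma integ_opp f : integ f -> integ (fun x => - f x).
Proof. exact: integrableN. Qed.

Lemma integ_sub f g : integ f -> integ g -> integ (fun x => f x - g x).
Proof. by move=> hf hg; apply: integ_add => //; exact: integ_opp. Qed.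

Lemma sint_add f g : integ f -> integ g -> sint (fun x => f x + g x) = sint f + sint g.
Proof. exact: RintegralD. Qed.

Lemma sint_sub f g : integ f -> integ g -> sint (fun x => f x - g x) = sint f - sint g.
Proof. exact: RintegralB. Qed.

Lemma sint_scale c f : integ f -> sint (fun x => c * f x) = c * sint f.
Proof. exact: RintegralZl. Qed.

Lemma sint0 : @sint R n (fun=> 0) = 0.
Proof. by rewrite /sint integral0. Qed.

Lemma Rn_sintE f : integ f -> Rn_sint f = sint f.
Proof.
move=> hf; have /meas_rnP mf := integ_meas hf.
have mpos : measurable_fun (setT : set (borelT R n)) (fun x => (Num.max (f x) 0)%:E).
  by apply/measurable_EFinP; exact: (measurable_funrpos mf).
have mneg : measurable_fun (setT : set (borelT R n)) (fun x => (Num.max (- f x) 0)%:E).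
  by apply/measurable_EFinP; exact: (measurable_funrneg mf).
rewrite /Rn_sint !Rn_intE //; try by move=> x; rewrite lee_fin le_max lexx orbT.
have posE : (EFin \o f)^\+%E = (fun x : borelT R n => (Num.max (f x) 0)%:E).
  by apply/funext => x; rewrite funeposE /= EFin_max.
have negE : (EFin \o f)^\-%E = (fun x : borelT R n => (Num.max (- f x) 0)%:E).
  by apply/funext => x; rewrite funenegE /= EFin_max EFinN.
have /integral_fune_fin_num fp := integrable_funepos measurableT hf.
have /integral_fune_fin_num fn := integrable_funeneg measurableT hf.
rewrite /sint [in RHS]integralE -[(fun x => (f x)%:E)]/(EFin \o f).
move: (fp measurableT) (fn measurableT); rewrite posE negE => fp1 fn1.
exact/esym/(fineB fp1 fn1).
Qed.

Lemma sint_shift f (v : 'rV[R]_n) : integ f ->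
  integ (fun x => f (x + v)) /\ sint (fun x => f (x + v)) = sint f.
Proof.
move=> hf; have /meas_rnP mf := integ_meas hf.
have mfv : measurable_fun (setT : set (borelT R n)) (fun x : borelT R n => f (x + v)).
  exact: (measurableT_comp mf (measurable_continuous_rV (@continuous_translate R n v))).
have hfv : integ (fun x => f (x + v)).
  apply/integrableP; split; first exact/measurable_EFinP.
  rewrite (@lebn_shift R n v (fun x => `|(f x)%:E|%E)).
  - by have /integrableP[] := hf.
  - by apply: measurableT_comp; [exact: abse_measurable|exact/measurable_EFinP].
  - by move=> x; exact: abse_ge0.
split=> //; rewrite -!Rn_sintE // /Rn_sint.
have shift (g : 'rV[R]_n -> R) : meas_rn g ->
   Rn_int (fun x => (Num.max (g (x + v)) 0)%:E) = Rn_int (fun x => (Num.max (g x) 0)%:E).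
  move=> /meas_rnP mg.
  have mpos : measurable_fun (setT : set (borelT R n)) (fun x => (Num.max (g x) 0)%:E).
    by apply/measurable_EFinP; exact: (measurable_funrpos mg).
  rewrite !Rn_intE //; try by move=> x; rewrite lee_fin le_max lexx orbT.
    by rewrite (@lebn_shift R n v (fun x => (Num.max (g x) 0)%:E)) // => x; rewrite lee_fin le_max lexx orbT.
  exact: (measurableT_comp mpos (measurable_continuous_rV (@continuous_translate R n v))).
rewrite (shift f); last exact/meas_rnP.
rewrite (shift (fun x => - f x)) //; apply/meas_rnP; exact: measurable_funN.
Qed.

Lemma sint_cvg (F : nat -> 'rV[R]_n -> R) f g :
  (forall k, meas_rn (F k)) -> meas_rn f -> integ g ->
  (forall x, (fun k => F k x) @ \oo --> f x) -> (forall k x, `|F k x| <= g x) ->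
  integ f /\ (fun k => sint (F k)) @ \oo --> sint f.
Proof.
move=> mF mf ig cF Fg.
have mFE k : measurable_fun (setT : set (borelT R n)) (EFin \o F k).
  by apply/measurable_EFinP/meas_rnP; exact: mF.
have mfE : measurable_fun (setT : set (borelT R n)) (EFin \o f).
  by apply/measurable_EFinP/meas_rnP; exact: mf.
have [|| hf _ cv] := @dominated_convergence _ _ R (lebn R n) setT measurableT
  (fun k => EFin \o F k) (EFin \o f) (EFin \o g) mFE mfE _ ig _.
- apply: aeW => x _; apply: cvg_EFin; last exact: cF.
  by apply: nearW => k.
- by apply: aeW => x k _; rewrite /= lee_fin; exact: Fg.
split=> //; apply: fine_cvg; rewrite fineK; first exact: cv.
exact: integral_fune_fin_num.
Qed.

End SignedIntegral.

Section BoundedDomain.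
Context (R : realType) (n : nat) (p : R) (O : set 'rV[R]_n) (M : R).
Hypotheses (p1 : 1 < p) (oO : open O) (M0 : 0 <= M).
Hypothesis OM : O `<=` cbox (const_mx (- M)) (const_mx M).

Let p0 : 0 < p. Proof. exact: lt_trans p1. Qed.

Let mO : measurable (O : set (borelT R n)). Proof. exact: measurable_open. Qed.

Lemma lebn_domain_lty : (lebn R n O < +oo)%E.
Proof.
apply: (@le_lt_trans _ _ (lebn R n (cbox (const_mx (- M)) (const_mx M)))).
  by apply: le_measure; rewrite ?inE //; exact: measurable_cbox.
by rewrite lebn_cbox // ltry.
Qed.

Lemma integ_indic_domain : integ (\1_O : 'rV[R]_n -> R).
Proof.
apply/integrableP; split; first by apply/measurable_EFinP/measurable_indicP.
under eq_integral => x _ do rewrite /= ger0_norm //.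
by rewrite integral_indic // setIT; exact: lebn_domain_lty.
Qed.

Lemma le_1_powR (t : R) : 0 <= t -> t <= 1 + t `^ p.
Proof.
move=> t0; have [t1|t1] := leP t 1.
  by rewrite (le_trans t1) // lerDl powR_ge0.
have : t `^ 1 <= t `^ p by apply: ler_powR => //; exact: ltW.
by rewrite powRr1 // => /le_trans; apply; rewrite lerDr.
Qed.

(** On a domain of finite measure [1 + |f|^p] is an integrable bound for [|f|]. *)
Lemma inLp_integ f : inLp p O f -> integ (res O f).
Proof.
move=> [mf foo]; have mr : meas_rn (res O f) by apply/meas_rnP; exact: measurable_res.
have ipow : integ (fun x => `|res O f x| `^ p).
  apply/integrableP; split.
    by apply/measurable_EFinP/measurable_powR_norm; exact: measurable_res.
  under eq_integral => x _ do rewrite /= ger0_norm ?powR_ge0 //.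
  by rewrite -Lp_intE.
apply: (integ_le mr (integ_add integ_indic_domain ipow)) => x.
have [Ox|Ox] := pselect (O x).
  by rewrite [X in X + _]indicE mem_set //; exact: le_1_powR.
by rewrite res_out // normr0 addr_ge0 // powR_ge0.
Qed.

Lemma inLp_bounded f C : meas_rn f -> (forall x, O x -> `|f x| <= C) -> inLp p O f.
Proof.
move=> mf fC; split=> //; rewrite Lp_intE //.
have C0 : 0 <= Num.max C 0 by rewrite le_max lexx orbT.
apply: (@le_lt_trans _ _ (\int[lebn R n]_x ((Num.max C 0) `^ p * \1_O x)%:E)%E).
  apply: ge0_le_integral; rewrite ?measurableT //.
  - by apply/measurable_EFinP/measurable_powR_norm; exact: measurable_res.
  - by apply/measurable_EFinP; apply: measurable_funM => //; exact/measurable_indicP.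
  move=> x _; rewrite lee_fin; have [Ox|Ox] := pselect (O x).
    rewrite resE // indicE mem_set // mulr1; apply: ge0_ler_powR; rewrite ?nnegrE //.
      exact: ltW.
    by rewrite le_max fC.
  by rewrite res_out // indicE memNset // mulr0 normr0 powR0 // gt_eqF.
under eq_integral => x _ do rewrite EFinM.
rewrite integralZl //; last exact: integ_indic_domain.
rewrite integral_indic // setIT lte_mul_pinfty ?lee_fin ?powR_ge0 //.
exact: lebn_domain_lty.
Qed.

Lemma inLp_integM f h C : inLp p O f -> meas_rn h -> (forall x, `|h x| <= C) ->
  (forall x, ~ O x -> h x = 0) -> integ (fun x => f x * h x).
Proof.
move=> Lf mh hC h0; have ir := inLp_integ Lf.
have mfh : meas_rn (fun x => f x * h x).
  have [/meas_rnP mf _] := Lf; have /meas_rnP mh' := mh.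
  by apply/meas_rnP; exact: measurable_funM.
apply: (integ_le mfh (integ_scale C (integ_norm ir))) => x.
have [Ox|Ox] := pselect (O x).
  by rewrite resE // normrM mulrC ler_wpM2r.
by rewrite h0 // mulr0 normr0 res_out // normr0 mulr0.
Qed.

End BoundedDomain.

(** * Test functions and differentiation *)

Definition smooth1 (R : realType) (f : R -> R) := forall k x, derivable (derive1n k f) x 1.

(** By induction all iterated derivatives stay in [S]. To prove a bump smooth it then suffices to
    find a class stable under differentiation that contains it. *)
Lemma smooth1_closed (R : realType) (S : set (R -> R)) :
  (forall f, S f -> exists g, S g /\ forall x : R, is_derive x 1 f (g x)) ->
  forall f, S f -> smooth1 f.
Proof.
move=> Sd f Sf; suff S_ k : S (derive1n k f).
  by move=> k x; have [g [_ /(_ x)[]]] := Sd _ (S_ k).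
elim: k => [//|k Sk]; have [g [Sg dg]] := Sd _ Sk.
suff -> : derive1n k.+1 f = g by [].
apply/funext => x; rewrite derive1nS derive1E; exact: derive_val.
Qed.

Lemma smooth1_derive (R : realType) (f : R -> R) : smooth1 f -> smooth1 (derive1 f).
Proof. by move=> sf k x; have := sf k.+1 x; rewrite derive1Sn. Qed.

Lemma smooth1_is_derive (R : realType) (f : R -> R) (x : R) : smooth1 f -> is_derive x 1 f (derive1 f x).
Proof. by move=> sf; rewrite derive1E; apply/derivableP; exact: (sf 0%N). Qed.

Lemma smooth1_continuous (R : realType) (f : R -> R) : smooth1 f -> continuous f.
Proof.
move=> sf x; apply: differentiable_continuous; apply/derivable1_diffP; exact: (sf 0%N).
Qed.

Lemma is_derive0_quadratic (R : realType) (f : R -> R) (C : R) :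
  f 0 = 0 -> (forall t, `|f t| <= C * t ^+ 2) -> is_derive (0 : R) 1 f 0.
Proof.
move=> f0 fC.
have lim0 : h^-1 *: ((f \o shift 0) (h *: 1) - f 0) @[h --> 0^'] --> (0 : R).
  apply/cvgrPdist_le => e e0; near=> h.
  have h0 : h != 0 by near: h; exact: nbhs_dnbhs_neq.
  rewrite sub0r normrN f0 subr0 /= addr0 normrZ normfV -[h *: 1]/(h * 1) mulr1.
  rewrite ler_pdivrMl ?normr_gt0 //.
  rewrite (le_trans (fC h)) // -real_normK ?num_real // expr2 mulrA mulrC ler_pM2l ?normr_gt0 //.
  apply: (@le_trans _ _ ((`|C| + 1) * `|h|)).
    by rewrite ler_wpM2r // (le_trans (ler_norm C)) // lerDl.
  rewrite -ler_pdivlMl ?ltr_wpDl //.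
  by near: h; apply: dnbhs0_le; rewrite mulr_gt0 // invr_gt0 ltr_wpDl.
apply: DeriveDef; first exact: (cvgP _ lim0).
exact: cvg_lim.
Unshelve. all: by end_near. Qed.

(** For each monomial, [s^i <= i! exp s] by the exponential series. *)
Lemma poly_expRN_bounded (R : realType) (q : {poly R}) :
  exists C, forall s : R, 0 <= s -> `|q.[s]| * expR (- s) <= C.
Proof.
exists (\sum_(i < size q) `|q`_i| * (i`!)%:R) => s s0.
apply: (@le_trans _ _ (\sum_(i < size q) `|q`_i| * s ^+ i * expR (- s))).
  rewrite -mulr_suml ler_wpM2r ?expR_ge0 // horner_coef.
  apply: (le_trans (ler_norm_sum _ _ _)); apply: ler_sum => i _.
  by rewrite normrM [X in _ * X]ger0_norm // exprn_ge0.
apply: ler_sum => i _; rewrite -mulrA ler_wpM2l // expRN ler_pdivrMr ?expR_gt0 //.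
rewrite mulrC -ler_pdivrMr; last by rewrite ltr0n fact_gt0.
case: (nat_of_ord i) => [|j]; first by rewrite expr0 fact0 divr1 -expR0 ler_expR.
by apply: (le_trans _ (expR_ge1Dxn j s0)); rewrite lerDr.
Qed.

(** This class is stable under differentiation: the derivative belongs to the polynomial
    [X^2 (q - q')]. For [q = 1] it is the classical flat function. *)
Definition flat (R : realType) (q : {poly R}) (t : R) : R :=
  if 0 < t then q.[t^-1] * expR (- t^-1) else 0.

(** Applying [poly_expRN_bounded] to [X^2 q] gains the factor [t^2] that makes the derivative at 0
    exist and vanish. *)
Lemma flat_bound (R : realType) (q : {poly R}) : exists C, 0 <= C /\ forall t, `|flat q t| <= C * t ^+ 2.
Proof.
have [C hC] := poly_expRN_bounded ('X^2 * q).
have C0 : 0 <= C by apply: le_trans (hC 0 (lexx _)); rewrite mulr_ge0 // expR_ge0.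
exists C; split=> // t; rewrite /flat; case: ifPn => t0; last first.
  by rewrite normr0 mulr_ge0 // sqr_ge0.
have := hC t^-1; rewrite invr_ge0 ltW // => /(_ isT).
have tV0 : 0 <= t^-1 by rewrite invr_ge0 ltW.
rewrite hornerM hornerXn normrM normrX (ger0_norm tV0) exprVn.
rewrite -mulrA ler_pdivrMl ?exprn_gt0 // normrM (ger0_norm (expR_ge0 _)).
by rewrite [X in _ -> _ <= X]mulrC.
Qed.

Lemma is_derive_near (R : realType) (f g : R -> R) (x d : R) :
  (\forall y \near x, f y = g y) -> is_derive x 1 g d -> is_derive x 1 f d.
Proof.
by move=> fg dg; apply: near_eq_is_derive dg; apply: filterS fg => y ->.
Qed.

Lemma is_derive_flat (R : realType) (q : {poly R}) (t : R) :
  is_derive t 1 (flat q) (flat ('X^2 * (q - q^`())) t).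
Proof.
have [t0|t0|->] := ltgtP t 0.
- rewrite {2}/flat ltNge (ltW t0) /=.
  apply: (is_derive_near _ (is_derive_cst (0 : R) t (1 : R))).
  near=> y; rewrite /flat ifN //= -leNgt; apply: ltW; near: y; exact: lt_nbhsl.
- apply: (is_derive_near (g := fun y => q.[y^-1] * expR (- y^-1))).
    near=> y; rewrite /flat ifT //; near: y; exact: lt_nbhsr.
  have dV : is_derive t 1 (fun y : R => y^-1) (- t ^- 2).
    have tN0 : t != 0 by rewrite gt_eqF.
    apply: (is_derive_eq (@is_deriveV R id t 1 1 tN0 (is_derive_id t 1))).
    by rewrite /GRing.scale /= mulr1.
  have dq : is_derive t 1 (fun y : R => q.[y^-1]) (q^`().[t^-1] * - t ^- 2).
    exact: (is_derive1_comp (f := horner q)).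
  have dE : is_derive t 1 (fun y : R => expR (- y^-1)) (expR (- t^-1) * - (- t ^- 2)).
    exact: (is_derive1_comp (f := expR) (g := fun y : R => - y^-1)).
  apply: (is_derive_eq (is_deriveM dq dE)).
  rewrite /flat t0 hornerM hornerXn hornerD hornerN exprVn /GRing.scale /=; ring.
- rewrite {2}/flat ltxx; have [C [_ hC]] := flat_bound q.
  by apply: (is_derive0_quadratic (C := C)) => //; rewrite /flat ltxx.
Unshelve. all: by end_near. Qed.

(** Stable under differentiation: the product rule differentiates the polynomial factor, and the
    chain rule multiplies it by [u'] while changing the polynomial inside [flat]. *)
Definition flat_comb (R : realType) (u : {poly R}) (l : seq ({poly R} * {poly R})) (t : R) : R :=
  \sum_(x <- l) x.1.[t] * flat x.2 u.[t].

Lemma smooth1_flat_comb (R : realType) (u : {poly R}) l : smooth1 (flat_comb u l).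
Proof.
apply: (@smooth1_closed R [set f | exists l, f = flat_comb u l]); last by exists l.
move=> _ [{}l ->].
exists (flat_comb u (flatten [seq [:: (x.1^`(), x.2); (x.1 * u^`(), 'X^2 * (x.2 - x.2^`()))] | x <- l])).
split=> [|t]; first by eexists.
elim: l => [|x l IH] /=.
  rewrite (_ : flat_comb u [::] = cst 0); first exact: is_derive_cst.
  by apply/funext => s; rewrite /flat_comb big_nil.
rewrite (_ : flat_comb u (x :: l) = (fun s => x.1.[s] * flat x.2 u.[s]) + flat_comb u l); last first.
  by apply/funext => s; rewrite /flat_comb big_cons.
have dF : is_derive t 1 (fun s => flat x.2 u.[s]) (flat ('X^2 * (x.2 - x.2^`())) u.[t] * u^`().[t]).
  exact: (is_derive1_comp (is_derive_flat x.2 u.[t]) (is_derive_poly u t)).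
have dP := is_derive_poly x.1 t.
apply: (is_derive_eq (is_deriveD (is_deriveM dP dF) IH)).
rewrite /flat_comb !big_cons /= hornerM /GRing.scale /=; ring.
Qed.

(** For [a <= b] this is smooth, has values in [[0, 1]] and is positive exactly on the open
    interval; the factor [k.+1] makes it tend to the indicator. *)
Definition bump1 (R : realType) (a b : R) (k : nat) : R -> R :=
  fun t => flat 1 (k.+1%:R * (t - a) * (b - t)).

Lemma smooth1_bump1 (R : realType) (a b : R) k : smooth1 (bump1 a b k).
Proof.
rewrite (_ : bump1 a b k = flat_comb (k.+1%:R%:P * ('X - a%:P) * (b%:P - 'X)) [:: (1, 1)]).
  exact: smooth1_flat_comb.
apply/funext => t; rewrite /flat_comb big_seq1 /= hornerE mul1r /bump1; congr flat.
by rewrite !hornerE.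
Qed.

Lemma flat1E (R : realType) (t : R) : flat 1 t = if 0 < t then expR (- t^-1) else 0.
Proof. by rewrite /flat hornerC mul1r. Qed.

Lemma bump1_ge0 (R : realType) (a b : R) k t : 0 <= bump1 a b k t.
Proof. by rewrite /bump1 flat1E; case: ifP => // _; exact: expR_ge0. Qed.

Lemma bump1_le1 (R : realType) (a b : R) k t : bump1 a b k t <= 1.
Proof.
rewrite /bump1 flat1E; case: ifP => // t0.
by rewrite -[leRHS]expR0 ler_expR oppr_le0 invr_ge0 ltW.
Qed.

Lemma bump1_out (R : realType) (a b : R) k t : a <= b -> ~~ (a < t < b) -> bump1 a b k t = 0.
Proof.
move=> ab tab; rewrite /bump1 flat1E ifN // -leNgt -mulrA pmulr_rle0 ?ltr0n //.
move: tab; rewrite negb_and -!leNgt => /orP[ta|bt].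
  by rewrite mulr_le0_ge0 // ?subr_le0 // subr_ge0 (le_trans ta).
by rewrite mulr_ge0_le0 // ?subr_le0 // subr_ge0 (le_trans ab).
Qed.

Lemma bump1_cvg (R : realType) (a b t : R) : a < t < b -> (fun k => bump1 a b k t) @ \oo --> (1 : R).
Proof.
move=> /andP[at_ tb]; pose c := (t - a) * (b - t).
have c0 : 0 < c by rewrite mulr_gt0 // subr_gt0.
have -> : (fun k => bump1 a b k t) = (fun k => expR (- (k.+1%:R^-1 * c^-1))).
  apply/funext => k; rewrite /bump1 flat1E -mulrA -/c ifT; first by rewrite invfM.
  by rewrite mulr_gt0 // ltr0n.
have cV : (fun k : nat => - (k.+1%:R^-1 * c^-1)) @ \oo --> (0 : R).
  rewrite -[X in _ --> X]oppr0; apply: cvgN; rewrite -[X in _ --> X](mul0r c^-1).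
  by apply: cvgM; [exact: cvg_harmonic|exact: cvg_cst].
by have := cvg_comp _ _ cV (@continuous_expR R 0); rewrite expR0.
Qed.

(** * Increments along arbitrary directions from partial derivatives *)

Lemma is_derive1P (R : realType) (V : normedModType R) (f : V -> R) (x v : V) (d : R) :
  is_derive x v f d <-> is_derive (0 : R) 1 (fun h : R => f (h *: v + x)) d.
Proof.
have E : (fun h : R => h^-1 *: ((f \o shift x) (h *: v) - f x)) =
  (fun h : R => h^-1 *: (((fun h : R => f (h *: v + x)) \o shift 0) (h *: 1) - (f (0 *: v + x)))).
  by apply/funext => h /=; rewrite addr0 scale0r add0r -[h *: 1]/(h * 1) mulr1.
split=> -[df vf].
  apply: DeriveDef; first exact: (derivable1P f x v).1 df.
  by rewrite /derive -E.
apply: DeriveDef; first exact: (derivable1P f x v).2 df.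
by rewrite /derive E.
Qed.

Lemma is_derive_along (R : realType) (V : normedModType R) (f : V -> R) (v y : V) (s : R) :
  derivable f (s *: v + y) v -> is_derive s 1 (fun h : R => f (h *: v + y)) ('D_v f (s *: v + y)).
Proof.
move=> /derivableP /is_derive1P dfv; apply/is_derive1P.
rewrite (_ : (fun h : R => _) = (fun h : R => f (h *: v + (s *: v + y)))) //.
by apply/funext => h; rewrite scalerDl -[h *: 1]/(h * 1) mulr1 addrA.
Qed.

Lemma MVT_along (R : realType) (V : normedModType R) (f : V -> R) (v y : V) (r : R) :
  (forall x, derivable f x v) ->
  exists t : R, `|t| <= `|r| /\ f (r *: v + y) - f y = r * 'D_v f (t *: v + y).
Proof.
move=> df; pose g h := f (h *: v + y); pose g' h := 'D_v f (h *: v + y).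
have dg (s : R) : is_derive s 1 g (g' s) by exact: is_derive_along.
have cg (i : interval R) : {within [set` i], continuous g}.
  by apply: derivable_within_continuous => s _; case: (dg s).
have g0 : g 0 = f y by rewrite /g scale0r add0r.
have [r0|r0] := leP 0 r.
  have [c] := MVT_segment r0 (fun s _ => dg s) (cg _).
  rewrite in_itv /= subr0 g0 => /andP[c0 cr] E.
  by exists c; split; [rewrite !ger0_norm|rewrite /g mulrC in E *; rewrite -E].
have [c] := MVT_segment (ltW r0) (fun s _ => dg s) (cg _).
rewrite in_itv /= sub0r g0 => /andP[rc c0] E.
exists c; split; first by rewrite !ler0_norm ?lerN2 // ltW.
by rewrite -[LHS]opprB E mulrN opprK mulrC.
Qed.

Lemma cvg_sumr (R : realType) (I : Type) (s : seq I) (F : nat -> I -> R) (l : I -> R) :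
  (forall i, (fun k => F k i) @ \oo --> l i) ->
  (fun k => \sum_(i <- s) F k i) @ \oo --> \sum_(i <- s) l i.
Proof.
move=> Fl; elim: s => [|i s IH].
  by rewrite big_nil; under eq_cvg do rewrite big_nil; exact: cvg_cst.
by rewrite big_cons; under eq_cvg do rewrite big_cons; exact: cvgD.
Qed.

Section Directional.
Context (R : realType) (n : nat) (f : 'rV[R]_n -> R) (B : R).
Hypothesis df : forall (i : 'I_n) x, derivable f x (unitv R i).
Hypothesis cdf : forall i : 'I_n, continuous ('D_(unitv R i) f).
Hypothesis dfB : forall (i : 'I_n) x, `|'D_(unitv R i) f x| <= B.

Definition pgrad (x xi : 'rV[R]_n) : R := \sum_(i < n) xi ord0 i * 'D_(unitv R i) f x.

Let step (xi : 'rV[R]_n) (t : R) (x : 'rV[R]_n) (k : nat) : 'rV[R]_n :=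
  x + t *: \row_(i < n) (if (i < k)%N then xi ord0 i else 0).

Let step_coord xi t (x : 'rV[R]_n) k j : `|x ord0 j - step xi t x k ord0 j| <= `|t| * `|xi|.
Proof.
rewrite !mxE opprD addrA subrr add0r normrN normrM ler_wpM2l //.
by case: ifP => _; rewrite ?normr0 //; exact: norm_coord_le.
Qed.

(** [Ck] only provides partial derivatives, so the segment from [x] to [x + t xi] is replaced by a
    staircase of coordinate steps, with the mean value theorem on each. The factor 2 adds the
    distance of the start of a step and the offset of the intermediate point. *)
Lemma increment_telescope (xi : 'rV[R]_n) (t : R) (x : 'rV[R]_n) :
  exists z : 'I_n -> 'rV[R]_n,
    (forall i j, `|x ord0 j - z i ord0 j| <= 2 * (`|t| * `|xi|)) /\
    f (x + t *: xi) - f x = t * \sum_(i < n) xi ord0 i * 'D_(unitv R i) f (z i).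
Proof.
have stepS (i : 'I_n) : step xi t x i.+1 = (t * xi ord0 i) *: unitv R i + step xi t x i.
  apply/rowP => j; rewrite !mxE eqxx /= ltnS leq_eqVlt.
  rewrite -(inj_eq val_inj) /=; case: (eqVneq (j : nat) i) => [ji|ji] /=.
    by rewrite ltn_neqAle ji eqxx /= (ord_inj ji); ring.
  by rewrite mulr0 add0r.
have /choice[s hs] : forall i : 'I_n, exists s : R, `|s| <= `|t * xi ord0 i| /\
   f (step xi t x i.+1) - f (step xi t x i) =
     (t * xi ord0 i) * 'D_(unitv R i) f (s *: unitv R i + step xi t x i).
  by move=> i; rewrite stepS; apply: MVT_along; exact: df.
exists (fun i => s i *: unitv R i + step xi t x i); split=> [i j|].
  have := step_coord xi t x i j; have [+ _] := hs i; move: (step xi t x i) => y si xy.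
  rewrite mxE opprD addrCA addrC mulr2n mulrDl mul1r (le_trans (ler_normD _ _)) // lerD //.
  rewrite normrN mxE normrM (@le_trans _ _ `|s i|) //.
    by rewrite !mxE ler_piMr //; case: (_ && _); rewrite ?normr0 ?normr1.
  by rewrite (le_trans si) // normrM ler_wpM2l // norm_coord_le.
rewrite mulr_sumr.
have -> : f (x + t *: xi) - f x = f (step xi t x n) - f (step xi t x 0).
  congr (f _ - f _); last by apply/rowP => j; rewrite !mxE mulr0 addr0.
  by apply/rowP => j; rewrite !mxE ltn_ord.
rewrite -(telescope_sumr (fun k => f (step xi t x k))) // big_mkord.
by apply: eq_bigr => i _; have [_ ->] := hs i; rewrite mulrA.
Qed.

Lemma increment_le (xi : 'rV[R]_n) (t : R) (x : 'rV[R]_n) :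
  `|f (x + t *: xi) - f x| <= `|t| * (n%:R * `|xi| * B).
Proof.
have [z [_ ->]] := increment_telescope xi t x.
rewrite normrM ler_wpM2l // (le_trans (ler_norm_sum _ _ _)) //.
apply: (@le_trans _ _ (\sum_(i < n) `|xi| * B)); last first.
  by rewrite sumr_const card_ord -[leLHS]mulr_natl mulrA.
by apply: ler_sum => i _; rewrite normrM ler_pM // norm_coord_le.
Qed.

(** The intermediate points of the staircase tend to [x], and the partial derivatives are
    continuous. *)
Lemma increment_cvg (xi x : 'rV[R]_n) :
  (fun k : nat => k.+1%:R * (f (x + k.+1%:R^-1 *: xi) - f x)) @ \oo --> pgrad x xi.
Proof.
have /choice[z hz] : forall k : nat, exists z : 'I_n -> 'rV[R]_n,
    (forall i j, `|x ord0 j - z i ord0 j| <= 2 * (k.+1%:R^-1 * `|xi|)) /\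
    k.+1%:R * (f (x + k.+1%:R^-1 *: xi) - f x) = \sum_(i < n) xi ord0 i * 'D_(unitv R i) f (z i).
  move=> k; have [z [h1 h2]] := increment_telescope xi k.+1%:R^-1 x.
  exists z; split=> [i j|]; first by rewrite (le_trans (h1 i j)) // ger0_norm.
  by rewrite h2 mulrA divff ?mul1r // pnatr_eq0.
under eq_cvg do rewrite (hz _).2.
apply: cvg_sumr => i; apply: cvgM; first exact: cvg_cst.
have cz : (fun k => z k i) @ \oo --> x.
  have xi0 : 0 < 2 * (`|xi| + 1) by rewrite mulr_gt0 // ltr_wpDl.
  apply/cvg_ballP => e e0.
  have ee : 0 < e / (2 * (`|xi| + 1)) by rewrite divr_gt0.
  near=> k; apply: ball_rV => // j.
  rewrite (le_lt_trans ((hz k).1 i j)) // mulrCA.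
  apply: (@le_lt_trans _ _ (k.+1%:R^-1 * (2 * (`|xi| + 1)))).
    by rewrite ler_wpM2l // ler_wpM2l // lerDl.
  rewrite -ltr_pdivlMr //.
  by near: k; exact: (near_infty_natSinv_lt (PosNum ee)).
exact: (cvg_comp _ _ cz (@cdf i x)).
Unshelve. all: by end_near. Qed.

End Directional.

(** * Bump functions supported in boxes *)

Definition tensor (R : realType) n (f : 'I_n -> R -> R) (x : 'rV[R]_n) : R :=
  \prod_(i < n) f i (x ord0 i).

Lemma continuous_coord (R : realType) n (f : R -> R) (i : 'I_n) : continuous f ->
  continuous (fun x : 'rV[R]_n => f (x ord0 i)).
Proof.
move=> cf x; apply: (@continuous_comp _ _ _ (fun x : 'rV[R]_n => x ord0 i) f).
  exact: coord_continuous.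
exact: cf.
Qed.

Lemma continuous_prod_fun (R : realType) (T : topologicalType) (I : Type) (s : seq I) (F : I -> T -> R) :
  (forall i, continuous (F i)) -> continuous (fun x => \prod_(i <- s) F i x).
Proof.
move=> cF; elim: s => [|i s IH] x.
  rewrite (_ : (fun y => _) = fun=> 1); first exact: (@cst_continuous T R 1).
  by apply/funext => y; rewrite big_nil.
rewrite (_ : (fun y => _) = F i \* (fun y => \prod_(i <- s) F i y)).
  by apply: continuousM; [exact: cF|exact: IH].
by apply/funext => y; rewrite big_cons.
Qed.

Lemma continuous_sum_fun (R : realType) (T : topologicalType) (I : Type) (s : seq I) (F : I -> T -> R) :
  (forall i, continuous (F i)) -> continuous (fun x => \sum_(i <- s) F i x).
Proof.
move=> cF; elim: s => [|i s IH] x.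
  rewrite (_ : (fun y => _) = fun=> 0); first exact: (@cst_continuous T R 0).
  by apply/funext => y; rewrite big_nil.
rewrite (_ : (fun y => _) = F i \+ (fun y => \sum_(i <- s) F i y)).
  by apply: (@continuousD R R T (F i) (fun y => \sum_(i <- s) F i y) x); [exact: cF|exact: IH].
by apply/funext => y; rewrite big_cons.
Qed.

Lemma is_derive_tensor (R : realType) n (f : 'I_n -> R -> R) (j : 'I_n) (x : 'rV[R]_n) :
  (forall i, smooth1 (f i)) ->
  is_derive x (unitv R j) (tensor f)
    (tensor (fun i => if i == j then derive1 (f i) else f i) x).
Proof.
move=> sf; apply/is_derive1P.
rewrite /tensor (bigD1 j) //= eqxx.
set c := \prod_(i < n | i != j) _.
have -> : (fun h : R => \prod_(i < n) f i ((h *: unitv R j + x) ord0 i)) =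
  (fun h : R => f j (h + x ord0 j)) * (fun=> c).
  apply/funext => h; rewrite (bigD1 j) //=; congr (f j _ * _).
    by rewrite !mxE !eqxx mulr1.
  apply: eq_bigr => i ij; rewrite !mxE (negbTE ij) andbF mulr0 add0r //.
have dj : is_derive (0 : R) 1 (fun h : R => f j (h + x ord0 j)) (derive1 (f j) (x ord0 j)).
  have ds : is_derive (0 : R) 1 (fun h : R => h + x ord0 j) 1.
    by apply: (is_derive_eq (@is_deriveD R R R id (fun=> x ord0 j) 0 1 1 0 _ _)); rewrite addr0.
  have dfj : is_derive (0 + x ord0 j) 1 (f j) (derive1 (f j) (0 + x ord0 j)).
    exact: smooth1_is_derive.
  apply: (is_derive_eq (@is_derive1_comp R (f j) (fun h => h + x ord0 j) 0 _ _ dfj ds)).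
  by rewrite mulr1 add0r.
apply: (is_derive_eq (is_deriveM dj (is_derive_cst c (0 : R) (1 : R)))).
by rewrite /GRing.scale /= mulr0 add0r mulrC.
Qed.

(** Differentiating one factor gives another product of smooth functions, so the induction on [k]
    quantifies over all factors. *)
Lemma Ck_tensor (R : realType) n (f : 'I_n -> R -> R) k : (forall i, smooth1 (f i)) -> Ck k (tensor f).
Proof.
elim: k f => [|k IH] f sf; split=> //.
- by apply: continuous_prod_fun => i; apply: continuous_coord; exact: smooth1_continuous.
- by apply: continuous_prod_fun => i; apply: continuous_coord; exact: smooth1_continuous.
move=> j; have dt x := is_derive_tensor j x sf.
split=> [x|]; first by case: (dt x).
rewrite (_ : 'D_(unitv R j) (tensor f) = tensor (fun i => if i == j then derive1 (f i) else f i)).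
  by apply: IH => i; case: eqP => // _; exact: smooth1_derive.
by apply/funext => x; case: (dt x).
Qed.

Lemma compact_cbox (R : realType) n (a b : 'rV[R]_n) : compact (cbox a b).
Proof.
have := @rV_compact R n (fun i => `[a ord0 i, b ord0 i]%classic) (fun i => @segment_compact R _ _).
by rewrite (_ : [set v : 'rV[R]_n | _] = cbox a b) //; apply/seteqP; split=> x h i;
  have := h i; rewrite /= in_itv.
Qed.

Lemma closed_cbox (R : realType) n (a b : 'rV[R]_n) : closed (cbox a b).
Proof. by apply: compact_closed; [exact: norm_hausdorff|exact: compact_cbox]. Qed.

Definition bump (R : realType) n (a b : 'rV[R]_n) (k : nat) : 'rV[R]_n -> R :=
  tensor (fun i => bump1 (a ord0 i) (b ord0 i) k).

Lemma bump_ge0 (R : realType) n (a b : 'rV[R]_n) k x : 0 <= bump a b k x.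
Proof. by apply: prodr_ge0 => i _; exact: bump1_ge0. Qed.

Lemma bump_le1 (R : realType) n (a b : 'rV[R]_n) k x : bump a b k x <= 1.
Proof. by apply: prodr_ile1 => i _; rewrite bump1_ge0 bump1_le1. Qed.

Lemma bump_out (R : realType) n (a b : 'rV[R]_n) k x : (forall i, a ord0 i <= b ord0 i) ->
  ~ obox a b x -> bump a b k x = 0.
Proof.
move=> ab /existsNP[i /negP xi]; rewrite /bump /tensor (bigD1 i) //=.
by rewrite bump1_out // mul0r.
Qed.

Lemma bump_cvg (R : realType) n (a b : 'rV[R]_n) x : (forall i, a ord0 i <= b ord0 i) ->
  (fun k => bump a b k x) @ \oo --> (\1_(obox a b) x : R).
Proof.
move=> ab; have [xab|xab] := pselect (obox a b x); last first.
  by rewrite indicE memNset //; under eq_cvg do rewrite bump_out //; exact: cvg_cst.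
rewrite indicE mem_set // /bump /tensor.
have : forall s : seq 'I_n, (fun k => \prod_(i <- s) bump1 (a ord0 i) (b ord0 i) k (x ord0 i)) @ \oo --> (1 : R).
  elim=> [|i s IH]; first by under eq_cvg do rewrite big_nil; exact: cvg_cst.
  under eq_cvg do rewrite big_cons.
  have := cvgM (bump1_cvg (xab i)) IH; rewrite mul1r; exact.
exact.
Qed.

Lemma test_fun_bump (R : realType) n (O : set 'rV[R]_n) (a b : 'rV[R]_n) k :
  (forall i, a ord0 i <= b ord0 i) -> cbox a b `<=` O -> test_fun O (bump a b k).
Proof.
move=> ab abO; have cl : closure [set x | bump a b k x != 0] `<=` cbox a b.
  rewrite closureE; apply: smallest_sub; first exact: closed_cbox.
  move=> x /= x0; have xab : obox a b x.
    by apply: contrapT => xab; move: x0; rewrite bump_out // eqxx.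
  by move=> i; have /andP[/ltW -> /ltW ->] := xab i.
split=> [j|]; first by apply: Ck_tensor => i; exact: smooth1_bump1.
split; last exact: subset_trans abO.
apply: (@subclosed_compact _ _ (cbox a b)); [exact: closed_closure|exact: compact_cbox|exact: cl].
Qed.

(** * The fundamental lemma of the calculus of variations *)

Section Density.
Local Open Scope ereal_scope.
Context d (T : measurableType d) (R : realType) (mu : {measure set T -> \bar R}).
Context (f : T -> \bar R) (U : set T).
Hypotheses (mf : measurable_fun setT f) (f0 : forall x, 0 <= f x) (mU : measurable U).

Let density (A : set T) : \bar R := \int[mu]_(x in A `&` U) f x.

Let density0 : density set0 = 0.
Proof. by rewrite /density set0I integral_set0. Qed.

Let density_ge0 A : 0 <= density A.
Proof. exact: integral_ge0. Qed.

Let density_sigma_additive : semi_sigma_additive density.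
Proof.
move=> F mF tF mUF.
rewrite [X in _ --> X](_ : _ = \sum_(n <oo) density (F n)).
  by apply/cvg_closeP; split; [exact: is_cvg_nneseries|rewrite closeE].
rewrite /density setI_bigcupl ge0_integral_bigcup //.
- by move=> k; exact: measurableI.
- exact: measurable_funTS.
- exact: trivIset_setIr.
Qed.

HB.instance Definition _ := isMeasure.Build _ _ _ density
  density0 density_ge0 density_sigma_additive.

(** Serves to compare the positive and the negative part of a function on a box by uniqueness of
    measures. *)
Lemma density_measure : exists nu : {measure set T -> \bar R},
  forall A, nu A = \int[mu]_(x in A `&` U) f x.
Proof. by exists density. Qed.

End Density.

Lemma ae_and d (T : measurableType d) (R : realType) (mu : {measure set T -> \bar R})
  (P Q : T -> Prop) : {ae mu, forall x, P x} -> {ae mu, forall x, Q x} ->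
  {ae mu, forall x, P x /\ Q x}.
Proof. by move=> hP hQ; apply: filterS2 hP hQ. Qed.

Lemma integral_sint (R : realType) n (g : 'rV[R]_n -> R) (B : set (borelT R n)) :
  integ g -> measurable B ->
  integ (fun x => g x * \1_B x) /\
  (\int[lebn R n]_(x in B) (g x)%:E = (sint (fun x => g x * \1_B x))%:E)%E.
Proof.
move=> ig mB.
have igB : integ (fun x => g x * \1_B x).
  apply: (integ_le _ (integ_norm ig)).
    apply/meas_rnP; apply: measurable_funM; first by apply/meas_rnP; exact: integ_meas ig.
    exact/measurable_indicP.
  move=> x; rewrite normrM ler_piMr // indicE.
  by case: (_ \in _); rewrite ?normr0 ?normr1.
split=> //; rewrite /sint fineK; last exact: integral_fune_fin_num.
rewrite integral_mkcond; apply: eq_integral => x _.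
by rewrite patchE indicE; case: (_ \in _); rewrite ?mulr1 ?mulr0.
Qed.

Section FundamentalLemma.
Context (R : realType) (n : nat) (O : set 'rV[R]_n).
Hypothesis oO : open O.
Variable h : 'rV[R]_n -> R.
Hypothesis ih : integ (res O h).
Hypothesis h0 : forall phi, test_fun O phi -> sint (fun x => h x * phi x) = 0.

Let mres : measurable_fun (setT : set (borelT R n)) (res O h).
Proof. by apply/meas_rnP; exact: integ_meas ih. Qed.

(** The bumps of the box are test functions and tend boundedly to its indicator. *)
Lemma sint_obox0 (a b : 'rV[R]_n) : cbox a b `<=` O -> sint (fun x => res O h x * \1_(obox a b) x) = 0.
Proof.
move=> abO; have [ab|] := pselect (forall i, a ord0 i <= b ord0 i); last first.
  move=> /existsNP[i /negP]; rewrite -ltNge => ba.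
  rewrite (_ : (fun x => _) = fun=> 0) ?sint0 //; apply/funext => x.
  rewrite indicE memNset ?mulr0 // => /(_ i) /andP[h1 h2].
  by have := lt_trans (lt_trans h1 h2) ba; rewrite ltxx.
have mb k : measurable_fun (setT : set (borelT R n)) (bump a b k).
  by apply: measurable_continuous; have [/(_ 0%N)[]] := test_fun_bump k ab abO.
have cv := @sint_cvg R n (fun k x => res O h x * bump a b k x)
  (fun x => res O h x * \1_(obox a b) x) (fun x => `|res O h x|).
have {cv} [| | | | | _ cv] := cv.
- by move=> k; apply/meas_rnP; exact: measurable_funM.
- apply/meas_rnP; apply: measurable_funM => //; apply/measurable_indicP.
  by apply: measurable_open; exact: open_obox.
- exact: integ_norm.
- by move=> x; apply: cvgM; [exact: cvg_cst|exact: bump_cvg].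
- move=> k x; rewrite normrM ler_piMr // ger0_norm ?bump_le1 //; exact: bump_ge0.
suff E : (fun k => sint (fun x => res O h x * bump a b k x)) = fun=> 0.
  by move: cv; rewrite E => cv; exact: (cvg_unique _ cv (cvg_cst 0)).
apply/funext => k; rewrite -(h0 (test_fun_bump k ab abO)); congr sint.
apply/funext => x; have [Ox|Ox] := pselect (O x); first by rewrite resE.
rewrite bump_out ?mulr0 // => xab; apply: Ox; apply: abO => i.
by have /andP[/ltW -> /ltW ->] := xab i.
Qed.

Lemma obox_capE (a b c d : 'rV[R]_n) : obox a b `&` obox c d =
  obox (\row_i Num.max (a ord0 i) (c ord0 i)) (\row_i Num.min (b ord0 i) (d ord0 i)).
Proof.
apply/seteqP; split=> [x [h1 h2] i|x hx].
  by rewrite !mxE gt_max lt_min; have /andP[-> ->] := h1 i; have /andP[-> ->] := h2 i.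
by split=> i; have := hx i; rewrite !mxE gt_max lt_min => /andP[/andP[h1 h2] /andP[h3 h4]]; apply/andP.
Qed.

Definition oboxes : set (set 'rV[R]_n) := [set B | exists a b, B = obox a b].

Lemma borel_oboxes : (@measurable _ (borelT R n)) = <<s oboxes >>.
Proof.
apply/seteqP; split; last first.
  apply: smallest_sub; first exact: sigma_algebra_measurable.
  by move=> _ [a [b ->]]; apply: measurable_open; exact: open_obox.
apply: smallest_sub; first exact: smallest_sigma_algebra.
move=> U /= oU; rewrite (open_bigcup_boxes oU) bigcup_mkcond.
apply: (@countable_bigcupT_measurable _ (g_sigma_algebraType oboxes)).
  exact: countableP.
move=> q; case: ifP => _; last exact: measurable0.
by apply: sub_sigma_algebra; eexists; eexists.
Qed.

Let part (s : bool) (x : borelT R n) : \bar R :=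
  (Num.max (if s then - res O h x else res O h x) 0)%:E.

Let mpart s : measurable_fun setT (part s).
Proof.
apply/measurable_EFinP; case: s; first exact: (measurable_funrneg mres).
exact: (measurable_funrpos mres).
Qed.

Let part_ge0 s x : (0 <= part s x)%E.
Proof. by rewrite lee_fin le_max lexx orbT. Qed.

Let ipart s (A : set (borelT R n)) : measurable A -> (lebn R n).-integrable A (part s).
Proof.
move=> mA; apply: (integrableS measurableT mA) => //.
apply: (le_integrable measurableT (mpart s) _ ih) => x _.
rewrite /= lee_fin ger0_norm; last by rewrite le_max lexx orbT.
by case: s; rewrite ge_max normr_ge0 andbT; [rewrite -normrN|]; exact: ler_norm.
Qed.

Let rpart (s : bool) (x : 'rV[R]_n) : R := Num.max (if s then - res O h x else res O h x) 0.

Let irpart s : integ (rpart s).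
Proof. by have := ipart s measurableT. Qed.

(** The positive and the negative part of [res O h] define two measures on the box that agree on all
    sub-boxes, hence on all Borel sets, as boxes form a generating pi-system. Where one part is
    positive the other vanishes, so both integrals over that set are 0. *)
Lemma ae0_box (a b : 'rV[R]_n) : cbox a b `<=` O ->
  {ae lebn R n, forall x, obox a b x -> res O h x = 0}.
Proof.
move=> abO; pose U : set (borelT R n) := obox a b.
have mob c d : measurable (obox c d : set (borelT R n)).
  by apply: measurable_open; exact: open_obox.
have mU : measurable U by exact: mob.
have [nu1 nu1E] := density_measure (lebn R n) (mpart true) (part_ge0 true) mU.
have [nu2 nu2E] := density_measure (lebn R n) (mpart false) (part_ge0 false) mU.
have eqb c d : nu1 (obox c d) = nu2 (obox c d).
  rewrite nu1E nu2E /U obox_capE; set c' := \row_i _; set d' := \row_i _.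
  have cdO : cbox c' d' `<=` O.
    apply: subset_trans abO => x hx i; have := hx i.
    by rewrite !mxE ge_max le_min => /andP[/andP[_ ->] /andP[_ ->]].
  have [i1 E1] := integral_sint (irpart true) (mob c' d').
  have [i2 E2] := integral_sint (irpart false) (mob c' d').
  have := sint_obox0 cdO.
  have -> : (fun x => res O h x * \1_(obox c' d') x) =
     (fun x => rpart false x * \1_(obox c' d') x - rpart true x * \1_(obox c' d') x).
    apply/funext => x; rewrite -mulrBl /rpart; congr (_ * _).
    by case: (leP (res O h x) 0) => hx; [rewrite max_l|rewrite max_r]; lra.
  rewrite sint_sub // => /eqP; rewrite subr_eq0 => /eqP E.
  by rewrite [LHS]E1 [RHS]E2 E.
have eqA A : measurable A -> nu1 A = nu2 A.
  move=> mA; apply: (@measure_unique _ R (borelT R n) oboxes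
    (fun k => obox (const_mx (- k%:R)) (const_mx k%:R))) => //.
  - exact: borel_oboxes.
  - by move=> _ _ [a1 [b1 ->]] [a2 [b2 ->]]; rewrite obox_capE; eexists; eexists.
  - by move=> k; eexists; eexists.
  - apply/seteqP; split=> // x _; exists (Num.truncn `|x|).+1 => // i.
    by rewrite !mxE -ltr_norml (le_lt_trans (norm_coord_le x i)) // Num.Theory.truncnS_gt.
  - by move=> _ [c [d ->]]; exact: eqb.
  - move=> k; rewrite nu1E.
    have [_ E1] := integral_sint (irpart true) (measurableI _ _ (mob (const_mx (- k%:R)) (const_mx k%:R)) mU).
    by rewrite [X in (X < _)%E]E1 ltry.
have nu0 s : {ae lebn R n, forall x, U x -> part s x = 0%E}.
  pose P : set (borelT R n) := [set x | 0 < if s then - res O h x else res O h x].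
  have mP : measurable P.
    have mg : measurable_fun (setT : set (borelT R n)) (fun x => if s then - res O h x else res O h x).
      by case: (s); [exact: measurable_funN|exact: mres].
    by have := mg measurableT _ (measurable_itv `]0, +oo[); rewrite setTI preimage_itvoy.
  have int0 : (\int[lebn R n]_(x in P `&` U) `|part s x| = 0)%E.
    have -> : (\int[lebn R n]_(x in P `&` U) `|part s x| = \int[lebn R n]_(x in P `&` U) part s x)%E.
      by apply: eq_integral => x _; rewrite gee0_abs.
    have z : (\int[lebn R n]_(x in P `&` U) part (~~ s) x = 0)%E.
      apply: integral0_eq => x [Px _]; rewrite /part; congr EFin.
      by move: Px; rewrite /P /=; case: (s) => /= Px; rewrite max_r //; lra.
    by rewrite -z; case: (s); rewrite -nu1E -nu2E eqA.
  have mPU := measurableI _ _ mP mU.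
  have /ae_eq_integral_abs := int0; move=> /(_ mPU (measurable_funTS (mpart s))).
  apply: ae_sub => x hx Ux; have [Px|Px] := pselect (P x); first exact: hx.
  rewrite /part max_r // leNgt; exact/negP.
apply: ae_sub (ae_and (nu0 true) (nu0 false)) => x [h1 h2] Ux.
have [] := (h1 Ux, h2 Ux); rewrite /part => -[m1] [m2].
apply/eqP; rewrite eq_le; apply/andP; split.
  by rewrite -m2 le_max lexx.
by rewrite -oppr_le0 -m1 le_max lexx.
Qed.

(** Countably many rational boxes cover [O], so the exceptional null sets of the boxes add up to a
    null set. *)
Lemma fundamental_lemma : ae0 O h.
Proof.
have cov k : {ae lebn R n, forall x, if unpickle k is Some q then
    inner_boxes O q -> obox (ratv R q.1) (ratv R q.2) x -> res O h x = 0 else True}.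
  case: (unpickle k) => [q|]; last by apply: aeW.
  have [qO|qO] := pselect (inner_boxes O q); last by apply: aeW.
  by apply: ae_sub (ae0_box qO) => x hx _.
have := ae_foralln cov; apply: ae_sub => x hx Ox.
have [q qO qx] : (\bigcup_(q in inner_boxes O) obox (ratv R q.1) (ratv R q.2)) x.
  by rewrite -open_bigcup_boxes.
by have := hx (pickle q); rewrite pickleK => /(_ qO qx); rewrite resE.
Qed.

End FundamentalLemma.

(** * Weak gradients *)

Section TestSupport.
Context (R : realType) (n : nat) (O : set 'rV[R]_n).
Implicit Types phi chi : 'rV[R]_n -> R.

Lemma test_continuous phi : test_fun O phi -> continuous phi.
Proof. by move=> [/(_ 0%N)[]]. Qed.

Lemma test_derivable phi (i : 'I_n) : test_fun O phi -> forall x, derivable phi x (unitv R i).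
Proof. by move=> [/(_ 1%N)[_ /(_ i)[]]]. Qed.

Lemma test_derive_continuous phi (i : 'I_n) : test_fun O phi -> continuous ('D_(unitv R i) phi).
Proof. by move=> [/(_ 1%N)[_ /(_ i)[_ []]]]. Qed.

Lemma test_out phi x : test_fun O phi -> ~ O x -> phi x = 0.
Proof.
move=> [_ [_ clO]] Ox; apply: contrapT => /eqP phix; apply: Ox; apply: clO.
exact: subset_closure.
Qed.

Lemma test_derive_out phi (i : 'I_n) x : test_fun O phi -> ~ O x -> 'D_(unitv R i) phi x = 0.
Proof.
move=> [_ [_ clO]] Ox.
have oK : open (~` closure [set x | phi x != 0]) by apply: closed_openC; exact: closed_closure.
have Kx : (~` closure [set x | phi x != 0]) x by move=> /clO.
have z : \forall y \near x, cst (0 : R) y = phi y.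
  apply: filterS (open_nbhs_nbhs (conj oK Kx)) => y Ky.
  apply/esym; apply: contrapT => /eqP phiy; apply: Ky; exact: subset_closure.
by have [_ ->] := near_eq_is_derive z (is_derive_cst (0 : R) x (unitv R i)).
Qed.

Lemma bounded_support (g : 'rV[R]_n -> R) (K : set 'rV[R]_n) : compact K -> continuous g ->
  (forall x, ~ K x -> g x = 0) -> exists B : R, 0 <= B /\ forall x, `|g x| <= B.
Proof.
move=> cK cg gK; have [[x0 Kx0]|K0] := pselect (K !=set0); last first.
  by exists 0; split=> // x; rewrite gK ?normr0 // => Kx; apply: K0; exists x.
have cng : {within K, continuous (fun x => `|g x|)}.
  apply: continuous_subspaceT => z.
  by apply: (@continuous_comp _ _ _ g (@Num.norm _ R)); [exact: cg|exact: norm_continuous].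
have [c _ hc] := EVT_max_rV (ex_intro _ x0 Kx0) cK cng.
exists `|g c|; split=> // x; have [Kx|Kx] := pselect (K x); first by rewrite hc // inE.
by rewrite gK // normr0.
Qed.

End TestSupport.

Section TestBounds.
Context (R : realType) (n : nat) (O : set 'rV[R]_n).
Implicit Types phi chi : 'rV[R]_n -> R.

Lemma test_bounded phi : test_fun O phi -> exists B : R, [/\ 0 <= B, forall x, `|phi x| <= B &
  forall (i : 'I_n) x, `|'D_(unitv R i) phi x| <= B].
Proof.
move=> tphi; have [_ [cK clO]] := tphi.
set K := closure [set x | phi x != 0] in cK clO.
(* [phi] is also a test function of its own closed support, so it and its derivatives vanish off the
   compact set [K]. *)
have tK : test_fun K phi by have [hC _] := tphi; split; [exact: hC|split].
have [B0 [B00 hB0]] := bounded_support cK (test_continuous tphi)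
  (fun x => test_out tK).
have /choice[B hB] : forall i : 'I_n, exists B : R, 0 <= B /\ forall x, `|'D_(unitv R i) phi x| <= B.
  move=> i; apply: (@bounded_support R n ('D_(unitv R i) phi) K cK).
    exact: (test_derive_continuous tphi).
  by move=> x; move=> Kx; exact: (test_derive_out i tK Kx).
exists (B0 + \sum_(i < n) B i); split.
- by rewrite addr_ge0 // sumr_ge0 // => i _; case: (hB i).
- by move=> x; rewrite (le_trans (hB0 x)) // lerDl sumr_ge0 // => i _; case: (hB i).
- move=> i x; have [_ /(_ x)h] := hB i; rewrite (le_trans h) //.
  by rewrite (bigD1 i) //= addrCA lerDl addr_ge0 // sumr_ge0 // => j _; case: (hB j).
Qed.

Lemma test_fun0 : test_fun O (fun=> 0).
Proof.
split=> [k|].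
  elim: k => [|k IH]; (split; first by move=> x; exact: (@cst_continuous _ R 0 x)) => // i.
  split=> [x|]; first exact: derivable_cst.
  by rewrite (_ : 'D_(unitv R i) (fun=> 0) = fun=> 0) //; apply/funext => x; exact: derive_cst.
rewrite (_ : [set x : 'rV[R]_n | (0 : R) != 0] = set0).
  by rewrite closure0; split; [exact: compact0|exact: sub0set].
by apply/seteqP; split=> x //=; rewrite eqxx.
Qed.

Lemma test_meas phi : test_fun O phi -> meas_rn phi.
Proof. by move=> t; apply/meas_rnP; apply: measurable_continuous; exact: (test_continuous t). Qed.

Lemma test_derive_meas phi (i : 'I_n) : test_fun O phi -> meas_rn ('D_(unitv R i) phi).
Proof. by move=> t; apply/meas_rnP; apply: measurable_continuous; exact: (test_derive_continuous t). Qed.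

End TestBounds.

Section Parts.
Context (R : realType) (n : nat) (p : R) (O : set 'rV[R]_n) (M : R).
Hypotheses (p1 : 1 < p) (oO : open O) (M0 : 0 <= M).
Hypothesis OM : O `<=` cbox (const_mx (- M)) (const_mx M).
Implicit Types phi chi : 'rV[R]_n -> R.

Lemma test_inLp phi : test_fun O phi -> inLp p O phi.
Proof.
move=> t; have [B [_ hB _]] := test_bounded t.
by apply: (inLp_bounded p1 oO M0 OM) (test_meas t) (fun x _ => hB x).
Qed.

Lemma test_derive_inLp phi (i : 'I_n) : test_fun O phi -> inLp p O ('D_(unitv R i) phi).
Proof.
move=> t; have [B [_ _ hB]] := test_bounded t.
by apply: (inLp_bounded p1 oO M0 OM) (test_derive_meas i t) (fun x _ => hB i x).
Qed.

Let integ_dominated (f : 'rV[R]_n -> R) (B : R) : meas_rn f -> (forall x, `|f x| <= B) ->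
  (forall x, ~ O x -> f x = 0) -> integ f /\ forall x, `|f x| <= B * \1_O x.
Proof.
move=> mf fB fO; have d x : `|f x| <= B * \1_O x.
  rewrite indicE; have [Ox|Ox] := pselect (O x); first by rewrite mem_set // mulr1.
  by rewrite memNset // mulr0 fO // normr0.
by split=> //; apply: (integ_le mf _ d); apply: integ_scale; exact: (integ_indic_domain oO M0 OM).
Qed.

Lemma meas_rnM f g : meas_rn f -> meas_rn g -> meas_rn (fun x : 'rV[R]_n => f x * g x).
Proof. by rewrite !meas_rnP; exact: measurable_funM. Qed.

Lemma meas_rnB f g : meas_rn f -> meas_rn g -> meas_rn (fun x : 'rV[R]_n => f x - g x).
Proof. by rewrite !meas_rnP; exact: measurable_funB. Qed.

Lemma meas_rn_shift f v : meas_rn f -> meas_rn (fun x : 'rV[R]_n => f (x + v)).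
Proof.
move=> /meas_rnP mf; apply/meas_rnP.
exact: (measurableT_comp mf (measurable_continuous_rV (@continuous_translate R n v))).
Qed.

Lemma pgrad_unitv phi x (i : 'I_n) (c : R) : pgrad phi x (c *: unitv R i) = c * 'D_(unitv R i) phi x.
Proof.
rewrite /pgrad (bigD1 i) //= big1 ?addr0 => [|j ji]; first by rewrite !mxE !eqxx mulr1.
by rewrite !mxE (negbTE ji) andbF mulr0 mul0r.
Qed.

(** Dominated convergence: [increment_le] bounds the difference quotients uniformly, and the factor
    [phi] confines everything to [O], which has finite measure. *)
Lemma quotient_cvg_sint phi chi (v : 'rV[R]_n) : test_fun O phi -> test_fun O chi ->
  integ (fun x => phi x * pgrad chi x v) /\
  (fun k : nat => sint (fun x => phi x * (k.+1%:R * (chi (x + k.+1%:R^-1 *: v) - chi x)))) @ \oo -->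
    sint (fun x => phi x * pgrad chi x v).
Proof.
move=> tphi tchi; have [B [B0 phiB _]] := test_bounded tphi.
have [C [C0 _ chiC]] := test_bounded tchi.
have mphi := test_meas tphi; have mchi := test_meas tchi.
have mp : meas_rn (fun x => phi x * pgrad chi x v).
  apply: meas_rnM => //; apply/meas_rnP; apply: measurable_sum => i.
  apply: measurable_funM; first exact: measurable_cst.
  by apply/meas_rnP; exact: (test_derive_meas i tchi).
pose D := n%:R * `|v| * C.
apply: (@sint_cvg R n _ _ (fun x => (B * D) * \1_O x)).
- move=> k; apply: meas_rnM => //; apply: (meas_rn_scale k.+1%:R).
  by apply: meas_rnB => //; exact: meas_rn_shift.
- exact: mp.
- by apply: integ_scale; exact: (integ_indic_domain oO M0 OM).
- move=> x; apply: cvgM; first exact: cvg_cst.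
  by apply: increment_cvg => i; [exact: test_derivable tchi|exact: test_derive_continuous tchi].
- move=> k x; have [Ox|Ox] := pselect (O x); last first.
    by rewrite (test_out tphi Ox) mul0r normr0 indicE memNset // mulr0.
  rewrite indicE mem_set // mulr1 normrM ler_pM // normrM ger0_norm //.
  have := increment_le (fun i x => @test_derivable _ _ _ _ i tchi x) chiC v k.+1%:R^-1 x.
  rewrite [X in _ <= X * _]ger0_norm // => h; rewrite -ler_pdivlMl ?ltr0n //.
Qed.

Lemma integration_by_parts phi chi (i : 'I_n) : test_fun O phi -> test_fun O chi ->
  sint (fun x => phi x * 'D_(unitv R i) chi x) = - sint (fun x => 'D_(unitv R i) phi x * chi x).
Proof.
move=> tphi tchi.
have [_ c1] := quotient_cvg_sint (unitv R i) tphi tchi.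
have [_ c2] := quotient_cvg_sint ((-1) *: unitv R i) tchi tphi.
have E1 : (fun x => phi x * pgrad chi x (unitv R i)) = (fun x => phi x * 'D_(unitv R i) chi x).
  by apply/funext => x; have := pgrad_unitv chi x i 1; rewrite scale1r mul1r => ->.
have E2 : (fun x => chi x * pgrad phi x ((-1) *: unitv R i)) = (fun x => (-1) * ('D_(unitv R i) phi x * chi x)).
  by apply/funext => x; rewrite pgrad_unitv; ring.
have [B [B0 phiB phiB']] := test_bounded tphi.
have [C [C0 chiC chiC']] := test_bounded tchi.
have i3 : integ (fun x => 'D_(unitv R i) phi x * chi x).
  apply: (integ_dominated (B := B * C) _ _ _).1.
  - by apply: meas_rnM; [exact: test_derive_meas tphi|exact: test_meas tchi].
  - by move=> x; rewrite normrM ler_pM.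
  - by move=> x Ox; rewrite (test_out tchi Ox) mulr0.
rewrite E1 in c1; rewrite E2 sint_scale // mulN1r in c2.
(* Summation by parts: translation moves the difference quotient in direction
   [e_i] from [chi] to the one of [phi] in direction [- e_i]. *)
suff E k : sint (fun x => phi x * (k.+1%:R * (chi (x + k.+1%:R^-1 *: unitv R i) - chi x))) =
    sint (fun x => chi x * (k.+1%:R * (phi (x + k.+1%:R^-1 *: (-1 *: unitv R i)) - phi x))).
  by rewrite (funext E) in c1; exact: (cvg_unique _ c1 c2).
set t := k.+1%:R^-1; set c := k.+1%:R.
have ipc w : integ (fun x => phi x * chi (x + w)).
  apply: (integ_dominated (B := B * C) _ _ _).1.
  - by apply: meas_rnM; [exact: test_meas tphi|apply: meas_rn_shift; exact: test_meas tchi].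
  - by move=> x; rewrite normrM ler_pM.
  - by move=> x Ox; rewrite (test_out tphi Ox) mul0r.
have icp w : integ (fun x => chi x * phi (x + w)).
  apply: (integ_dominated (B := C * B) _ _ _).1.
  - by apply: meas_rnM; [exact: test_meas tchi|apply: meas_rn_shift; exact: test_meas tphi].
  - by move=> x; rewrite normrM ler_pM.
  - by move=> x Ox; rewrite (test_out tchi Ox) mul0r.
have ipc0 : integ (fun x => phi x * chi x).
  by have := ipc 0; under eq_fun do rewrite addr0.
have icp0 : integ (fun x => chi x * phi x).
  by have := icp 0; under eq_fun do rewrite addr0.
have -> : (fun x => chi x * (c * (phi (x + t *: (-1 *: unitv R i)) - phi x))) =
   (fun x => c * (chi x * phi (x + t *: (-1 *: unitv R i)) - chi x * phi x)).
  by apply/funext => x; ring.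
have -> : (fun x => phi x * (c * (chi (x + t *: unitv R i) - chi x))) =
   (fun x => c * (phi x * chi (x + t *: unitv R i) - phi x * chi x)).
  by apply/funext => x; ring.
rewrite !sint_scale ?sint_sub //; try exact: integ_sub.
congr (_ * (_ - _)); last by congr sint; apply/funext => x; rewrite mulrC.
have [_ <-] := sint_shift (t *: unitv R i) (icp (t *: (-1 *: unitv R i))).
congr sint; apply/funext => x.
by rewrite -addrA -scalerDr scaleN1r subrr scaler0 addr0 mulrC.
Qed.

End Parts.

Section WeakGradient.
Context (R : realType) (n : nat) (p : R) (O : set 'rV[R]_n) (M : R).
Hypotheses (p1 : 1 < p) (oO : open O) (M0 : 0 <= M).
Hypothesis OM : O `<=` cbox (const_mx (- M)) (const_mx M).
Implicit Types (u v : 'rV[R]_n -> R) (g : 'I_n -> 'rV[R]_n -> R).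

Lemma integ_test u phi : inLp p O u -> test_fun O phi -> integ (fun x => u x * phi x).
Proof.
move=> Lu t; have [B [_ hB _]] := test_bounded t.
by apply: (inLp_integM p1 oO M0 OM Lu (test_meas t) hB) => x; exact: test_out.
Qed.

Lemma integ_test_derive u phi (i : 'I_n) : inLp p O u -> test_fun O phi ->
  integ (fun x => u x * 'D_(unitv R i) phi x).
Proof.
move=> Lu t; have [B [_ _ hB]] := test_bounded t.
by apply: (inLp_integM p1 oO M0 OM Lu (test_derive_meas i t) (hB i)) => x; exact: test_derive_out.
Qed.

(** Test functions and their derivatives are bounded and vanish off [O], so all products are
    integrable and the linear [sint] may replace [Rn_sint]. *)
Lemma weak_gradP u g : inLp p O u -> weak_grad p O u g <->
  (forall i, inLp p O (g i)) /\ forall phi i, test_fun O phi ->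
    sint (fun x => u x * 'D_(unitv R i) phi x) = - sint (fun x => g i x * phi x).
Proof.
move=> Lu; split=> [[Lg ug]|[Lg ug]]; split=> // phi.
  move=> i t; rewrite -!Rn_sintE; [exact: ug|exact: integ_test|exact: integ_test_derive].
move=> t i; rewrite !Rn_sintE; [exact: ug|exact: integ_test|exact: integ_test_derive].
Qed.

(** The difference of the two gradients integrates to 0 against every test function. *)
Lemma weak_grad_unique u g g' : inLp p O u -> weak_grad p O u g -> weak_grad p O u g' ->
  forall i, ae0 O (fun x => g i x - g' i x).
Proof.
move=> Lu /(weak_gradP _ Lu)[Lg ug] /(weak_gradP _ Lu)[Lg' ug'] i.
have Lh : inLp p O (fun x => g i x - g' i x).
  have [L _] := inLp_scale p1 oO (-1) (Lg' i).
  have [L' _] := inLp_add p1 oO (Lg i) L.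
  rewrite (_ : (fun x => _) = g i \+ (fun x => -1 * g' i x)) //.
  by apply/funext => x /=; rewrite mulN1r.
apply: (fundamental_lemma oO (inLp_integ p1 oO M0 OM Lh)) => phi t.
under eq_fun do rewrite mulrBl.
rewrite sint_sub; [|exact: integ_test..].
by apply/eqP; rewrite subr_eq0 -eqr_opp -ug // -ug'.
Qed.

Lemma weak_grad_lin c u v g g' : inLp p O u -> inLp p O v ->
  weak_grad p O u g -> weak_grad p O v g' ->
  weak_grad p O (fun x => c * u x + v x) (fun i x => c * g i x + g' i x).
Proof.
move=> Lu Lv /(weak_gradP _ Lu)[Lg ug] /(weak_gradP _ Lv)[Lg' ug'].
have Llin f h : inLp p O f -> inLp p O h -> inLp p O (fun x => c * f x + h x).
  by move=> Lf Lh; have [L _] := inLp_scale p1 oO c Lf; have [] := inLp_add p1 oO L Lh.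
apply/weak_gradP; first exact: Llin.
split=> [i|phi i t]; first exact: Llin.
under eq_fun do rewrite mulrDl -mulrA.
under [in RHS]eq_fun do rewrite mulrDl -mulrA.
have i1 := integ_test_derive i Lu t; have i2 := integ_test_derive i Lv t.
have i3 := integ_test (Lg i) t; have i4 := integ_test (Lg' i) t.
rewrite sint_add //; last exact: integ_scale.
rewrite sint_add //; last exact: integ_scale.
by rewrite !sint_scale // ug // ug' // opprD mulrN.
Qed.

Lemma weak_grad_test phi : test_fun O phi -> weak_grad p O phi (fun i => 'D_(unitv R i) phi).
Proof.
move=> t; apply/weak_gradP; first exact: (test_inLp p1 oO M0 OM).
split=> [i|chi i t']; first exact: (test_derive_inLp p1 oO M0 OM).
exact: (integration_by_parts oO M0 OM).
Qed.

Lemma weak_grad0 : weak_grad p O (fun=> 0) (fun _ _ => 0).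
Proof.
have [L0 _] := inLp0 p1 oO; apply/weak_gradP => //; split=> // phi i t.
rewrite (_ : (fun x => _) = fun=> 0); last by apply/funext => x; rewrite mul0r.
by rewrite (_ : (fun x => 0 * phi x) = fun=> 0) ?sint0 ?oppr0 //; apply/funext => x; rewrite mul0r.
Qed.

Lemma weak_grad_ae0 u : inLp p O u -> ae0 O u -> weak_grad p O u (fun _ _ => 0).
Proof.
move=> Lu u0; have [L0 _] := inLp0 p1 oO; apply/weak_gradP => //; split=> // phi i t.
have -> : sint (fun x => u x * 'D_(unitv R i) phi x) = 0.
  rewrite /sint (ae_eq_integral (cst 0%E)) ?integral0 //.
    by have /integrableP[] := integ_test_derive i Lu t.
  apply: ae_sub u0 => x ux _; have [Ox|Ox] := pselect (O x); first by rewrite ux // mul0r.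
  by rewrite (test_derive_out i t Ox) mulr0.
by rewrite (_ : (fun x => 0 * phi x) = fun=> 0) ?sint0 ?oppr0 //; apply/funext => x; rewrite mul0r.
Qed.

Lemma W1p_inLp u : W1p p O u -> inLp p O u.
Proof. by move=> [mu [Lu _]]. Qed.

Lemma wgradP u : W1p p O u -> weak_grad p O u (wgrad p O u).
Proof. by move=> [_ [_ h]]; exact: ClassicalEpsilon.epsilon_spec. Qed.

Lemma weak_grad_W1p u g : inLp p O u -> weak_grad p O u g -> W1p p O u.
Proof. by move=> [mu Lu] ug; split=> //; split=> //; exists g. Qed.

(** [wgrad] is an unspecified choice; explicit computations with it go through this comparison with
    a known weak gradient. *)
Lemma wgrad_ae u g : inLp p O u -> weak_grad p O u g ->
  forall i, ae0 O (fun x => wgrad p O u i x - g i x).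
Proof. by move=> Lu ug; apply: (weak_grad_unique Lu _ ug); apply: wgradP; exact: weak_grad_W1p ug. Qed.

Lemma wgrad_inLp u i : W1p p O u -> inLp p O (wgrad p O u i).
Proof. by move=> hu; have [+ _] := wgradP hu; apply. Qed.

End WeakGradient.

(** * A Poincaré inequality and nondegeneracy *)

Lemma ge0_powR_le (R : realType) (p a b : R) : 0 < p -> 0 <= a -> a <= b -> a `^ p <= b `^ p.
Proof.
by move=> p0 a0 ab; apply: ge0_ler_powR; rewrite ?nnegrE ?(ltW p0) ?(le_trans a0 ab).
Qed.

Lemma powR_invKn (R : realType) (p a : R) : 0 < p -> 0 <= a -> (a `^ p^-1) `^ p = a.
Proof. by move=> p0 a0; rewrite -powRrM mulVf ?gt_eqF // powRr1. Qed.

Lemma cvg_powR (R : realType) (p l : R) (u : nat -> R) : 0 < p -> (forall k, 0 <= u k) ->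
  u @ \oo --> l -> (fun k => u k `^ p) @ \oo --> l `^ p.
Proof.
move=> p0 u0 ul.
have l0 : 0 <= l by apply: (ler_cvg_to (cvg_cst (0 : R)) ul); apply: nearW.
move: l0; rewrite le_eqVlt => /predU1P[l0|l0]; last first.
  have [/derivable1_diffP/differentiable_continuous c _] := is_derive1_powR p l0.
  exact: (cvg_comp _ _ ul c).
rewrite -l0 powR0 ?gt_eqF // in ul *; apply/cvgrPdist_lt => e e0.
have e'0 : 0 < e `^ p^-1 by exact: powR_gt0.
move/cvgrPdist_lt: ul => /(_ _ e'0) h; near=> k.
have : `|0 - u k| < e `^ p^-1 by near: k; exact: h.
rewrite !sub0r !normrN !ger0_norm ?powR_ge0 // => uk.
have : u k `^ p < (e `^ p^-1) `^ p by apply: gt0_ltr_powR; [exact: p0|rewrite nnegrE; exact: u0|rewrite nnegrE; exact: ltW|exact: uk].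
by rewrite -powRrM mulVf ?gt_eqF // powRr1 //; exact: ltW.
Unshelve. all: by end_near. Qed.

Section Shift.
Context (R : realType) (n : nat) (p : R) (p1 : 1 < p).
Implicit Types f : 'rV[R]_n -> R.

Let p0 : 0 < p. Proof. exact: lt_trans p1. Qed.

Lemma res_setT f : res setT f = f.
Proof. by apply/funext => x; rewrite resE. Qed.

Lemma Lp_intT f : meas_rn f -> Lp_int p setT f = (\int[lebn R n]_x (`|f x| `^ p)%:E)%E.
Proof. by move=> mf; rewrite (Lp_intE p1 openT mf) res_setT. Qed.

(** Translations do not preserve [O], so the Poincaré argument takes norms over the whole space; for
    functions vanishing off [O] these are the same. *)
Lemma Lp_int_suppE (O : set 'rV[R]_n) f : open O -> meas_rn f -> (forall x, ~ O x -> f x = 0) ->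
  Lp_int p O f = Lp_int p setT f.
Proof.
move=> oO mf f0; rewrite Lp_intT // (Lp_intE p1 oO mf).
suff -> : res O f = f by [].
by apply/funext => x; have [Ox|Ox] := pselect (O x); [rewrite resE|rewrite res_out // f0].
Qed.

Lemma inLpT_shift f v : inLp p setT f ->
  inLp p setT (fun x => f (x + v)) /\ Lp_norm p setT (fun x => f (x + v)) = Lp_norm p setT f.
Proof.
move=> [mf foo]; have mfv := meas_rn_shift v mf.
have E : Lp_int p setT (fun x => f (x + v)) = Lp_int p setT f.
  rewrite (Lp_intT mfv) (Lp_intT mf).
  apply: (@lebn_shift R n v (fun x => (`|f x| `^ p)%:E)).
  - by apply/measurable_EFinP/measurable_powR_norm; exact/meas_rnP.
  - by move=> x; rewrite lee_fin powR_ge0.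
by split; [split=> //; rewrite E|rewrite /Lp_norm E].
Qed.

Lemma Lp_int_le_of_norm f g : inLp p setT f -> inLp p setT g ->
  Lp_norm p setT f <= Lp_norm p setT g ->
  fine (@Lp_int R n p setT f) <= fine (@Lp_int R n p setT g).
Proof.
move=> [mf _] [mg _]; rewrite /Lp_norm => h.
have f0 := fine_ge0 (Lp_int_ge0 p1 openT mf).
have g0 := fine_ge0 (Lp_int_ge0 p1 openT mg).
by rewrite -(powR_invKn p0 f0) -(powR_invKn p0 g0); apply: (ge0_powR_le p0 _ h); exact: powR_ge0.
Qed.

End Shift.

Section Poincare.
Context (R : realType) (n : nat) (p : R) (O : set 'rV[R]_n) (M : R).
Hypotheses (p1 : 1 < p) (oO : open O) (M0 : 0 <= M).
Hypothesis OM : O `<=` cbox (const_mx (- M)) (const_mx M).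

Let p0 : 0 < p. Proof. exact: lt_trans p1. Qed.

Let integ_box (r : R) : 0 <= r ->
  integ (\1_(cbox (const_mx (- r)) (const_mx r)) : 'rV[R]_n -> R).
Proof.
move=> r0; apply/integrableP; split.
  by apply/measurable_EFinP/measurable_indicP; exact: measurable_cbox.
under eq_integral => x _ do rewrite /= ger0_norm //.
rewrite integral_indic //; last exact: measurable_cbox.
by rewrite setIT lebn_cbox // ltry.
Qed.

Let test_inLpT phi : test_fun O phi -> inLp p setT phi.
Proof.
move=> t; have [m fin] := test_inLp p1 oO M0 OM t; split=> //.
rewrite -(Lp_int_suppE p1 oO m) //; exact: (fun x => test_out t).
Qed.

Let diffq (phi : 'rV[R]_n -> R) eta (k : nat) x := k.+1%:R * (phi (x + k.+1%:R^-1 *: eta) - phi x).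

(* As [phi] and its translate by [eta] have disjoint supports,
   [`|phi x| <= `|phi (x + eta) - phi x|]; the increment telescopes into [k.+1]
   translates of a single difference, all of the same norm. *)
Lemma norm_le_diffq phi (eta : 'rV[R]_n) k : test_fun O phi -> (forall x, O x -> ~ O (x + eta)) ->
  inLp p setT (diffq phi eta k) /\ Lp_norm p setT phi <= Lp_norm p setT (diffq phi eta k).
Proof.
move=> t off; have Lphi := test_inLpT t.
set h := k.+1%:R^-1 *: eta.
pose d x := phi (x + h) - phi x.
have Ld : inLp p setT d.
  have [L1 _] := inLpT_shift p1 h Lphi.
  have [L2 _] := inLp_scale p1 openT (-1) Lphi.
  have [L3 _] := inLp_add p1 openT L1 L2.
  by rewrite (_ : d = (fun x => phi (x + h)) \+ (fun x => -1 * phi x)) //; apply/funext => x /=; rewrite mulN1r.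
have [LD ED] := inLp_scale p1 openT k.+1%:R Ld; split; first exact: LD.
rewrite [leRHS]ED ger0_norm //.
have [Ls les] := @inLp_sum R n p setT p1 openT _ (index_iota 0 k.+1) (fun j x => d (x + h *+ j))
  (fun j => (inLpT_shift p1 (h *+ j) Ld).1).
have tele x : \sum_(j <- index_iota 0 k.+1) d (x + h *+ j) = phi (x + eta) - phi x.
  have := telescope_sumr (fun j => phi (x + h *+ j)) (leq0n k.+1).
  rewrite mulr0n addr0 -[h *+ k.+1]scaler_nat /h scalerA divff ?pnatr_eq0 // scale1r => <-.
  by apply: eq_bigr => j _; rewrite /d -addrA -mulrSr.
have le1 x : setT x -> `|phi x| <= `|\sum_(j <- index_iota 0 k.+1) d (x + h *+ j)|.
  move=> _; rewrite tele; have [Ox|Ox] := pselect (O x).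
    by rewrite (test_out t (off x Ox)) sub0r normrN.
  by rewrite (test_out t Ox) normr0.
have [_ le2] := inLp_le p1 openT Lphi.1 Ls le1.
apply: (le_trans le2); apply: (le_trans les).
under eq_bigr do rewrite (inLpT_shift p1 _ Ld).2.
by rewrite big_const_nat subn0 iter_addr_0 mulr_natl.
Qed.

Lemma pgrad_out phi x eta : test_fun O phi -> ~ O x -> pgrad phi x eta = 0.
Proof. by move=> t Ox; rewrite /pgrad big1 // => i _; rewrite (test_derive_out i t Ox) mulr0. Qed.

Lemma pgrad_meas phi eta : test_fun O phi -> meas_rn (fun x => pgrad phi x eta).
Proof.
move=> t; apply/meas_rnP; apply: measurable_sum => i.
apply: measurable_funM; first exact: measurable_cst.
by apply/meas_rnP; exact: (test_derive_meas i t).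
Qed.

(** Let [k] tend to infinity in [norm_le_diffq]: the difference quotients converge pointwise to the
    directional derivative, and dominated convergence carries this over to the norms. *)
Lemma test_poincare phi (eta : 'rV[R]_n) : test_fun O phi -> (forall x, O x -> ~ O (x + eta)) ->
  Lp_norm p O phi <= Lp_norm p O (fun x => pgrad phi x eta).
Proof.
move=> t off; have [B [B0 phiB dB]] := test_bounded t.
have Lphi := test_inLpT t; have mp := pgrad_meas eta t.
pose D := n%:R * `|eta| * B; have D0 : 0 <= D by rewrite !mulr_ge0.
(* The cube of half-side [r] contains [O] and its translates by [- eta / k.+1], so every quotient is
   at most [D] on it and 0 elsewhere. *)
pose r := M + `|eta|; have r0 : 0 <= r by rewrite addr_ge0.
have dq k x : `|diffq phi eta k x| <= D * \1_(cbox (const_mx (- r)) (const_mx r)) x.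
  have [Bx|Bx] := pselect (cbox (const_mx (- r)) (const_mx r) x).
    rewrite indicE mem_set // mulr1 normrM ger0_norm //.
    have := increment_le (fun i x => @test_derivable _ _ _ _ i t x) dB eta k.+1%:R^-1 x.
    by rewrite [X in _ <= X * _]ger0_norm // => h; rewrite -ler_pdivlMl ?ltr0n.
  rewrite indicE memNset // mulr0 normr_le0 /diffq !(test_out t) ?subrr ?mulr0 //.
    move=> /OM h; apply: Bx => i; have := h i; rewrite !mxE => /andP[h1 h2].
    by apply/andP; rewrite /r; split; have := normr_ge0 eta; lra.
  move=> /OM h; apply: Bx => i; have := h i; rewrite !mxE => /andP[h1 h2].
  have : `|k.+1%:R^-1 * eta ord0 i| <= `|eta|.
    rewrite normrM (@le_trans _ _ `|eta ord0 i|) ?norm_coord_le //.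
    by rewrite ler_piMl // ger0_norm // invf_le1 ?ltr0n // ler1n.
  rewrite ler_norml => /andP[h3 h4]; apply/andP; rewrite /r; move: h1 h2 h3 h4.
  by move: (k.+1%:R^-1 * _) => c; split; lra.
have [||||| ip cv] := @sint_cvg R n (fun k x => `|diffq phi eta k x| `^ p)
  (fun x => `|pgrad phi x eta| `^ p)
  (fun x => D `^ p * \1_(cbox (const_mx (- r)) (const_mx r)) x).
- move=> k; apply/meas_rnP; apply: measurable_powR_norm; apply/meas_rnP.
  by have [[]] := norm_le_diffq k t off.
- by apply/meas_rnP; apply: measurable_powR_norm; exact/meas_rnP.
- by apply: integ_scale; exact: integ_box.
- move=> x; apply: cvg_powR => //; apply: cvg_norm.
  by apply: increment_cvg => i; [exact: test_derivable t|exact: test_derive_continuous t].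
- move=> k x; rewrite ger0_norm ?powR_ge0 //.
  have := dq k x; rewrite indicE; case: (_ \in _); rewrite ?mulr1 ?mulr0 /= ?mulr1 => h.
    by apply: ge0_ler_powR; rewrite ?nnegrE // ltW.
  by move: h; rewrite normr_le0 => /eqP ->; rewrite normr0 powR0 // gt_eqF.
have E1 (f : 'rV[R]_n -> R) : meas_rn f -> fine (Lp_int p setT f) = sint (fun x => `|f x| `^ p).
  by move=> mf; rewrite Lp_intT.
have le : fine (Lp_int p setT phi) <= fine (Lp_int p setT (fun x => pgrad phi x eta)).
  rewrite (E1 _ mp); apply: (ler_cvg_to (cvg_cst _) cv); apply: nearW => k.
  have [Lk lek] := norm_le_diffq k t off.
  rewrite -(E1 (diffq phi eta k)); last by case: Lk.
  exact: (Lp_int_le_of_norm p1).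
rewrite /Lp_norm (Lp_int_suppE p1 oO Lphi.1 (fun x => test_out t)).
rewrite (Lp_int_suppE p1 oO mp (fun x => pgrad_out eta t)).
apply: (ge0_powR_le _ _ le); first by rewrite invr_gt0.
exact: fine_ge0 (Lp_int_ge0 p1 openT Lphi.1).
Qed.

End Poincare.

Lemma enorm_ge0 (R : realType) n (x : 'rV[R]_n) : 0 <= enorm x.
Proof. exact: sqrtr_ge0. Qed.

Lemma norm_coord_le_enorm (R : realType) n (x : 'rV[R]_n) i : `|x ord0 i| <= enorm x.
Proof.
rewrite -sqrtr_sqr /enorm ler_wsqrtr // (bigD1 i) //= lerDl.
by apply: sumr_ge0 => j _; exact: sqr_ge0.
Qed.

Lemma enorm_le_sum (R : realType) n (x : 'rV[R]_n) : enorm x <= \sum_(i < n) `|x ord0 i|.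
Proof.
have s0 : 0 <= \sum_(i < n) `|x ord0 i| by exact: sumr_ge0.
rewrite -[leRHS]ger0_norm // -sqrtr_sqr ler_wsqrtr // expr2 mulr_sumr.
apply: ler_sum => i _; rewrite -real_normK ?num_real //.
by rewrite expr2 ler_wpM2r // (bigD1 i) //= lerDl; exact: sumr_ge0.
Qed.

Section AeZero.
Context (R : realType) (n : nat) (O : set 'rV[R]_n).
Implicit Types f g : 'rV[R]_n -> R.

Lemma ae0_lin c f g : ae0 O f -> ae0 O g -> ae0 O (fun x => c * f x + g x).
Proof.
move=> hf hg; apply: ae_sub (ae_and hf hg) => x [fx gx] Ox.
by rewrite fx // gx // mulr0 addr0.
Qed.

Lemma ae0_0 : ae0 O (fun=> 0).
Proof. by apply: aeW => x _. Qed.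

Lemma ae0_sum (I : Type) (s : seq I) (c : I -> R) (f : I -> 'rV[R]_n -> R) :
  (forall i, ae0 O (f i)) -> ae0 O (fun x => \sum_(i <- s) c i * f i x).
Proof.
move=> hf; elim: s => [|i s IH].
  by rewrite (_ : (fun x => _) = fun=> 0); [exact: ae0_0|apply/funext => x; rewrite big_nil].
rewrite (_ : (fun x => _) = fun x => c i * f i x + \sum_(j <- s) c j * f j x).
  exact: ae0_lin.
by apply/funext => x; rewrite big_cons.
Qed.

Lemma ae0_eq f g : ae0 O f -> f =1 g -> ae0 O g.
Proof. by move=> hf /funext <-. Qed.

End AeZero.

Section Nondegeneracy.
Context (R : realType) (n : nat) (p : R) (O : set 'rV[R]_n) (M : R).
Hypotheses (p1 : 1 < p) (oO : open O) (M0 : 0 <= M).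
Hypothesis OM : O `<=` cbox (const_mx (- M)) (const_mx M).
Implicit Types (u v : 'rV[R]_n -> R) (g : 'I_n -> 'rV[R]_n -> R).

Lemma inLp_enorm g : (forall i, inLp p O (g i)) ->
  [/\ inLp p O (fun x => enorm (\row_(i < n) g i x)),
      forall i, Lp_norm p O (g i) <= Lp_norm p O (fun x => enorm (\row_(i < n) g i x)) &
      Lp_norm p O (fun x => enorm (\row_(i < n) g i x)) <= \sum_(i < n) Lp_norm p O (g i)].
Proof.
move=> Lg.
have m : meas_rn (fun x => enorm (\row_(i < n) g i x)).
  have /(_ measurableT) ms := measurable_sum (D := setT : set (borelT R n)) (index_enum 'I_n)
     (h := fun i x => g i x ^+ 2) (fun i => measurable_funX 2 ((meas_rnP _).1 (Lg i).1)).
  apply/meas_rnP.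
  have msq : measurable_fun setT (@Num.sqrt R).
    by apply: continuous_measurable_fun; exact: sqrt_continuous.
  rewrite (_ : (fun x => _) = (@Num.sqrt R) \o (fun x : borelT R n => \sum_(i < n) g i x ^+ 2)).
    by apply: (measurableT_comp msq) => _ Y mY; exact: ms.
  by apply/funext => x; rewrite /enorm /=; congr Num.sqrt; apply: eq_bigr => i _; rewrite mxE.
have Labs i : inLp p O (fun x => `|g i x|) /\ Lp_norm p O (fun x => `|g i x|) <= Lp_norm p O (g i).
  apply: (inLp_le p1 oO) => [|//|x _]; last by rewrite normr_id.
  by apply/meas_rnP; apply: (measurableT_comp (@normr_measurable R setT)); apply/meas_rnP; exact: (Lg i).1.
have [Ls les] := inLp_sum p1 oO (index_enum 'I_n) (fun i => (Labs i).1).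
have [|Le lee] := inLp_le p1 oO m Ls.
  move=> x _; rewrite !ger0_norm ?enorm_ge0 //; last exact: sumr_ge0.
  by rewrite (le_trans (enorm_le_sum _)) //; apply: ler_sum => i _; rewrite mxE.
split; first exact: Le.
  move=> i; apply: (inLp_le p1 oO (Lg i).1 Le _).2 => x _.
  by rewrite (@ger0_norm _ (enorm _)) ?enorm_ge0 //; have := norm_coord_le_enorm (\row_i g i x) i; rewrite mxE.
apply: (le_trans lee); apply: (le_trans les); apply: ler_sum => i _; exact: (Labs i).2.
Qed.

(** Passes from the Euclidean norm of the gradient to its components, which can be compared one at a
    time up to null sets. *)
Lemma W_norm_bounds u : W1p p O u ->
  [/\ Lp_norm p O u <= W_norm p O u,
      forall i, Lp_norm p O (wgrad p O u i) <= W_norm p O u &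
      W_norm p O u <= Lp_norm p O u + \sum_(i < n) Lp_norm p O (wgrad p O u i)].
Proof.
move=> Wu; have [_ h1 h2] := inLp_enorm (fun i => wgrad_inLp i Wu).
split; first by rewrite lerDl powR_ge0.
  by move=> i; rewrite (le_trans (h1 i)) // lerDr powR_ge0.
by rewrite lerD2l.
Qed.

Lemma W_norm_ge0 u : 0 <= W_norm p O u.
Proof. by rewrite addr_ge0 // powR_ge0. Qed.

Lemma dir_grad_ae u g xi : inLp p O u -> weak_grad p O u g ->
  ae0 O (fun x => dir_grad p O u xi x - \sum_(i < n) xi ord0 i * g i x).
Proof.
move=> Lu ug; apply: ae0_eq (ae0_sum (index_enum 'I_n) (fun i => xi ord0 i) (wgrad_ae p1 oO M0 OM Lu ug)) _.
by move=> x; rewrite /dir_grad -sumrB; apply: eq_bigr => i _; rewrite mulrBr.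
Qed.

Lemma inLp_lincomb (I : Type) (s : seq I) (c : I -> R) (f : I -> 'rV[R]_n -> R) :
  (forall i, inLp p O (f i)) ->
  inLp p O (fun x => \sum_(i <- s) c i * f i x) /\
  Lp_norm p O (fun x => \sum_(i <- s) c i * f i x) <= \sum_(i <- s) `|c i| * Lp_norm p O (f i).
Proof.
move=> Lf; have [L le] := inLp_sum p1 oO s (fun i => (inLp_scale p1 oO (c i) (Lf i)).1).
split=> //; apply: (le_trans le); apply: ler_sum => i _.
by rewrite (inLp_scale p1 oO (c i) (Lf i)).2.
Qed.

Lemma inLp_dir_grad u xi : W1p p O u -> inLp p O (dir_grad p O u xi).
Proof. by move=> Wu; apply: (inLp_lincomb _ _ _).1 => i; exact: wgrad_inLp. Qed.

(** Write [u = (u - phi) + phi]. The Poincaré inequality bounds [phi] by [D_eta phi], and as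
    [D_eta u = 0] this is [- D_eta (u - phi)], controlled by the [W_norm] of the difference. *)
Let test_approx u phi (eta : 'rV[R]_n) : W1p p O u -> test_fun O phi ->
  (forall x, O x -> ~ O (x + eta)) -> ae0 O (dir_grad p O u eta) ->
  Lp_norm p O u <= (1 + \sum_(i < n) `|eta ord0 i|) * W_norm p O (u \- phi).
Proof.
move=> Wu t off u0; set v := u \- phi; set dphi := fun i => 'D_(unitv R i) phi.
have Lu := W1p_inLp Wu; have ug := wgradP Wu.
have Lphi := test_inLp p1 oO M0 OM t.
have vg : weak_grad p O v (fun i x => -1 * dphi i x + wgrad p O u i x).
  have := weak_grad_lin p1 oO M0 OM (-1) Lphi Lu (weak_grad_test p1 oO M0 OM t) ug.
  by rewrite (_ : (fun x => -1 * phi x + u x) = v) //; apply/funext => x; rewrite /v /= mulN1r addrC.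
have Lv : inLp p O v.
  have := (inLp_add p1 oO Lu (inLp_scale p1 oO (-1) Lphi).1).1.
  by rewrite (_ : u \+ _ = v) //; apply/funext => x; rewrite /v /= mulN1r.
have Wv := weak_grad_W1p Lv vg; have [v1 v2 _] := W_norm_bounds Wv.
have uE : u = v \+ phi by apply/funext => x; rewrite /v /= subrK.
have [_] := inLp_add p1 oO Lv Lphi; rewrite -uE => h; apply: (le_trans h).
rewrite mulrDl mul1r; apply: (lerD v1); apply: (le_trans (test_poincare p1 oO M0 OM t off)).
have vd := dir_grad_ae eta Lv vg.
have [Ls les] := inLp_lincomb (index_enum 'I_n) (fun i => - eta ord0 i) (fun i => wgrad_inLp i Wv).
have [|_ ->] := Lp_norm_ae p1 oO (pgrad_meas eta t) Ls.
  apply: ae0_eq (ae0_lin 1 u0 vd) _ => x.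
  have -> : \sum_(i < n) - eta ord0 i * wgrad p O v i x = - dir_grad p O v eta x.
    by rewrite /dir_grad -sumrN; apply: eq_bigr => i _; rewrite mulNr.
  have -> : \sum_(i < n) eta ord0 i * (-1 * dphi i x + wgrad p O u i x) =
     dir_grad p O u eta x - pgrad phi x eta.
    by rewrite /dir_grad /pgrad -sumrB; apply: eq_bigr => i _; rewrite mulrDr mulN1r mulrN addrC.
  by move: (dir_grad p O u eta x) (dir_grad p O v eta x) (pgrad phi x eta) => a b c; ring.
apply: (le_trans les); rewrite mulr_suml; apply: ler_sum => i _.
by rewrite normrN; exact: (ler_wpM2l (normr_ge0 _) (v2 i)).
Qed.

Lemma W0_dir_grad_eq0 u (xi : 'rV[R]_n) i : W0 p O u -> xi ord0 i != 0 ->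
  Lp_norm p O (dir_grad p O u xi) = 0 -> ae0 O u.
Proof.
move=> [Wu [phi [tphi cphi]]] xi0 N0.
have Lu := W1p_inLp Wu.
(* Scaled so that the [i]-th coordinate moves by [2 * M + 1], more than the width [2 * M] of the
   cube containing [O]. *)
pose L := (2 * M + 1) / xi ord0 i; pose eta := L *: xi.
have etai : eta ord0 i = 2 * M + 1 by rewrite mxE /L divfK.
have off x : O x -> ~ O (x + eta).
  move=> /OM/(_ i) h /OM/(_ i); move: h; rewrite [X in _ -> X]/=.
  rewrite !(mxE, etai) => /andP[h1 h2]; have := etai; rewrite mxE => -> /andP[h3 h4]; lra.
have ueta : ae0 O (dir_grad p O u eta).
  have /(Lp_norm_eq0 p1 oO (inLp_dir_grad xi Wu)) h := N0.
  apply: ae0_eq (ae0_lin L h (@ae0_0 R n O)) _ => x.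
  by rewrite addr0 /dir_grad mulr_sumr; apply: eq_bigr => j _; rewrite mxE mulrA.
apply/(Lp_norm_eq0 p1 oO Lu)/eqP; rewrite eq_le Lp_norm_ge0 andbT.
have C0 : (fun k => (1 + \sum_(i < n) `|eta ord0 i|) * W_norm p O (u \- phi k)) @ \oo -->
    (1 + \sum_(i < n) `|eta ord0 i|) * 0.
  by apply: cvgM; [exact: cvg_cst|exact: cphi].
rewrite mulr0 in C0; apply: (ler_cvg_to (cvg_cst (Lp_norm p O u)) C0); apply: nearW => k.
exact: test_approx.
Qed.

End Nondegeneracy.

(** * Linear structure of the Sobolev space and independence of the basis *)

Lemma Ck_lin (R : realType) n k c (f g : 'rV[R]_n -> R) : Ck k f -> Ck k g ->
  Ck k (fun x => c * f x + g x).
Proof.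
elim: k f g => [|k IH] f g [cf hf] [cg hg]; (split; first by move=> x;
  apply: (@continuousD R R _ (fun x => c * f x) g x);
    [exact: (@continuousM R _ (fun=> c) f x (@cst_continuous _ R c x) (cf x))|exact: cg]) => //.
move=> i; have [df cdf] := hf i; have [dg cdg] := hg i.
have dcf x : derivable (fun x => c * f x) x (unitv R i).
  exact: (@derivableZ _ _ _ f c x (unitv R i) (df x)).
split=> [x|]; first exact: (@derivableD _ _ _ (fun x => c * f x) g x (unitv R i) (dcf x) (dg x)).
rewrite (_ : 'D_(unitv R i) _ = fun x => c * 'D_(unitv R i) f x + 'D_(unitv R i) g x).
  exact: IH.
apply/funext => x.
rewrite (@deriveD _ _ _ (fun x => c * f x) g x (unitv R i) (dcf x) (dg x)).
by rewrite (@deriveZ _ _ _ f c x (unitv R i) (df x)).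
Qed.

Lemma test_fun_lin (R : realType) n (O : set 'rV[R]_n) c (f g : 'rV[R]_n -> R) :
  test_fun O f -> test_fun O g -> test_fun O (fun x => c * f x + g x).
Proof.
move=> [Cf [cf fO]] [Cg [cg gO]].
have sub : closure [set x | c * f x + g x != 0] `<=`
    closure [set x | f x != 0] `|` closure [set x | g x != 0].
  rewrite -closureU; apply: closure_subset => x /=.
  by have [->|] := eqVneq (f x) 0; [rewrite mulr0 add0r; right|left].
split; first by move=> k; exact: Ck_lin.
split; last by move=> x /sub[/fO|/gO].
apply: (subclosed_compact _ _ sub); first exact: closed_closure.
exact: compactU.
Qed.

Section Combinations.
Context (R : realType) (n : nat) (p : R) (O : set 'rV[R]_n) (M : R).
Hypotheses (p1 : 1 < p) (oO : open O) (M0 : 0 <= M).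
Hypothesis OM : O `<=` cbox (const_mx (- M)) (const_mx M).
Implicit Types (u v : 'rV[R]_n -> R) (g : 'I_n -> 'rV[R]_n -> R).

Lemma inLp_lin c u v : inLp p O u -> inLp p O v ->
  inLp p O (fun x => c * u x + v x) /\
  Lp_norm p O (fun x => c * u x + v x) <= `|c| * Lp_norm p O u + Lp_norm p O v.
Proof.
move=> Lu Lv; have [L E] := inLp_scale p1 oO c Lu.
by have := inLp_add p1 oO L Lv; rewrite E.
Qed.

Lemma W1p_lin c u v : W1p p O u -> W1p p O v -> W1p p O (fun x => c * u x + v x).
Proof.
move=> Wu Wv; have Lu := W1p_inLp Wu; have Lv := W1p_inLp Wv.
apply: (weak_grad_W1p (inLp_lin c Lu Lv).1).
exact: (weak_grad_lin p1 oO M0 OM c Lu Lv (wgradP Wu) (wgradP Wv)).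
Qed.

(** A null function has the zero weak gradient, so the chosen gradient is null as well. *)
Lemma W_norm_ae0 u : inLp p O u -> ae0 O u -> W_norm p O u = 0.
Proof.
move=> Lu u0; have ug := weak_grad_ae0 p1 oO M0 OM Lu u0.
have Wu := weak_grad_W1p Lu ug.
have [_ _ le] := W_norm_bounds p1 oO Wu.
apply/eqP; rewrite eq_le W_norm_ge0 andbT (le_trans le) //.
rewrite ((Lp_norm_eq0 p1 oO Lu).2 u0) add0r big1 // => i _.
apply/(Lp_norm_eq0 p1 oO (wgrad_inLp i Wu)).
by apply: ae0_eq (wgrad_ae p1 oO M0 OM Lu ug i) _ => x; rewrite subr0.
Qed.

(* [W_norm] is itself subadditive; the constant only saves comparing it with
   the chosen representatives of the weak gradients. *)
Lemma W_norm_lin c u v : W1p p O u -> W1p p O v ->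
  W_norm p O (fun x => c * u x + v x) <= (n.+1)%:R * (`|c| * W_norm p O u + W_norm p O v).
Proof.
move=> Wu Wv; have Lu := W1p_inLp Wu; have Lv := W1p_inLp Wv.
have [Ll lel] := inLp_lin c Lu Lv.
have lg := weak_grad_lin p1 oO M0 OM c Lu Lv (wgradP Wu) (wgradP Wv).
have Wl := W1p_lin c Wu Wv.
have [_ _ le] := W_norm_bounds p1 oO Wl.
have [u1 u2 _] := W_norm_bounds p1 oO Wu.
have [v1 v2 _] := W_norm_bounds p1 oO Wv.
apply: (le_trans le); rewrite -natr1 mulrDl mul1r addrC; apply: lerD; last first.
  by apply: (le_trans lel); apply: (lerD _ v1); exact: (ler_wpM2l (normr_ge0 c) u1).
rewrite -[X in X%:R](card_ord n) mulr_natl -sumr_const; apply: ler_sum => i _.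
have [Li lei] := inLp_lin c (wgrad_inLp i Wu) (wgrad_inLp i Wv).
have [_ ->] := Lp_norm_ae p1 oO (wgrad_inLp i Wl).1 Li (wgrad_ae p1 oO M0 OM Ll lg i).
by apply: (le_trans lei); apply: (lerD _ (v2 i)); exact: (ler_wpM2l (normr_ge0 c) (u2 i)).
Qed.

(** The approximating test functions combine linearly; the constant in [W_norm_lin] does not affect
    convergence to 0. *)
Lemma W0_lin c u v : W0 p O u -> W0 p O v -> W0 p O (fun x => c * u x + v x).
Proof.
move=> [Wu [phi [tphi cphi]]] [Wv [psi [tpsi cpsi]]].
split; first exact: W1p_lin.
exists (fun k x => c * phi k x + psi k x); split=> [k|]; first exact: test_fun_lin.
have Wt chi : test_fun O chi -> W1p p O chi.
  move=> t; apply: (weak_grad_W1p (test_inLp p1 oO M0 OM t)).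
  exact: (weak_grad_test p1 oO M0 OM t).
have Wsub a chi : W1p p O a -> test_fun O chi -> W1p p O (a \- chi).
  move=> Wa /Wt Wchi; have := W1p_lin (-1) Wchi Wa.
  by rewrite (_ : (fun x => _) = a \- chi) //; apply/funext => x; rewrite /= mulN1r addrC.
have C0 : (fun k => n.+1%:R * (`|c| * W_norm p O (u \- phi k) + W_norm p O (v \- psi k))) @ \oo -->
    n.+1%:R * (`|c| * 0 + 0).
  apply: cvgM; first exact: cvg_cst.
  by apply: cvgD; [apply: cvgM; [exact: cvg_cst|exact: cphi]|exact: cpsi].
rewrite mulr0 addr0 mulr0 in C0.
apply: (squeeze_cvgr _ (cvg_cst 0) C0); apply: nearW => k.
rewrite W_norm_ge0 /=.
have := W_norm_lin c (Wsub _ _ Wu (tphi k)) (Wsub _ _ Wv (tpsi k)).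
rewrite (_ : (fun x => c * (u \- phi k) x + (v \- psi k) x) =
  (fun x => c * u x + v x) \- (fun x => c * phi k x + psi k x)); first by [].
by apply/funext => x /=; ring.
Qed.

Lemma W0_zero : W0 p O (fun=> 0).
Proof.
have [L0 _] := inLp0 p1 oO (n := n); split.
  exact: (weak_grad_W1p L0 (weak_grad0 p1 oO M0 OM)).
exists (fun _ _ => 0); split=> [k|]; first exact: test_fun0.
rewrite (_ : (fun k => _) = fun=> 0); first exact: cvg_cst.
apply/funext => k; rewrite (_ : _ \- _ = fun=> 0); last by apply/funext => x; rewrite /= subr0.
by apply: W_norm_ae0; [exact: L0|exact: ae0_0].
Qed.

Lemma W0_sum (I : Type) (s : seq I) (c : I -> R) (f : I -> 'rV[R]_n -> R) :
  (forall j, W0 p O (f j)) -> W0 p O (fun x => \sum_(j <- s) c j * f j x).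
Proof.
move=> Wf; elim: s => [|j s IH].
  by rewrite (_ : (fun x => _) = fun=> 0); [exact: W0_zero|apply/funext => x; rewrite big_nil].
rewrite (_ : (fun x => _) = fun x => c j * f j x + \sum_(k <- s) c k * f k x).
  exact: (W0_lin (c j) (Wf j) IH).
by apply/funext => x; rewrite big_cons.
Qed.

Lemma weak_grad_sum (I : Type) (s : seq I) (c : I -> R) (f : I -> 'rV[R]_n -> R) :
  (forall j, W1p p O (f j)) -> weak_grad p O (fun x => \sum_(j <- s) c j * f j x)
    (fun i x => \sum_(j <- s) c j * wgrad p O (f j) i x).
Proof.
move=> Wf; have Lf j := W1p_inLp (Wf j); elim: s => [|j s IH].
  rewrite (_ : (fun x => _) = fun=> 0); last by apply/funext => x; rewrite big_nil.
  rewrite (_ : (fun i => _) = fun _ _ => 0); first exact: (weak_grad0 p1 oO M0 OM).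
  by apply/funext => i; apply/funext => x; rewrite big_nil.
have := weak_grad_lin p1 oO M0 OM (c j) (Lf j) (inLp_lincomb p1 oO s c Lf).1 (wgradP (Wf j)) IH.
rewrite (_ : (fun x => c j * f j x + _) = fun x => \sum_(k <- j :: s) c k * f k x); last first.
  by apply/funext => x; rewrite big_cons.
rewrite (_ : (fun i x => c j * _ + _) = fun i x => \sum_(k <- j :: s) c k * wgrad p O (f k) i x); first by [].
by apply/funext => i; apply/funext => x; rewrite big_cons.
Qed.

(** The zero sequence and [z] continued by zeros both expand the zero function, and the expansion is
    unique. It is enough that [combo w z] vanishes almost everywhere, since [W_norm] does not see
    null sets. *)
Lemma basis_independent w m (z : 'rV[R]_m) : schauder_basis p O w -> ae0 O (combo w z) -> z = 0.
Proof.
move=> [Ww ex] z0; have [c [_ uniq]] := ex _ W0_zero.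
have Lz : inLp p O (combo w z).
  by apply: (inLp_lincomb p1 oO (index_enum 'I_m) (fun j => z ord0 j) _).1 => j; exact: W1p_inLp (Ww j).1.
pose cz (j : nat) := if insub j is Some i then z ord0 i else 0.
(* Coefficients whose partial sums are eventually null expand the zero function. *)
have uniq0 d : (exists K, forall N, (K <= N)%N -> ae0 O (lincomb d w N)) -> c = d.
  move=> [K hK]; apply: uniq.
  apply: cvg_trans (@cvg_cst _ (0 : R) nat \oo _).
  apply: near_eq_cvg; near=> N; apply/esym; apply: W_norm_ae0.
    have := (inLp_lincomb p1 oO (index_enum 'I_N) (fun j : 'I_N => - d j) (fun j => W1p_inLp (Ww j).1)).1.
    rewrite (_ : (fun x => _) = (fun=> 0) \- lincomb d w N) //.
    by apply/funext => x; rewrite /= sub0r /lincomb -sumrN; apply: eq_bigr => j _; rewrite mulNr.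
  have KN : (K <= N)%N by near: N; exact: nbhs_infty_ge.
  apply: ae0_eq (ae0_lin (-1) (hK N KN) (@ae0_0 R n O)) _ => x.
  by rewrite /= addr0 mulN1r sub0r.
have c0 : c = fun=> 0.
  apply: uniq0; exists 0%N => N _; apply: ae0_eq (@ae0_0 R n O) _ => x.
  by rewrite /lincomb big1 // => j _; rewrite mul0r.
have ccz : c = cz.
  apply: uniq0; exists m => N mN; apply: ae0_eq z0 _ => x.
  rewrite /lincomb -(big_mkord xpredT (fun j => cz j * w j x)) (big_cat_nat (leq0n m) mN) /=.
  rewrite [X in _ = _ + X]big_nat [X in _ = _ + X]big1 ?addr0; last first.
    by move=> j /andP[mj _]; rewrite /cz insubF ?mul0r // ltnNge mj.
  by rewrite big_mkord; apply: eq_bigr => j _; rewrite /cz valK.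
apply/rowP => j; rewrite mxE; have /(congr1 (fun f => f (val j))) := ccz.
by rewrite c0 /cz valK.
Unshelve. all: by end_near. Qed.

End Combinations.

(** * The affine energy *)

Section GammaPositive.
Context (R : realType).
Let mu := @lebesgue_measure R.

(** From [ln x <= x] at [x = t / (2 q)], that is [x^q <= exp (q x) = exp (t / 2)]. The leading 2
    cancels the rate 1/2 in the exponential density. *)
Let integrand_bound (q t : R) : 0 < q -> 0 < t ->
  t `^ q * expR (- t) <= 2 * (2 * q) `^ q * exponential_pdf 2^-1 t.
Proof.
move=> q0 t0; rewrite (exponential_pdfE _ (ltW t0)).
have q20 : 0 < 2 * q by rewrite mulr_gt0.
set x := t / (2 * q); have x0 : 0 < x by rewrite divr_gt0.
have tE : t = 2 * q * x by rewrite /x mulrC divfK // gt_eqF.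
rewrite {1}tE (powRM _ (ltW q20) (ltW x0)) [X in _ <= X](_ : _ = (2 * q) `^ q * expR (- 2^-1 * t)); last first.
  by move: (expR _) (_ `^ _) => a b; field.
rewrite -mulrA ler_pM2l ?powR_gt0 // (_ : - 2^-1 * t = q * x - t); last by rewrite tE; field.
rewrite expRD ler_pM2r ?expR_gt0 // /powR gt_eqF // ler_expR ler_pM2l //.
exact: ltW (ln_sublinear x0).
Qed.

(** [fine] sends infinity to 0, so positivity of the integral must be joined by finiteness, obtained
    from an exponential density. From below, the integrand is at least [exp (-2)] on [[1, 2]]. *)
Lemma Gamma_gt0 (s : R) : 1 < s -> 0 < Gamma s.
Proof.
move=> s1; have q0 : 0 < s - 1 by rewrite subr_gt0.
pose f t : R := t `^ (s - 1) * expR (- t).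
have f0 t : 0 <= f t by rewrite mulr_ge0 ?powR_ge0 ?expR_ge0.
have mfT : measurable_fun setT (fun t => (f t)%:E).
  apply/measurable_EFinP/measurable_funM; first exact: measurable_powR.
  apply: continuous_measurable_fun => x.
  apply: (@continuous_comp _ _ _ (fun x : R => - x) expR); last exact: continuous_expR.
  by apply: (@continuousN R R R id); exact: cvg_id.
have mf (D : set R) : measurable_fun D (fun t => (f t)%:E) by exact: measurable_funTS.
have fin : (\int[mu]_(t in `]0%R, +oo[) (f t)%:E < +oo)%E.
  pose C := 2 * (2 * (s - 1)) `^ (s - 1); have C0 : 0 <= C by rewrite mulr_ge0 // powR_ge0.
  have r0 : 0 <= (2^-1 : R) by rewrite invr_ge0.
  have mg : measurable_fun setT (fun t : R => (exponential_pdf 2^-1 t)%:E).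
    by apply/measurable_EFinP; exact: measurable_exponential_pdf.
  apply: (@le_lt_trans _ _ (\int[mu]_(t in `]0%R, +oo[) (C%:E * (exponential_pdf 2^-1 t)%:E))%E).
    apply: ge0_le_integral => //; first by move=> t _; rewrite lee_fin.
    - exact: mf.
    - by apply: measurable_funTS; apply: measurable_funeM; exact: mg.
    - by move=> t; rewrite /= in_itv /= andbT -EFinM lee_fin => t0; exact: integrand_bound.
  apply: (@le_lt_trans _ _ (\int[mu]_t (C%:E * (exponential_pdf 2^-1 t)%:E))%E).
    apply: ge0_subset_integral => //; first exact: measurable_funeM.
    by move=> t _; rewrite -EFinM lee_fin mulr_ge0 // exponential_pdf_ge0.
  rewrite ge0_integralZl ?integral_exponential_pdf ?invr_gt0 // ?mule1 ?ltry //.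
  by move=> t _; rewrite lee_fin exponential_pdf_ge0.
rewrite /Gamma fine_gt0 // fin andbT.
apply: (@lt_le_trans _ _ (\int[mu]_(t in `[1%R, 2%R]) (cst (expR (-2))%:E t))%E).
  rewrite integral_cst //= lebesgue_measure_itv /= lte_fin ltr1n -EFinB -EFinM lte_fin.
  by rewrite mulr_gt0 ?expR_gt0 // subr_gt0 ltr1n.
apply: (@le_trans _ _ (\int[mu]_(t in `[1%R, 2%R]) (f t)%:E)%E).
  apply: ge0_le_integral => //.
  - by move=> t _; rewrite lee_fin expR_ge0.
  - exact: mf.
  move=> t; rewrite /= in_itv /= => /andP[t1 t2]; rewrite lee_fin /f.
  rewrite -[leLHS]mul1r ler_pM ?expR_ge0 //; last by rewrite ler_expR lerN2.
  by rewrite -[leLHS](powRr0 t); apply: ler_powR => //; exact: ltW.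
apply: ge0_subset_integral => //; first exact: (mf `]0, +oo[%classic).
  by move=> t _; rewrite lee_fin; exact: f0.
by move=> t; rewrite /= !in_itv /= andbT => /andP[t1 _]; rewrite (lt_le_trans _ t1).
Qed.

Lemma omega_gt0 (k : R) : 0 < k -> 0 < omega k.
Proof.
by move=> k0; rewrite divr_gt0 ?powR_gt0 ?pi_gt0 // Gamma_gt0 // ltrDr divr_gt0.
Qed.

Lemma gamma_np_gt0 n (p : R) : (0 < n)%N -> 1 < p -> 0 < gamma_np n p.
Proof.
move=> n0 p1; have nR : (1 : R) <= n%:R by rewrite ler1n.
have nR0 : (0 : R) < n%:R by rewrite ltr0n.
have h1 : 0 < omega (n%:R + p - 2) by apply: omega_gt0; lra.
have h2 : 0 < omega (p - 1) by apply: omega_gt0; rewrite subr_gt0.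
have h3 := omega_gt0 nR0.
have h4 := mulr_gt0 nR0 h3.
apply: mulr_gt0; last exact: powR_gt0.
apply: mulr_gt0; last exact: (mulr_gt0 h4 h2).
by rewrite invr_gt0; exact: (mulr_gt0 (ltr0Sn R 1) h1).
Qed.

End GammaPositive.

Lemma enorm_eq0 (R : realType) n (x : 'rV[R]_n) : (enorm x == 0) = (x == 0).
Proof.
apply/idP/eqP => [/eqP x0|->]; last first.
  by rewrite /enorm big1 ?sqrtr0 // => i _; rewrite mxE expr0n.
apply/rowP => i; have := norm_coord_le_enorm x i.
by rewrite x0 mxE normr_le0 => /eqP.
Qed.

Lemma enormZ (R : realType) n (t : R) (x : 'rV[R]_n) : enorm (t *: x) = `|t| * enorm x.
Proof.
rewrite /enorm -sqrtr_sqr -sqrtrM ?sqr_ge0 // mulr_sumr; congr Num.sqrt.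
by apply: eq_bigr => i _; rewrite mxE exprMn.
Qed.

Lemma continuous_enorm (R : realType) n : continuous (@enorm R n).
Proof.
move=> x.
have c : continuous (fun x : 'rV[R]_n => \sum_(i < n) x ord0 i ^+ 2).
  apply: (@continuous_sum_fun R _ 'I_n (index_enum 'I_n) (fun i (x : 'rV[R]_n) => x ord0 i ^+ 2)) => i y.
  have ci := @coord_continuous R 1 n ord0 i y.
  exact: (@continuousM R _ (fun z : 'rV[R]_n => z ord0 i) (fun z : 'rV[R]_n => z ord0 i) y ci ci).
apply: (@continuous_comp _ _ _ (fun x : 'rV[R]_n => \sum_(i < n) x ord0 i ^+ 2) (@Num.sqrt R) x (c x)).
exact: sqrt_continuous.
Qed.

(** * The energy of an abstract gauge *)

Section GaugeEnergy.
Context (R : realType) (n : nat) (p : R).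
Hypotheses (n0 : (0 < n)%N) (p1 : 1 < p).
Implicit Types a b : 'rV[R]_n -> R.

(** [affine_int] with an arbitrary function in place of the directional norm, so that the energy of
    [u_z] can be compared with that of [enorm]. *)
Definition gauge_int a : \bar R :=
  sphere_int (fun xi => if a xi == 0 then +oo%E else (a xi `^ (- n%:R))%:E).

Definition gauge_energy a : R :=
  if gauge_int a == +oo%E then 0 else gamma_np n p * fine (gauge_int a) `^ (- n%:R^-1).

(* The role of [a] is played by [xi |-> ||D_xi u_z||_p] with [z != 0]. *)
Definition is_gauge a : Prop :=
  [/\ continuous a, forall t x, a (t *: x) = `|t| * a x &
      exists c C : R, [/\ 0 < c, 0 < C, forall x, c * enorm x <= a x & forall x, a x <= C * enorm x]].

Definition pball : set 'rV[R]_n := [set x | (0 < enorm x) && (enorm x <= 1)].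

Let nR0 : (0 : R) < n%:R. Proof. by rewrite ltr0n. Qed.

Lemma measurable_enorm : measurable_fun (setT : set (borelT R n)) (@enorm R n).
Proof. by apply: measurable_continuous; exact: continuous_enorm. Qed.

Lemma measurable_pball : measurable (pball : set (borelT R n)).
Proof.
rewrite (_ : pball = (@enorm R n) @^-1` `]0, 1]%classic); last first.
  by apply/seteqP; split=> x /=; rewrite /pball /= in_itv.
by rewrite -[X in measurable X]setTI; exact: measurable_enorm.
Qed.

Lemma pball_cbox : pball `<=` cbox (const_mx (- 1)) (const_mx 1).
Proof.
move=> x /andP[_ x1] i; rewrite !mxE -ler_norml.
exact: le_trans (norm_coord_le_enorm x i) x1.
Qed.

(** The known volumes are those of centred cubes. The cube of half-side [1/n] lies in the unit ball,
    and a cube of half that side covers the origin; were the punctured ball null, the large cube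
    would have at most the measure of the small one, but it has [2^n] times as much. *)
Lemma lebn_pball_gt0 : (0 < lebn R n pball)%E.
Proof.
have r0 : (0 : R) <= n%:R^-1 by rewrite invr_ge0 ltW.
have d0 : (0 : R) <= (2 * n%:R)^-1 by rewrite invr_ge0 mulr_ge0 // ltW.
have sub : cbox (const_mx (- n%:R^-1)) (const_mx n%:R^-1) `<=`
    pball `|` cbox (const_mx (- (2 * n%:R)^-1)) (const_mx (2 * n%:R)^-1 : 'rV[R]_n).
  move=> x hx; have [x0|x0] := eqVneq x 0.
    by right => i; rewrite x0 !mxE oppr_le0 d0.
  left; apply/andP; split; first by rewrite lt_neqAle enorm_ge0 eq_sym enorm_eq0 x0.
  apply: (le_trans (enorm_le_sum x)); apply: (@le_trans _ _ (\sum_(i < n) n%:R^-1)).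
    by apply: ler_sum => i _; have := hx i; rewrite !mxE -ler_norml.
  by rewrite sumr_const card_ord -[leLHS]mulr_natl mulfV // gt_eqF.
rewrite lt_neqAle measure_ge0 andbT; apply/negP => /eqP/esym B0.
set K1 := cbox (const_mx (- n%:R^-1)) (const_mx n%:R^-1 : 'rV[R]_n) in sub.
set K2 := cbox (const_mx (- (2 * n%:R)^-1)) (const_mx (2 * n%:R)^-1 : 'rV[R]_n) in sub.
have m1 : measurable (K1 : set (borelT R n)) by exact: measurable_cbox.
have m2 : measurable (K2 : set (borelT R n)) by exact: measurable_cbox.
have mB := measurable_pball.
have le1 : (lebn R n K1 <= lebn R n (pball `|` K2))%E.
  by apply: le_measure; rewrite ?inE //; exact: measurableU.
have := le_trans le1 (measureU2 (lebn R n) mB m2).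
rewrite -[X in (_ <= X -> _)%E]/(lebn R n pball + lebn R n K2)%E.
rewrite B0 add0e /K1 /K2 !lebn_cbox // lee_fin.
have -> : 2 * n%:R^-1 = 2 * (2 * (2 * n%:R)^-1) :> R by field; rewrite gt_eqF.
set t := 2 * (2 * n%:R)^-1; have t0 : 0 < t ^+ n by rewrite exprn_gt0 // !(mulr_gt0, invr_gt0).
rewrite exprMn -[leRHS]mul1r ler_pM2r // leNgt exprn_egt1 ?ltr1n //.
by rewrite -lt0n n0.
Qed.

Lemma lebn_pball_lty : (lebn R n pball < +oo)%E.
Proof.
apply: (@le_lt_trans _ _ (lebn R n (cbox (const_mx (- 1)) (const_mx 1)))).
  apply: le_measure; rewrite ?inE; [exact: measurable_pball|exact: measurable_cbox|exact: pball_cbox].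
by rewrite lebn_cbox // ltry.
Qed.

(** By homogeneity of a gauge this is the integrand of [gauge_int], namely [(a x / enorm x)^-n] on
    the punctured ball; the product form makes it visibly measurable. *)
Let density a x := \1_pball x * (a x `^ (- n%:R) * enorm x ^+ n).

Let density_ge0 a x : 0 <= density a x.
Proof. by rewrite !mulr_ge0 ?powR_ge0 // exprn_ge0 // enorm_ge0. Qed.

Let measurable_density a : continuous a ->
  measurable_fun (setT : set (borelT R n)) (density a).
Proof.
move=> ca; apply: measurable_funM.
  by apply/measurable_indicP; exact: measurable_pball.
apply: measurable_funM; last by apply: measurable_funX; exact: measurable_enorm.
apply: (measurableT_comp (measurable_powR (- n%:R))).
exact: measurable_continuous.
Qed.

Let densityE a x : is_gauge a -> density a x = \1_pball x * (a x / enorm x) ^- n.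
Proof.
move=> [_ _ [c [C [c0 _ h _]]]].
have ax : 0 <= a x by rewrite (le_trans _ (h x)) // mulr_ge0 ?enorm_ge0 ?(ltW c0).
by rewrite /density powR_invn // exprMn invfM exprVn invrK.
Qed.

Let gauge_intE a : is_gauge a ->
  gauge_int a = (n%:R%:E * \int[lebn R n]_x (density a x)%:E)%E.
Proof.
move=> ga; have [ca ha [c [C [c0 C0 h1 h2]]]] := ga.
rewrite /gauge_int /sphere_int; congr (_ * _)%E.
rewrite -Rn_intE; last 2 first.
- by apply/measurable_EFinP; exact: measurable_density.
- by move=> x; rewrite lee_fin.
congr Rn_int; apply/funext => x; rewrite (densityE x ga) indicE.
have -> : (x \in pball) = (0 < enorm x) && (enorm x <= 1).
  by apply/idP/idP => [/set_mem|/mem_set].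
case: ifP => [/andP[x0 x1]|]; last by rewrite mul0r.
have ax : 0 < a x by rewrite (lt_le_trans _ (h1 x)) // mulr_gt0.
rewrite ha ger0_norm ?invr_ge0 ?ltW // mul1r.
have qx : 0 < (enorm x)^-1 * a x by rewrite mulr_gt0 // invr_gt0.
by rewrite gt_eqF // powR_invn ?ltW // mulrC.
Qed.

(** On the punctured ball, of finite positive measure, the integrand lies between [C^-n] and
    [c^-n]. *)
Lemma gauge_int_fin a : is_gauge a -> exists2 r : R, 0 < r & gauge_int a = r%:E.
Proof.
move=> ga; have [ca ha [c [C [c0 C0 h1 h2]]]] := ga.
have mB := measurable_pball; have md := measurable_density ca.
have ratio x : 0 < enorm x -> c <= a x / enorm x <= C.
  by move=> x0; rewrite ler_pdivlMr // h1 ler_pdivrMr // h2.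
have int_indic (k : R) : 0 <= k ->
   (\int[lebn R n]_x (k * \1_pball x)%:E = k%:E * lebn R n pball)%E.
  move=> k0; under eq_integral do rewrite EFinM.
  rewrite ge0_integralZl //; last by apply/measurable_EFinP/measurable_indicP.
  by rewrite integral_indic // setIT.
have mind (k : R) : measurable_fun (setT : set (borelT R n)) (fun x => (k * \1_pball x)%:E).
  by apply/measurable_EFinP; apply: measurable_funM => //; exact/measurable_indicP.
have mdE : measurable_fun (setT : set (borelT R n)) (fun x => (density a x)%:E).
  exact/measurable_EFinP.
have up : (\int[lebn R n]_x (density a x)%:E < +oo)%E.
  apply: (@le_lt_trans _ _ (\int[lebn R n]_x (c ^- n * \1_pball x)%:E)%E).
    apply: ge0_le_integral; [exact: measurableT|by move=> x _; rewrite lee_fin|exact: mdE|exact: mind|].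
    move=> x _; rewrite lee_fin (densityE x ga) indicE.
    have [/set_mem/andP[x0 _]|_] := boolP (x \in pball); last by rewrite mul0r mulr0.
    have /andP[r1 r2] := ratio x x0; rewrite mul1r mulr1 lef_pV2 ?posrE ?exprn_gt0 ?(lt_le_trans c0 r1) //.
    by rewrite lerXn2r // nnegrE ?(le_trans (ltW c0) r1) // ltW.
  rewrite int_indic; last by rewrite invr_ge0 exprn_ge0 // ltW.
  by rewrite lte_mul_pinfty ?lee_fin ?invr_ge0 ?exprn_ge0 ?ltW // lebn_pball_lty.
have lo : (0 < \int[lebn R n]_x (density a x)%:E)%E.
  apply: (@lt_le_trans _ _ (\int[lebn R n]_x (C ^- n * \1_pball x)%:E)%E).
    rewrite int_indic; last by rewrite invr_ge0 exprn_ge0 // ltW.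
    by rewrite mule_gt0 ?lebn_pball_gt0 // lte_fin invr_gt0 exprn_gt0.
  apply: ge0_le_integral; [exact: measurableT| |exact: mind|exact: mdE|].
    by move=> x _; rewrite lee_fin mulr_ge0 // invr_ge0 exprn_ge0 // ltW.
  move=> x _; rewrite lee_fin (densityE x ga) indicE.
  have [/set_mem/andP[x0 _]|_] := boolP (x \in pball); last by rewrite mul0r mulr0.
  have /andP[r1 r2] := ratio x x0; rewrite mul1r mulr1 lef_pV2 ?posrE ?exprn_gt0 ?(lt_le_trans c0 r1) //.
  by rewrite lerXn2r // nnegrE ?(le_trans (ltW c0) r1) // ltW.
rewrite (gauge_intE ga).
have fin : (\int[lebn R n]_x (density a x)%:E)%E \is a fin_num by rewrite ge0_fin_numE // ltW.
move: up lo; rewrite -(fineK fin); set I := fine _; rewrite lte_fin => _ I0.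
by exists (n%:R * I); [exact: mulr_gt0|rewrite EFinM].
Qed.

(** The exponent [-n] reverses the inequality; the power [-1/n] in the energy reverses it back and
    turns [lam^n] into [lam]. *)
Lemma gauge_int_le a b lam : is_gauge a -> is_gauge b -> 0 < lam -> (forall x, a x <= lam * b x) ->
  (gauge_int b <= (lam ^+ n)%:E * gauge_int a)%E.
Proof.
move=> ga gb lam0 ab.
have [ca _ [c [C [c0 C0 h1 _]]]] := ga; have [cb _ [c' [C' [c'0 _ h1' _]]]] := gb.
have md := measurable_density ca; have md' := measurable_density cb.
rewrite (gauge_intE ga) (gauge_intE gb) muleCA.
apply: lee_wpmul2l; first by rewrite lee_fin ltW.
rewrite -ge0_integralZl; [|exact: measurableT|exact/measurable_EFinP|by move=> x _; rewrite lee_fin|].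
  apply: ge0_le_integral; [exact: measurableT|by move=> x _; rewrite lee_fin|exact/measurable_EFinP| |].
    by apply: measurable_funeM; exact/measurable_EFinP.
  move=> x _; rewrite -EFinM lee_fin (densityE x ga) (densityE x gb) indicE.
  have [/set_mem/andP[x0 _]|_] := boolP (x \in pball); last by rewrite !mul0r mulr0.
  have ax0 : 0 < a x by rewrite (lt_le_trans _ (h1 x)) // mulr_gt0.
  have bx0 : 0 < b x by rewrite (lt_le_trans _ (h1' x)) // mulr_gt0.
  have ax : 0 < a x / enorm x by exact: divr_gt0.
  have bx : 0 < b x / enorm x by exact: divr_gt0.
  have abx : a x / enorm x <= b x / enorm x * lam by rewrite mulrAC ler_pM2r ?invr_gt0 // mulrC.
  move: (a x / enorm x) (b x / enorm x) ax bx abx => A B A0 B0 AB; rewrite !mul1r.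
  rewrite -[lam ^+ n]invrK -invfM lef_pV2 ?posrE ?exprn_gt0 ?mulr_gt0 ?invr_gt0 ?exprn_gt0 //.
  rewrite mulrC ler_pdivrMr ?exprn_gt0 // -exprMn lerXn2r // nnegrE ltW // mulr_gt0 //.
by rewrite lee_fin exprn_ge0 // ltW.
Qed.

Lemma gauge_energyE a (r : R) : gauge_int a = r%:E -> gauge_energy a = gamma_np n p / r `^ n%:R^-1.
Proof. by rewrite /gauge_energy => -> /=; rewrite powRN. Qed.

Lemma gauge_energy_gt0 a : is_gauge a -> 0 < gauge_energy a.
Proof.
move=> /gauge_int_fin[r r0 E]; rewrite (gauge_energyE E) divr_gt0 ?powR_gt0 //.
exact: gamma_np_gt0.
Qed.

Lemma gauge_energy_le a b lam : is_gauge a -> is_gauge b -> 0 < lam -> (forall x, a x <= lam * b x) ->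
  gauge_energy a <= lam * gauge_energy b.
Proof.
move=> ga gb lam0 ab; have [r r0 E] := gauge_int_fin ga; have [s s0 E'] := gauge_int_fin gb.
have := gauge_int_le ga gb lam0 ab; rewrite E E' -EFinM lee_fin => h.
rewrite (gauge_energyE E) (gauge_energyE E') mulrCA ler_pM2l ?gamma_np_gt0 //.
have rn : 0 < r `^ n%:R^-1 by exact: powR_gt0.
have sn : 0 < s `^ n%:R^-1 by exact: powR_gt0.
rewrite ler_pdivlMr // mulrC ler_pdivrMr //.
have n1 : (0 : R) < n%:R^-1 by rewrite invr_gt0.
have := ge0_powR_le n1 (ltW s0) h.
by rewrite (powRM _ (exprn_ge0 n (ltW lam0)) (ltW r0)) -(powR_mulrn _ (ltW lam0)) -powRrM mulfV ?gt_eqF // (powRr1 (ltW lam0)).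
Qed.

(** Monotonicity, applied with [lam] and with its inverse. *)
Lemma gauge_energy_scale a b lam : is_gauge a -> is_gauge b -> 0 < lam -> (forall x, a x = lam * b x) ->
  gauge_energy a = lam * gauge_energy b.
Proof.
move=> ga gb lam0 ab; apply/eqP; rewrite eq_le gauge_energy_le ?ab //=; last by move=> x; rewrite ab.
rewrite mulrC -ler_pdivlMr // mulrC gauge_energy_le ?invr_gt0 // => x.
by rewrite ab mulrA mulVf ?mul1r // gt_eqF.
Qed.

(** The integrand is infinite on a set of positive measure, and the energy of an infinite integral
    is 0 by definition. *)
Lemma gauge_energy0 a : (forall x, a x = 0) -> gauge_energy a = 0.
Proof.
move=> a0; suff E : gauge_int a = +oo%E by rewrite /gauge_energy E eqxx.
have mB := measurable_pball.
rewrite /gauge_int /sphere_int.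
rewrite (_ : (fun x => _) = (cst +oo%E : 'rV[R]_n -> \bar R) \_ pball); last first.
  apply/funext => x; rewrite patchE a0 eqxx.
  have -> : (x \in pball) = (0 < enorm x) && (enorm x <= 1); last by [].
  by apply/idP/idP => [/set_mem|/mem_set].
rewrite Rn_intE; last 2 first.
- by apply/(measurable_restrictT _ mB); exact: measurable_cst.
- by move=> x; rewrite patchE; case: ifP => _; rewrite ?leey.
rewrite -integral_mkcond integral_cst // gt0_mulye ?lebn_pball_gt0 //.
by rewrite gt0_muley // lte_fin.
Qed.

End GaugeEnergy.

(** * Lipschitz estimates and lower bounds for biseminorms *)

Lemma rV_norm_le (R : realType) m (x : 'rV[R]_m) (B : R) :
  0 <= B -> (forall j, `|x ord0 j| <= B) -> `|x| <= B.
Proof.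
move=> B0 h; have -> : `|x| = \big[Order.max/0]_i `|x i.1 i.2| by rewrite -mx_normrE.
by apply: bigmax_le => // -[i j] _ /=; rewrite ord1.
Qed.

Lemma norm_le_enorm (R : realType) n (x : 'rV[R]_n) : `|x| <= enorm x.
Proof. by apply: rV_norm_le; [exact: enorm_ge0|move=> j; exact: norm_coord_le_enorm]. Qed.

Lemma enorm_le_norm (R : realType) n (x : 'rV[R]_n) : enorm x <= n%:R * `|x|.
Proof.
have h := norm_coord_le x; move: h; set B := `|x| => h.
apply: (le_trans (enorm_le_sum x)); rewrite mulr_natl -[X in _ *+ X](card_ord n) -sumr_const.
by apply: ler_sum.
Qed.

Lemma continuous_of_lipschitz_at (R : realType) m (f : 'rV[R]_m -> R) (z : 'rV[R]_m) (d L : R) :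
  0 < d -> 0 <= L -> (forall y, `|z - y| < d -> `|f z - f y| <= L * `|z - y|) ->
  {for z, continuous f}.
Proof.
move=> d0 L0 h; apply: (proj2 (@cvgrPdist_lt _ _ _ (nbhs z) _ f (f z))) => e e0; have L1 : 0 < L + 1 by rewrite ltr_wpDl.
have m0 : 0 < Num.min d (e / (L + 1)) by rewrite lt_min d0 divr_gt0.
apply/nbhs_ballP; exists (Num.min d (e / (L + 1))) => //= y.
rewrite -ball_normE /= lt_min => /andP[yd ye].
apply: (le_lt_trans (h y yd)); rewrite ltr_pdivlMr // in ye.
by apply: (le_lt_trans _ ye); rewrite mulrC ler_wpM2l // lerDl.
Qed.

Lemma continuous_lipschitz (R : realType) m (f : 'rV[R]_m -> R) (L : R) :
  0 <= L -> (forall x y, `|f x - f y| <= L * `|x - y|) -> continuous f.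
Proof. by move=> L0 h z; apply: (@continuous_of_lipschitz_at _ _ f z 1 L) => //. Qed.

Section BiSeminorm.
Context (R : realType) (m n : nat) (N : 'rV[R]_m -> 'rV[R]_n -> R) (K : R).
Hypothesis K0 : 0 <= K.
Hypothesis NDl : forall z y xi, N (z + y) xi <= N z xi + N y xi.
Hypothesis NDr : forall z xi eta, N z (xi + eta) <= N z xi + N z eta.
Hypothesis NZl : forall t z xi, N (t *: z) xi = `|t| * N z xi.
Hypothesis NZr : forall t z xi, N z (t *: xi) = `|t| * N z xi.
Hypothesis NK : forall z xi, N z xi <= K * `|z| * `|xi|.
Hypothesis Npos : forall z xi, z != 0 -> xi != 0 -> 0 < N z xi.

Lemma biseminorm_distl z y xi : `|N z xi - N y xi| <= K * `|z - y| * `|xi|.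
Proof.
have le a b : N a xi - N b xi <= K * `|a - b| * `|xi|.
  by rewrite lerBlDr (le_trans _ (lerD (NK (a - b) xi) (lexx _))) // -{1}(subrK b a).
rewrite ler_norml le andbT lerNl opprB (distrC z y); exact: le.
Qed.

Lemma biseminorm_distr z xi eta : `|N z xi - N z eta| <= K * `|z| * `|xi - eta|.
Proof.
have le a b : N z a - N z b <= K * `|z| * `|a - b|.
  by rewrite lerBlDr (le_trans _ (lerD (NK z (a - b)) (lexx _))) // -{1}(subrK b a).
rewrite ler_norml le andbT lerNl opprB (distrC xi eta); exact: le.
Qed.

(** Pairs [(z, xi)] are coded as row vectors of length [m + n], so that the extremum theorem for row
    vectors applies to a product of two unit spheres. *)
Let lpart (v : 'rV[R]_(m + n)) : 'rV[R]_m := lsubmx v.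
Let rpart (v : 'rV[R]_(m + n)) : 'rV[R]_n := rsubmx v.

Let lpart_le v : `|lpart v| <= `|v|.
Proof. by apply: rV_norm_le => // j; rewrite mxE norm_coord_le. Qed.

Let rpart_le v : `|rpart v| <= `|v|.
Proof. by apply: rV_norm_le => // j; rewrite mxE norm_coord_le. Qed.

Let lpartB v u : lpart v - lpart u = lpart (v - u).
Proof. by rewrite /lpart linearB. Qed.

Let rpartB v u : rpart v - rpart u = rpart (v - u).
Proof. by rewrite /rpart linearB. Qed.

Let continuous_N : continuous (fun v => N (lpart v) (rpart v)).
Proof.
move=> v; pose L := K * (`|v| + 1) + K * `|v|.
have L0 : 0 <= L by rewrite addr_ge0 // mulr_ge0 // addr_ge0.
apply: (@continuous_of_lipschitz_at _ _ _ v 1 L) => // u uv.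
apply: (le_trans (ler_distD (N (lpart u) (rpart v)) _ _)); rewrite addrC mulrDl; apply: lerD.
  apply: (le_trans (biseminorm_distr _ _ _)); rewrite rpartB -!mulrA ler_wpM2l //.
  rewrite ler_pM //; apply: (le_trans (lpart_le u)).
  by rewrite -lerBlDl (le_trans _ (ltW uv)) // (distrC v) lerB_dist.
apply: (le_trans (biseminorm_distl _ _ _)); rewrite lpartB -!mulrA ler_wpM2l //.
by rewrite mulrC ler_pM.
Qed.

Let spheres : set 'rV[R]_(m + n) :=
  (fun v => `|lpart v|) @^-1` [set 1] `&` (fun v => `|rpart v|) @^-1` [set 1].

Let compact_spheres : compact spheres.
Proof.
have cl : closed spheres.
  apply: closedI; (apply: preimage_closed; last exact: closed_eq) => v _ /=.
    apply: (@continuous_lipschitz _ _ (fun v => `|lpart v|) 1) => // x y.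
    by rewrite mul1r (le_trans (ler_dist_dist _ _)) // lpartB.
  apply: (@continuous_lipschitz _ _ (fun v => `|rpart v|) 1) => // x y.
  by rewrite mul1r (le_trans (ler_dist_dist _ _)) // rpartB.
apply: (subclosed_compact cl (@compact_cbox R (m + n) (const_mx (-1)) (const_mx 1))).
move=> v [l1 r1] i; rewrite !mxE -ler_norml.
case: (split_ordP i) => j ->.
  by move: (norm_coord_le (lpart v) j); rewrite mxE => /le_trans; apply; rewrite l1.
by move: (norm_coord_le (rpart v) j); rewrite mxE => /le_trans; apply; rewrite r1.
Qed.

(** By homogeneity a bound on the product of the unit spheres is enough; this set is compact, and
    [N] is continuous and positive on it. *)
Lemma biseminorm_lower : exists2 c, 0 < c & forall z xi, c * `|z| * `|xi| <= N z xi.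
Proof.
have N0l xi : N 0 xi = 0 by have := NZl 0 0 xi; rewrite scaler0 normr0 mul0r.
have N0r z : N z 0 = 0 by have := NZr 0 z 0; rewrite scaler0 normr0 mul0r.
suff [c c0 hc] : exists2 c, 0 < c & forall v, spheres v -> c <= N (lpart v) (rpart v).
  exists c => // z xi; have [->|z0] := eqVneq z 0; first by rewrite normr0 mulr0 mul0r N0l.
  have [->|xi0] := eqVneq xi 0; first by rewrite normr0 mulr0 N0r.
  have nz : 0 < `|z| by rewrite normr_gt0.
  have nxi : 0 < `|xi| by rewrite normr_gt0.
  have := hc (row_mx (`|z|^-1 *: z) (`|xi|^-1 *: xi)).
  rewrite /lpart /rpart row_mxKl row_mxKr NZl NZr !gtr0_norm ?invr_gt0 // => h.
  rewrite -mulrA mulrC -ler_pdivlMl ?mulr_gt0 // invfM -mulrA h //.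
  split=> /=; rewrite /lpart /rpart ?row_mxKl ?row_mxKr normrZ gtr0_norm ?invr_gt0 //;
    by rewrite mulVf // gt_eqF.
(* If [m] or [n] is 0 the product of spheres is empty and any positive constant will do. *)
have [[v0 sv0]|no] := pselect (spheres !=set0); last first.
  by exists 1 => // v sv; exfalso; apply: no; exists v.
have cN : {within spheres, continuous (fun v => N (lpart v) (rpart v))}.
  exact: continuous_subspaceT.
have [v] := EVT_min_rV (ex_intro _ v0 sv0) compact_spheres cN.
rewrite inE => -[l1 r1] hv; exists (N (lpart v) (rpart v)).
  by apply: Npos; rewrite -normr_gt0 ?l1 ?r1 ltr01.
by move=> u su; apply: hv; rewrite inE.
Qed.

End BiSeminorm.

(** * The affine floor of a finite combination *)

Section Floor.
Context (R : realType) (n : nat) (p : R) (O : set 'rV[R]_n) (M : R).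
Hypotheses (n0 : (0 < n)%N) (p1 : 1 < p) (oO : open O) (M0 : 0 <= M).
Hypothesis OM : O `<=` cbox (const_mx (- M)) (const_mx M).
Context (w : nat -> 'rV[R]_n -> R) (m : nat).
Hypothesis bw : schauder_basis p O w.
Implicit Types (z y : 'rV[R]_m) (xi : 'rV[R]_n).

Let Ww j : W0 p O (w j). Proof. exact: bw.1. Qed.
Let Lgw j i : inLp p O (wgrad p O (w j) i). Proof. exact: wgrad_inLp (Ww j).1. Qed.

Definition dirnorm z xi : R := Lp_norm p O (dir_grad p O (combo w z) xi).

Lemma combo_W0 z : W0 p O (combo w z).
Proof. exact: (W0_sum p1 oO M0 OM (index_enum 'I_m) (fun j => z ord0 j) (fun j : 'I_m => Ww j)). Qed.

Let combo_weak_grad z :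
  weak_grad p O (combo w z) (fun i x => \sum_(j < m) z ord0 j * wgrad p O (w j) i x).
Proof.
exact: (weak_grad_sum p1 oO M0 OM (index_enum 'I_m) (fun j => z ord0 j) (fun j : 'I_m => (Ww j).1)).
Qed.

(** Built from the gradients of the basis functions, hence bilinear in [z] and [xi] at every point,
    whereas [dir_grad] of [combo w z] involves a new choice for each [z]; the two agree up to null
    sets. *)
Let explicit z xi x := \sum_(i < n) xi ord0 i * \sum_(j < m) z ord0 j * wgrad p O (w j) i x.

Let Lsum z i : inLp p O (fun x => \sum_(j < m) z ord0 j * wgrad p O (w j) i x) /\
  Lp_norm p O (fun x => \sum_(j < m) z ord0 j * wgrad p O (w j) i x) <=
    \sum_(j < m) `|z ord0 j| * Lp_norm p O (wgrad p O (w j) i).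
Proof. exact: (inLp_lincomb p1 oO (index_enum 'I_m) (fun j => z ord0 j) (fun j : 'I_m => Lgw j i)). Qed.

Let Lexplicit z xi : inLp p O (explicit z xi) /\ Lp_norm p O (explicit z xi) <=
  \sum_(i < n) `|xi ord0 i| * Lp_norm p O (fun x => \sum_(j < m) z ord0 j * wgrad p O (w j) i x).
Proof. exact: (inLp_lincomb p1 oO (index_enum 'I_n) (fun i => xi ord0 i) (fun i => (Lsum z i).1)). Qed.

Let dirnormE z xi : dirnorm z xi = Lp_norm p O (explicit z xi).
Proof.
have W := (combo_W0 z).1; have L := W1p_inLp W.
apply: (Lp_norm_ae p1 oO (inLp_dir_grad p1 oO xi W).1 (Lexplicit z xi).1 _).2.
exact: (dir_grad_ae p1 oO M0 OM xi L (combo_weak_grad z)).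
Qed.

Lemma dirnormDl z y xi : dirnorm (z + y) xi <= dirnorm z xi + dirnorm y xi.
Proof.
rewrite !dirnormE; have [_] := inLp_add p1 oO (Lexplicit z xi).1 (Lexplicit y xi).1.
rewrite (_ : explicit z xi \+ explicit y xi = explicit (z + y) xi) //.
apply/funext => x; rewrite /explicit /= -big_split; apply: eq_bigr => i _ /=.
by rewrite -mulrDr -big_split; congr (_ * _); apply: eq_bigr => j _; rewrite mxE mulrDl.
Qed.

Lemma dirnormDr z xi eta : dirnorm z (xi + eta) <= dirnorm z xi + dirnorm z eta.
Proof.
rewrite !dirnormE; have [_] := inLp_add p1 oO (Lexplicit z xi).1 (Lexplicit z eta).1.
rewrite (_ : explicit z xi \+ explicit z eta = explicit z (xi + eta)) //.
by apply/funext => x; rewrite /explicit /= -big_split; apply: eq_bigr => i _; rewrite mxE mulrDl.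
Qed.

Lemma dirnormZl t z xi : dirnorm (t *: z) xi = `|t| * dirnorm z xi.
Proof.
rewrite !dirnormE -(inLp_scale p1 oO t (Lexplicit z xi).1).2; congr Lp_norm.
apply/funext => x; rewrite /explicit mulr_sumr; apply: eq_bigr => i _.
rewrite [RHS]mulrCA; congr (_ * _); rewrite mulr_sumr.
by apply: eq_bigr => j _; rewrite mxE mulrA.
Qed.

Lemma dirnormZr t z xi : dirnorm z (t *: xi) = `|t| * dirnorm z xi.
Proof.
rewrite !dirnormE -(inLp_scale p1 oO t (Lexplicit z xi).1).2; congr Lp_norm.
by apply/funext => x; rewrite /explicit mulr_sumr; apply: eq_bigr => i _; rewrite mxE mulrA.
Qed.

(** The added 1 makes [K] positive even if all these gradients are null. *)
Let K := 1 + \sum_(i < n) \sum_(j < m) Lp_norm p O (wgrad p O (w j) i).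

Let S0 : 0 <= \sum_(i < n) \sum_(j < m) Lp_norm p O (wgrad p O (w j) i).
Proof. by apply: sumr_ge0 => i _; apply: sumr_ge0 => j _; exact: Lp_norm_ge0. Qed.

Let K0 : 0 < K. Proof. by rewrite ltr_wpDr. Qed.

Lemma dirnorm_le z xi : dirnorm z xi <= K * `|z| * `|xi|.
Proof.
rewrite dirnormE; apply: (le_trans (Lexplicit z xi).2).
apply: (@le_trans _ _ ((\sum_(i < n) \sum_(j < m) Lp_norm p O (wgrad p O (w j) i)) * (`|z| * `|xi|))).
  rewrite mulr_suml; apply: ler_sum => i _; rewrite [leRHS]mulrA [leRHS]mulrC.
  apply: ler_pM; [exact: normr_ge0|exact: Lp_norm_ge0|exact: norm_coord_le|].
  apply: (le_trans (Lsum z i).2); rewrite mulrC mulr_sumr; apply: ler_sum => j _.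
  by apply: (ler_wpM2r (Lp_norm_ge0 _ _ _)); exact: norm_coord_le.
by rewrite -mulrA ler_wpM2r ?mulr_ge0 // lerDr.
Qed.

(** A zero would make [combo w z] vanish almost everywhere, by the Poincaré argument, and then
    [z = 0] by independence of the basis. *)
Lemma dirnorm_gt0 z xi : z != 0 -> xi != 0 -> 0 < dirnorm z xi.
Proof.
move=> z0 /eqP xi0; rewrite lt_neqAle Lp_norm_ge0 andbT eq_sym; apply/eqP => N0.
have [i xii] : exists i, xi ord0 i != 0.
  apply: contrapT => no; apply: xi0; apply/rowP => i; rewrite mxE.
  by apply: contrapT => /eqP xii; apply: no; exists i.
have := W0_dir_grad_eq0 p1 oO M0 OM (combo_W0 z) xii N0.
by move/(basis_independent p1 oO M0 OM bw)/eqP; rewrite (negbTE z0).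
Qed.

(** Passage from the maximum norm of [xi] to [enorm]; the divisor [n] is the constant of
    [enorm_le_norm]. *)
Lemma dirnorm_bounds : exists c C : R, [/\ 0 < c, 0 < C,
  forall z xi, c * `|z| * enorm xi <= dirnorm z xi &
  forall z xi, dirnorm z xi <= C * `|z| * enorm xi].
Proof.
have [c c0 hc] := biseminorm_lower (ltW K0) dirnormDl dirnormDr dirnormZl dirnormZr dirnorm_le dirnorm_gt0.
have nR : (0 : R) < n%:R by rewrite ltr0n.
exists (c / n%:R), K; split=> //; first exact: divr_gt0.
  move=> z xi; apply: (le_trans _ (hc z xi)).
  rewrite -!mulrA ler_wpM2l ?(ltW c0) // mulrCA ler_wpM2l // mulrC ler_pdivrMr // mulrC.
  exact: enorm_le_norm.
move=> z xi; apply: (le_trans (dirnorm_le z xi)).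
by rewrite ler_wpM2l ?norm_le_enorm // mulr_ge0 // ltW.
Qed.

Lemma is_gauge_enorm : is_gauge (@enorm R n).
Proof.
split; [exact: continuous_enorm|exact: enormZ|].
by exists 1, 1; split=> // x; rewrite mul1r.
Qed.

Lemma is_gauge_dirnorm z : z != 0 -> is_gauge (dirnorm z).
Proof.
move=> z0; have nz : 0 < `|z| by rewrite normr_gt0.
have [c [C [c0 C0 h1 h2]]] := dirnorm_bounds; split.
- apply: (@continuous_lipschitz _ _ _ (K * `|z|)); first by rewrite mulr_ge0 // ltW.
  exact: biseminorm_distr dirnormDr dirnorm_le _.
- by move=> t x; exact: dirnormZr.
- by exists (c * `|z|), (C * `|z|); split=> //; exact: mulr_gt0.
Qed.

Lemma affine_floorE z : affine_floor p O w z = gauge_energy p (dirnorm z).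
Proof. by []. Qed.

Lemma affine_floor0 : affine_floor p O w (0 : 'rV[R]_m) = 0.
Proof.
rewrite affine_floorE; apply: (gauge_energy0 p n0) => xi.
by have := dirnormZl 0 0 xi; rewrite scaler0 normr0 mul0r.
Qed.

Lemma affine_floorZ t z : 0 <= t -> affine_floor p O w (t *: z) = t * affine_floor p O w z.
Proof.
rewrite le_eqVlt => /predU1P[<-|t0]; first by rewrite scale0r mul0r affine_floor0.
have [->|z0] := eqVneq z 0; first by rewrite scaler0 affine_floor0 mulr0.
rewrite !affine_floorE; apply: (gauge_energy_scale n0 p1) => //.
- by apply: is_gauge_dirnorm; rewrite scaler_eq0 negb_or gt_eqF.
- exact: is_gauge_dirnorm.
- by move=> x; rewrite dirnormZl gtr0_norm.
Qed.

(** Monotonicity of the energy compares the gauge of [z] with multiples of [enorm], whose energy [B]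
    is a fixed positive number. *)
Lemma affine_floor_bounds : exists c C : R, [/\ 0 < c, 0 < C,
  forall z, c * `|z| <= affine_floor p O w z & forall z, affine_floor p O w z <= C * `|z|].
Proof.
have [c [C [c0 C0 h1 h2]]] := dirnorm_bounds.
have B0 := gauge_energy_gt0 n0 p1 is_gauge_enorm; set B := gauge_energy p _ in B0.
exists (c * B), (C * B); split; [exact: mulr_gt0|exact: mulr_gt0|..] => z.
  have [->|z0] := eqVneq z 0; first by rewrite normr0 mulr0 affine_floor0.
  have nz : 0 < `|z| by rewrite normr_gt0.
  have cz : 0 < c * `|z| by exact: mulr_gt0.
  have := gauge_energy_le n0 p1 is_gauge_enorm (is_gauge_dirnorm z0) (lam := (c * `|z|)^-1).
  rewrite invr_gt0 => /(_ cz) h; rewrite mulrAC -ler_pdivlMl // h // => x.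
  by rewrite ler_pdivlMl.
have [->|z0] := eqVneq z 0; first by rewrite normr0 mulr0 affine_floor0.
have nz : 0 < `|z| by rewrite normr_gt0.
rewrite mulrAC; apply: (gauge_energy_le n0 p1 (is_gauge_dirnorm z0) is_gauge_enorm) => //.
exact: mulr_gt0.
Qed.

Lemma continuous_affine_floor : continuous (affine_floor p O w (m := m)).
Proof.
have [b [B [b0 B0 hb hB]]] := affine_floor_bounds.
move=> z; have [->|z0] := eqVneq z 0.
  (* At 0 the directional norm is not a gauge, and continuity comes from the linear upper bound
     instead. *)
  apply: (@continuous_of_lipschitz_at _ _ _ 0 1 B) => //; first exact: ltW.
  move=> y _; rewrite affine_floor0 !sub0r !normrN ger0_norm //.
  by rewrite (le_trans _ (hb y)) // mulr_ge0 // ltW.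
have [c [C [c0 C0 h1 h2]]] := dirnorm_bounds.
have nz : 0 < `|z| by rewrite normr_gt0.
have cz : 0 < c * `|z| by exact: mulr_gt0.
(* [L |z - y|] is the relative size of the perturbation: [C |z - y|] against the lower bound [c |z|]
   for the gauge of [z]. *)
pose L := C / (c * `|z|); have L0 : 0 < L by exact: divr_gt0.
have fz0 : 0 <= affine_floor p O w z by rewrite (le_trans _ (hb z)) // mulr_ge0 // ltW.
(* Within [|z|] the point [y] stays nonzero; within [1 / L] the relative error stays below 1, so
   that [1 - del] can be inverted. *)
have d0 : 0 < Num.min `|z| L^-1 by rewrite lt_min nz invr_gt0.
apply: (@continuous_of_lipschitz_at _ _ _ z _ (L * affine_floor p O w z) d0).
  by rewrite mulr_ge0 // ltW.
move=> y; rewrite lt_min => /andP[yz yL].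
have y0 : y != 0 by apply: contraTneq yz => ->; rewrite subr0 ltxx.
pose del := L * `|z - y|.
have del0 : 0 <= del by rewrite mulr_ge0 // ltW.
have del1 : del < 1 by rewrite /del -ltr_pdivlMl // mulr1.
have Nz x : C * `|z - y| * enorm x <= del * dirnorm z x.
  rewrite /del /L; apply: (@le_trans _ _ (C / (c * `|z|) * `|z - y| * (c * `|z| * enorm x))).
    rewrite le_eqVlt; apply/orP; left; apply/eqP; field.
    by rewrite !gt_eqF.
  by rewrite ler_wpM2l.
have up x : dirnorm y x <= (1 + del) * dirnorm z x.
  have := dirnormDl z (y - z) x; rewrite addrCA subrr addr0 mulrDl mul1r => /le_trans; apply.
  by rewrite lerD2l (le_trans (h2 _ _)) // distrC.
have down x : dirnorm z x <= (1 - del)^-1 * dirnorm y x.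
  rewrite ler_pdivlMl ?subr_gt0 // mulrBl mul1r lerBlDr.
  have := dirnormDl y (z - y) x; rewrite addrCA subrr addr0 => /le_trans; apply.
  by rewrite lerD2l (le_trans (h2 _ _)).
have gz := is_gauge_dirnorm z0; have gy := is_gauge_dirnorm y0.
have E1 : affine_floor p O w y <= (1 + del) * affine_floor p O w z.
  have lam0 : 0 < 1 + del by rewrite ltr_wpDr.
  exact: (gauge_energy_le n0 p1 gy gz lam0 up).
have E2 : affine_floor p O w z <= (1 - del)^-1 * affine_floor p O w y.
  have lam0 : 0 < (1 - del)^-1 by rewrite invr_gt0 subr_gt0.
  exact: (gauge_energy_le n0 p1 gz gy lam0 down).
rewrite ler_pdivlMl ?subr_gt0 // in E2.
have -> : L * affine_floor p O w z * `|z - y| = del * affine_floor p O w z by rewrite mulrAC.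
move: E1 E2; rewrite mulrDl mulrBl mul1r => E1 E2.
by rewrite ler_distlC E1 E2.
Qed.

End Floor.

(** * Equivalence of norms and conclusion *)

Lemma norm1pm_bounds (R : realType) n (p : R) (O : set 'rV[R]_n) (M : R)
    (w : nat -> 'rV[R]_n -> R) (m : nat) :
  (0 < n)%N -> 1 < p -> open O -> 0 <= M -> O `<=` cbox (const_mx (- M)) (const_mx M) ->
  schauder_basis p O w -> exists c C : R, [/\ 0 < c, 0 < C,
    forall z : 'rV[R]_m, c * `|z| <= norm1pm p O w z & forall z : 'rV[R]_m, norm1pm p O w z <= C * `|z|].
Proof.
move=> n0 p1 oO M0 OM bw.
have [c [C [c0 C0 h1 h2]]] := dirnorm_bounds n0 p1 oO M0 OM m bw.
(* In a coordinate direction the directional norm is the norm of one gradient component. One such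
   component gives the lower bound; all of them, with the norms of the [w j], give the upper one. *)
have gradE (z : 'rV[R]_m) i : dirnorm p O w z (unitv R i) = Lp_norm p O (wgrad p O (combo w z) i).
  congr Lp_norm; apply/funext => x; rewrite /dir_grad (bigD1 i) //= big1 ?addr0 => [|j ji].
    by rewrite mxE !eqxx mul1r.
  by rewrite mxE eqxx (negbTE ji) mul0r.
have Wz (z : 'rV[R]_m) : W1p p O (combo w z) by exact: (combo_W0 p1 oO M0 OM bw z).1.
have e1 (i : 'I_n) : 1 <= enorm (unitv R i).
  by apply: le_trans (norm_coord_le_enorm _ i); rewrite mxE !eqxx normr1.
pose A := \sum_(j < m) Lp_norm p O (w j); pose E := \sum_(i < n) C * enorm (unitv R i).
have A0 : 0 <= A by apply: sumr_ge0 => j _; exact: Lp_norm_ge0.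
have E0 : 0 <= E by apply: sumr_ge0 => i _; rewrite mulr_ge0 ?enorm_ge0 // ltW.
exists c, (1 + (A + E)); split=> //; first by rewrite ltr_wpDr // addr_ge0.
  move=> z; have [_ h _] := W_norm_bounds p1 oO (Wz z).
  apply: le_trans (h (Ordinal n0)); rewrite -gradE; apply: le_trans (h1 _ _).
  by rewrite ler_peMr ?e1 // mulr_ge0 // ltW.
move=> z; have [_ _ h] := W_norm_bounds p1 oO (Wz z).
apply: (le_trans h); apply: (@le_trans _ _ ((A + E) * `|z|)); last first.
  by rewrite ler_wpM2r // lerDr.
rewrite mulrDl; apply: lerD.
  have L (j : 'I_m) := W1p_inLp (bw.1 j).1.
  apply: (le_trans (inLp_lincomb p1 oO (index_enum 'I_m) (fun j => z ord0 j) L).2).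
  rewrite mulr_suml; apply: ler_sum => j _; rewrite mulrC.
  by apply: (ler_wpM2l (Lp_norm_ge0 _ _ _)); exact: norm_coord_le.
rewrite mulr_suml; apply: ler_sum => i _; rewrite -gradE.
by apply: (le_trans (h2 _ _)); rewrite mulrAC.
Qed.

(** Continuity is assumed with respect to [norm1pm]; the equivalence of norms converts it to the
    topology of row vectors. *)
Lemma continuous_of_norm (R : realType) m (N : 'rV[R]_m -> R) (c C : R) (F : 'rV[R]_m -> 'rV[R]_m) :
  0 < c -> 0 < C -> (forall z, c * `|z| <= N z) -> (forall z, N z <= C * `|z|) ->
  (forall z (e : R), 0 < e -> exists d : R, 0 < d /\
     forall y, N (y - z) < d -> N (F y - F z) < e) -> continuous F.
Proof.
move=> c0 C0 hc hC cF z; apply: (proj2 (@cvgrPdist_lt _ _ _ (nbhs z) _ F (F z))) => e e0.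
have [d [d0 hd]] := cF z (c * e) (mulr_gt0 c0 e0).
apply/nbhs_ballP; exists (d / C); first exact: divr_gt0.
move=> y; rewrite -ball_normE /= ltr_pdivlMr // => yd.
rewrite -(ltr_pM2l c0) distrC; apply: (le_lt_trans (hc _)); apply: hd.
by apply: (le_lt_trans (hC _)); rewrite mulrC distrC.
Qed.

Theorem theorem1p1 (R : realType) (n : nat) (p : R) (O : set 'rV[R]_n)
  (w : nat -> 'rV[R]_n -> R) (m : nat) (F : 'rV[R]_m -> 'rV[R]_m) (rho : R) :
  (2 <= n)%N -> 1 < p ->
  open O -> (exists M : R, forall x, O x -> enorm x <= M) ->
  schauder_basis p O w ->
  (1 <= m)%N ->
  (forall z (e : R), 0 < e -> exists d : R, 0 < d /\
     forall y, norm1pm p O w (y - z) < d ->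
               norm1pm p O w (F y - F z) < e) ->
  0 < rho ->
  (forall z, affine_floor p O w z = rho -> 0 <= inner (F z) z) ->
  exists z0 : 'rV[R]_m, affine_floor p O w z0 <= rho /\ F z0 = 0.
Proof.
move=> n2 p1 oO [M hM] bw _ cF rho0 hF.
have n0 : (0 < n)%N by exact: leq_trans n2.
(* The given bound can be negative only if [O] is empty; the maximum covers that case. *)
have M0 : 0 <= Num.max M 0 by rewrite le_max lexx orbT.
have OM : O `<=` cbox (const_mx (- Num.max M 0)) (const_mx (Num.max M 0)).
  move=> x /hM xM i; rewrite !mxE -ler_norml le_max.
  by rewrite (le_trans (norm_coord_le_enorm x i) xM).
have [c [C [c0 C0 h1 h2]]] := norm1pm_bounds m n0 p1 oO M0 OM bw.
have [b [B [b0 B0 hb _]]] := affine_floor_bounds n0 p1 oO M0 OM m bw.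
apply: (@gauge_zero R m F (affine_floor p O w (m := m)) rho b^-1) => //.
- exact: continuous_of_norm c0 C0 h1 h2 cF.
- exact: (continuous_affine_floor n0 p1 oO M0 OM bw).
- by move=> t z t0; exact: (affine_floorZ n0 p1 oO M0 OM bw).
- by rewrite invr_ge0 ltW.
- move=> z j; rewrite ler_pdivlMl //; apply: le_trans (hb z).
  by rewrite ler_wpM2l ?norm_coord_le // ltW.
Qed.
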